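(* Let $p<q$, $q\neq p+1$, with $p,q$ sufficiently large (i.e. $p,q\geq N$ for a suitable absolute constant $N$). Let $\Gamma$ be a finitely generated group and let $\rho_0:\Gamma\to SO(p,q)$ be a representation whose image is contained in and Zariski dense in $SO(p)\times SO(q)$. Then there exists an open neighborhood of $\rho_0$ in $X_{\Gamma,SO(p,q)}$ (in the real topology) such that each point $\rho$ in the neighborhood satisfies precisely one of the following conditions: (a) The Zariski closure of $\rho(\Gamma)$ is $SO(p,q)$. (b) The Zariski closure of $\rho(\Gamma)$ is conjugate to $SO(p)\times SO(q)$.
   Context: $SO(p,q)$ is the indefinite special orthogonal group of signature $(p,q)$, regarded as a linear algebraic group over $\mathbb{R}$; $SO(p)\times SO(q)\subset SO(p,q)$ is the standard block-diagonal subgroup. $X_{\Gamma,SO(p,q)}=\operatorname{Hom}(\Gamma,SO(p,q))$ is the representation variety, an affine scheme of finite type over $\mathbb{R}$; points are real points, i.e. homomorphisms $\Gamma\to SO(p,q)$ into the real group. Conjugacy is in $SO(p,q)$. *)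

(* Defs.v *)
From HB Require Import structures.
From mathcomp Require Import all_boot all_order all_algebra.
From mathcomp Require Import all_classical all_reals all_analysis.
(* Not imported: the notations of mpoly clash with those of all_analysis. *)
From mathcomp Require mpoly.

Import Order.TTheory GRing.Theory Num.Theory.
Import numFieldNormedType.Exports.

Local Open Scope classical_set_scope.
Local Open Scope ring_scope.

Definition finitely_generated (G : groupType) : Prop :=
  exists s : seq G, forall H : {pred G},
    group_closed H -> {subset s <= H} -> forall x, x \in H.

(* The algebraic groups below are represented by their sets of real points. *)

Definition SO (R : realType) (n : nat) : set 'M[R]_n :=
  [set A | A^T *m A = 1%:M /\ \det A = 1].

Definition indef_form (R : realType) (p q : nat) : 'M[R]_(p + q) :=
  block_mx 1%:M 0 0 (- 1%:M).

Definition SOpq (R : realType) (p q : nat) : set 'M[R]_(p + q) :=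
  [set A | A^T *m indef_form R p q *m A = indef_form R p q /\ \det A = 1].

Definition SOp_x_SOq (R : realType) (p q : nat) : set 'M[R]_(p + q) :=
  [set block_mx A 0 0 B | A in SO R p & B in SO R q].

Definition conjugate_in {R : realType} {n : nat} (G H K : set 'M[R]_n) : Prop :=
  exists2 g, G g & H = [set g *m A *m invmx g | A in K].

(* Zariski topology on the affine space of n x n matrices; the n ^ 2
   coordinates are the entries, listed by mxvec.  A closed subgroup of SO(p,q)
   is Zariski closed in this affine space, so closures of subsets of SO(p,q)
   may be taken here. *)

Definition zariski_closed {R : realType} {n : nat} (Z : set 'M[R]_n) : Prop :=
  exists I : set (mpoly.mpoly (n * n) R),
    Z = [set A | forall f, I f -> mpoly.meval (fun k => mxvec A 0 k) f = 0].

Definition zariski_closure {R : realType} {n : nat} (S : set 'M[R]_n) :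
  set 'M[R]_n := smallest zariski_closed S.

(* Real points of Hom(Gamma, SO(p,q)).  As a type, this set carries the subspace
   topology of the topology of pointwise convergence.  For a finitely generated
   Gamma, this is the real topology of the representation variety: all
   coordinates rho |-> rho x i j are polynomials in those for x in a finite
   symmetric generating set.  Multiplicativity forces rho 1 = 1, the values
   being invertible. *)
Definition repvar (R : realType) (Gamma : groupType) (p q : nat) :
    set {ptws Gamma -> 'M[R]_(p + q)} :=
  [set rho | (forall x, SOpq R p q (rho x)) /\
             (forall x y, rho (x * y)%g = rho x *m rho y)].

Definition rep_image {R : realType} {Gamma : groupType} {p q : nat}
  (rho : repvar R Gamma p q) : set 'M[R]_(p + q) := range (set_val rho).

(* Main.v *)
(* Lie algebras are replaced by Zariski tangent spaces at 1, defined through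
   polynomial functions with formal derivatives; a tangent vector is turned
   back into group elements of the closure by rational Cayley curves.

   Zariski density puts all plane rotations of the two blocks in the closure
   of rho0(Gamma).  Hence finitely many group elements witness two properties
   of rho0 that persist for every rho near rho0: some of them are close to 1
   and have a common commutant close to that of SO(p) x SO(q), and suitable
   combinations of the Ad(rho x) approximate the operators X |-> X_cd E_ab for
   pairs (a, b), (c, d) of the same block type.  Zassenhaus' commutator
   argument then shows that 1 is not isolated in rho(Gamma), so the tangent
   space h of its closure is nonzero; by the second property, for each of the
   three block types, h contains approximations of all the E_ab or of none.

   If the mixed type occurs, brackets produce the other two and a contraction
   argument gives h = so(p,q), which is case (a).  Otherwise the Casimir
   operator of h commutes with rho(Gamma) and, as p <> q, has distinct diagonal
   entries on the two blocks; it yields a J-selfadjoint idempotent e in the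
   commutant of rho(Gamma), close to the projection on the second block.
   Zassenhaus' argument in both corners of e shows that both diagonal types
   occur, so h is the centraliser of e in so(p,q), and a J-orthonormal basis
   adapted to e conjugates the closure to SO(p) x SO(q). *)

Require Import Defs.
From HB Require Import structures.
From mathcomp Require Import all_boot all_order all_algebra all_fingroup.
From mathcomp Require Import all_classical all_reals all_analysis.
From mathcomp Require mpoly.
From mathcomp Require Import ring lra zify.

Set Implicit Arguments.
Unset Strict Implicit.
Unset Printing Implicit Defensive.

Import Order.TTheory GRing.Theory Num.Theory.
Import numFieldNormedType.Exports.
Local Open Scope ring_scope.

(** * The entrywise maximum norm *)

Section MatrixNorm.
Variable R : realFieldType.

(** Density of the image is not an open condition, so what is kept of [rho0] is a finite system of
    inequalities, and h, which need not vary continuously with [rho], is known only through vectors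
    within O([eta]) of some E_ab. Exact statements are recovered by maps that halve the norm, or
    because a matrix commuting with the image is determined by one diagonal entry per block. The
    finite witnesses come from duality: a vector killed by every functional that kills a given
    family is a finite combination of the family, and its coefficients stay fixed while [rho] moves.
    Knowing h leaves components undecided: the centraliser of e in SO(p,q) also contains elements of
    determinant -1 on both blocks. Corner determinants are signs, close to 1 on a finite generating
    set, hence 1 everywhere. The bound 5 on p and q comes from half-turns: isolating a matrix entry
    takes a further index of a given block outside four given ones. Powers of n = p + q occur in the
    constants because the maximum norm is submultiplicative only up to a factor n. *)

Definition nrm m n (A : 'M[R]_(m, n)) : R :=
  \big[Num.max/0]_(ij : 'I_m * 'I_n) `|A ij.1 ij.2|.

Lemma nrm_entry m n (A : 'M[R]_(m, n)) i j : `|A i j| <= nrm A.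
Proof. exact: (le_bigmax _ (fun ij : 'I_m * 'I_n => `|A ij.1 ij.2|) (i, j)). Qed.

Lemma nrm_le m n (A : 'M[R]_(m, n)) c :
  0 <= c -> (forall i j, `|A i j| <= c) -> nrm A <= c.
Proof. by move=> c0 H; apply/bigmax_leP; split=> // -[i j] _; apply: H. Qed.

Lemma nrm_ge0 m n (A : 'M[R]_(m, n)) : 0 <= nrm A.
Proof.
rewrite /nrm; elim/big_rec: _ => // ij x _ x0.
by rewrite le_max normr_ge0.
Qed.

Lemma nrm_eq0 m n (A : 'M[R]_(m, n)) : nrm A <= 0 -> A = 0.
Proof.
move=> A0; apply/matrixP=> i j; rewrite mxE; apply/eqP.
by rewrite -normr_le0 (le_trans (nrm_entry A i j)).
Qed.

Lemma nrm_gt0 m n (A : 'M[R]_(m, n)) : A != 0 -> 0 < nrm A.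
Proof.
move=> A0; rewrite lt_def nrm_ge0 andbT; apply: contra A0 => /eqP A0.
by apply/eqP/nrm_eq0; rewrite A0.
Qed.

Lemma nrm0 m n : nrm (0 : 'M[R]_(m, n)) = 0.
Proof.
by apply/le_anti; rewrite nrm_ge0 nrm_le // => i j; rewrite mxE normr0.
Qed.

Lemma nrm_attained m n (A : 'M[R]_(m, n)) :
  A != 0 -> exists i j, nrm A = `|A i j|.
Proof.
move=> A0; have /existsP[i0 /existsP[j0 _]] :
    [exists i, [exists j, A i j != 0]].
  apply: contraR A0; rewrite negb_exists => /forallP H; apply/eqP/matrixP => i j.
  rewrite mxE; have := H i; rewrite negb_exists => /forallP /(_ j).
  by rewrite negbK => /eqP.
pose f (ij : 'I_m * 'I_n) := `|A ij.1 ij.2|.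
case: (@arg_maxP _ R _ (i0, j0) predT f) => // -[i j] _ H.
exists i, j; apply/le_anti; rewrite nrm_entry andbT nrm_le //.
by move=> k l; exact: (H (k, l)).
Qed.

Lemma nrmD m n (A B : 'M[R]_(m, n)) : nrm (A + B) <= nrm A + nrm B.
Proof.
apply: nrm_le => [|i j]; first by rewrite addr_ge0 ?nrm_ge0.
by rewrite mxE (le_trans (ler_normD _ _)) // lerD ?nrm_entry.
Qed.

Lemma nrmN m n (A : 'M[R]_(m, n)) : nrm (- A) = nrm A.
Proof. by apply: eq_bigr => ij _; rewrite mxE normrN. Qed.

Lemma nrmB m n (A B : 'M[R]_(m, n)) : nrm (A - B) <= nrm A + nrm B.
Proof. by rewrite -[nrm B]nrmN nrmD. Qed.

Lemma nrmZ m n c (A : 'M[R]_(m, n)) : nrm (c *: A) <= `|c| * nrm A.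
Proof.
apply: nrm_le => [|i j]; first by rewrite mulr_ge0 ?nrm_ge0.
by rewrite mxE normrM ler_wpM2l ?nrm_entry.
Qed.

Lemma nrm_tr m n (A : 'M[R]_(m, n)) : nrm A^T = nrm A.
Proof.
apply/le_anti/andP; split; apply: nrm_le; rewrite ?nrm_ge0 // => i j.
  by rewrite mxE nrm_entry.
by rewrite -[A i j]/(A i j) -{1}(trmxK A) mxE nrm_entry.
Qed.

Lemma nrmM m n k (A : 'M[R]_(m, n)) (B : 'M[R]_(n, k)) :
  nrm (A *m B) <= n%:R * nrm A * nrm B.
Proof.
apply: nrm_le => [|i j]; first by rewrite !mulr_ge0 ?nrm_ge0.
rewrite mxE (le_trans (ler_norm_sum _ _ _)) //.
rewrite (@le_trans _ _ (\sum_(l < n) nrm A * nrm B)) //.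
  by apply: ler_sum => l _; rewrite normrM ler_pM ?nrm_entry.
by rewrite sumr_const card_ord -[leLHS]mulr_natl mulrA.
Qed.

Lemma nrmM_le m n k (A : 'M[R]_(m, n)) (B : 'M[R]_(n, k)) a b :
  nrm A <= a -> nrm B <= b -> nrm (A *m B) <= n%:R * a * b.
Proof.
move=> ha hb; apply: le_trans (nrmM A B) _.
by rewrite ler_pM ?mulr_ge0 ?nrm_ge0 // ler_wpM2l.
Qed.

Lemma nrm_sum m n I (r : seq I) (P : pred I) (F : I -> 'M[R]_(m, n)) :
  nrm (\sum_(i <- r | P i) F i) <= \sum_(i <- r | P i) nrm (F i).
Proof.
elim/big_rec2: _ => [|i x A _ H]; first by rewrite nrm0.
by rewrite (le_trans (nrmD _ _)) // lerD2l.
Qed.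

Lemma nrm_scalar_le n (c : R) : nrm (c%:M : 'M[R]_n) <= `|c|.
Proof.
by apply: nrm_le => // i j; rewrite mxE; case: (_ == _); rewrite ?mulr1n ?mulr0n ?normr0.
Qed.

End MatrixNorm.

(** * Subspaces and finite spans *)

Section Subspaces.
Variable R : fieldType.

(** Among the matrices whose row space satisfies [P], one of maximal rank catches every vector of
    [P]: stacking a missed vector would raise the rank. *)
Lemma subspace_matrix N (P : 'rV[R]_N -> Prop) :
  P 0 -> (forall a u v, P u -> P v -> P (a *: u + v)) ->
  exists B : 'M[R]_N, forall v, P v <-> (v <= B)%MS.
Proof.
move=> P0 PL.
pose Q (B : 'M[R]_N) := forall v : 'rV_N, (v <= B)%MS -> P v.
have PM (u : 'rV[R]_N) a : P u -> P (a *: u).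
  by move=> Pu; rewrite -[_ *: _]addr0; apply: PL.
pose rk r := `[< exists2 B, Q B & \rank B = r >].
have ex : exists r, rk r.
  by exists 0%N; apply/asboolP; exists 0; rewrite ?mxrank0 // => v /submx0null ->.
have bd r : rk r -> (r <= N)%N by move=> /asboolP[B _ <-]; apply: rank_leq_row.
case: (ex_maxnP ex bd) => r /asboolP[B QB rB] rmax; exists B => v; split; last exact: QB.
move=> Pv; apply: contraT => nvB.
have QBv : Q (B + v)%MS.
  move=> w /sub_addsmxP[[u1 u2] ->] /=; rewrite [u2 *m v]mulmx_sum_row.
  rewrite big_ord1 (_ : row 0 v = v); last by apply/rowP => i; rewrite mxE.
  by rewrite addrC; apply: PL => //; apply: QB; apply: submxMl.
have := rmax (\rank (B + v)%MS) _.
have -> : rk (\rank (B + v)%MS) by apply/asboolP; exists (B + v)%MS.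
move=> /(_ isT); rewrite -rB leqNgt => /negP; case; apply: rank_ltmx.
by rewrite ltmxE addsmxSl /=; apply: contra nvB; apply: submx_trans; apply: addsmxSr.
Qed.

(** The columns of [cokermx] of a matrix of the span are functionals that kill it. [T] may be
    infinite while the combination is finite: this is how statements about all group elements yield
    finitely many witnesses. *)
Lemma span_of_annihilator T N (u : T -> 'rV[R]_N) (v : 'rV[R]_N) :
  (forall phi : 'cV[R]_N, (forall x, u x *m phi = 0) -> v *m phi = 0) ->
  exists s : seq (R * T), v = \sum_(x <- s) x.1 *: u x.2.
Proof.
move=> H.
pose P w := exists s : seq (R * T), w = \sum_(x <- s) x.1 *: u x.2.
have P0 : P 0 by exists [::]; rewrite big_nil.
have PL a w w' : P w -> P w' -> P (a *: w + w').
  move=> [s ->] [s' ->]; exists ([seq (a * x.1, x.2) | x <- s] ++ s').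
  rewrite big_cat big_map scaler_sumr; congr (_ + _).
  by apply: eq_bigr => x _; rewrite scalerA.
have [B PB] := subspace_matrix P0 PL; apply/PB.
rewrite submxE; apply/eqP/row_matrixP => i; apply/rowP => j.
have HE (w : 'rV[R]_N) : w *m col j (cokermx B) = col j (w *m cokermx B).
  by rewrite !colE mulmxA.
have H' : v *m col j (cokermx B) = 0.
  apply: H => x; have : (u x <= B)%MS.
    by apply/PB; exists [:: (1, x)]; rewrite big_seq1 scale1r.
  by rewrite HE submxE => /eqP ->; rewrite col0.
have := congr1 (fun M : 'M[R]_1 => M i 0) H'.
by rewrite HE !mxE.
Qed.

Lemma span_of_annihilator_fin (I : finType) T (u : T -> I -> R) (v : I -> R) :
  (forall phi : I -> R, (forall x, \sum_i u x i * phi i = 0) ->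
     \sum_i v i * phi i = 0) ->
  exists s : seq (R * T), forall i, v i = \sum_(x <- s) x.1 * u x.2 i.
Proof.
move=> H.
pose vec (f : I -> R) : 'rV[R]_#|I| := \row_k f (enum_val k).
have [phi Hphi|s Hs] := @span_of_annihilator T _ (fun x => vec (u x)) (vec v).
  have E f : (vec f *m phi) = (\sum_i f i * phi (enum_rank i) 0)%:M.
    apply/matrixP => a b; rewrite !ord1 !mxE eqxx mulr1n.
    rewrite (reindex (fun k : 'I_#|I| => enum_val k)) /=; last first.
      by exists enum_rank => x _; rewrite ?enum_rankK ?enum_valK.
    by apply: eq_bigr => k _; rewrite mxE enum_valK.
  rewrite E H ?raddf0 // => x; move: (Hphi x); rewrite E => /matrixP /(_ 0 0).
  by rewrite !mxE eqxx mulr1n.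
exists s => i; have := congr1 (fun M : 'rV_#|I| => M 0 (enum_rank i)) Hs.
rewrite mxE enum_rankK summxE => ->.
by apply: eq_bigr => x _; rewrite !mxE enum_rankK.
Qed.

End Subspaces.

(** * Polynomial functions and tangent spaces *)

Section PolynomialFunctions.
Variables (R : realFieldType) (n : nat).
Notation M := 'M[R]_n.

(* [pf F dF ddF]: [F] is polynomial in the entries, with first and second
   derivatives [dF A X] and [ddF A X Y] at [A]. *)
Inductive pf : (M -> R) -> (M -> M -> R) -> (M -> M -> M -> R) -> Prop :=
| pf_const c : pf (fun=> c) (fun _ _ => 0) (fun _ _ _ => 0)
| pf_coord i j : pf (fun A => A i j) (fun _ X => X i j) (fun _ _ _ => 0)
| pf_add F dF ddF G dG ddG : pf F dF ddF -> pf G dG ddG ->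
    pf (fun A => F A + G A) (fun A X => dF A X + dG A X)
       (fun A X Y => ddF A X Y + ddG A X Y)
| pf_mul F dF ddF G dG ddG : pf F dF ddF -> pf G dG ddG ->
    pf (fun A => F A * G A) (fun A X => dF A X * G A + F A * dG A X)
       (fun A X Y => ddF A X Y * G A + dF A X * dG A Y
                     + dF A Y * dG A X + F A * ddG A X Y).

Definition poly_fun F := exists dF ddF, pf F dF ddF.

Lemma pf_eq F dF ddF F' dF' ddF' : pf F dF ddF ->
  (forall A, F A = F' A) -> (forall A X, dF A X = dF' A X) ->
  (forall A X Y, ddF A X Y = ddF' A X Y) -> pf F' dF' ddF'.
Proof.
move=> H e1 e2 e3.
have -> : F' = F by apply/funext.
have -> : dF' = dF by apply/funext => A; apply/funext.
have -> // : ddF' = ddF.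
by apply/funext => A; apply/funext => X; apply/funext.
Qed.

Lemma pf_scale c F dF ddF : pf F dF ddF ->
  pf (fun A => c * F A) (fun A X => c * dF A X) (fun A X Y => c * ddF A X Y).
Proof.
move=> H; apply: pf_eq (pf_mul (pf_const c) H) _ _ _ => //= *.
  by rewrite mul0r add0r.
by rewrite !mul0r !add0r.
Qed.

Lemma pf_sum I (r : seq I) F dF ddF : (forall i : I, pf (F i) (dF i) (ddF i)) ->
  pf (fun A => \sum_(i <- r) F i A) (fun A X => \sum_(i <- r) dF i A X)
     (fun A X Y => \sum_(i <- r) ddF i A X Y).
Proof.
move=> H; elim: r => [|i r IH].
  by apply: pf_eq (pf_const 0) _ _ _ => *; rewrite big_nil.
by apply: pf_eq (pf_add (H i) IH) _ _ _ => *; rewrite big_cons.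
Qed.

Lemma pf_linear F dF ddF : pf F dF ddF ->
  forall A a X Y, dF A (a *: X + Y) = a * dF A X + dF A Y.
Proof.
elim=> {F dF ddF} [c|i j|F dF ddF G dG ddG _ IF _ IG|F dF ddF G dG ddG _ IF _ IG] A a X Y /=.
- by rewrite mulr0 addr0.
- by rewrite !mxE.
- by rewrite IF IG; ring.
- by rewrite IF IG; ring.
Qed.

Lemma pf_zero F dF ddF : pf F dF ddF -> forall A, dF A 0 = 0.
Proof. by move=> H A; have := pf_linear H A (-1) 0 0; rewrite scaler0 addr0 => ->; ring. Qed.

Lemma pf_scaler F dF ddF : pf F dF ddF -> forall A a X, dF A (a *: X) = a * dF A X.
Proof.
by move=> H A a X; rewrite -[_ *: _]addr0 (pf_linear H) (pf_zero H) addr0.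
Qed.

Lemma pf_sumr F dF ddF : pf F dF ddF -> forall A I (r : seq I) (X : I -> M),
  dF A (\sum_(i <- r) X i) = \sum_(i <- r) dF A (X i).
Proof.
move=> H A I r X; elim/big_rec2: _ => [|i x Y _ <-]; first exact: pf_zero H A.
by rewrite -[X i]scale1r (pf_linear H) mul1r scale1r.
Qed.

(** Makes the second-order terms cancel when two left-invariant fields are commuted. *)
Lemma pf_sym F dF ddF : pf F dF ddF -> forall A X Y, ddF A X Y = ddF A Y X.
Proof.
elim=> {F dF ddF} // [F dF ddF G dG ddG _ IF _ IG|F dF ddF G dG ddG _ IF _ IG] A X Y /=.
  by rewrite IF IG.
by rewrite IF IG; ring.
Qed.

Lemma pf_entry (U W : M) i j :
  pf (fun A => (U *m A *m W) i j) (fun _ X => (U *m X *m W) i j) (fun _ _ _ => 0).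
Proof.
have h := pf_sum (index_enum 'I_n) (fun l => pf_scale (W l j)
  (pf_sum (index_enum 'I_n) (fun k => pf_scale (U i k) (pf_coord k l)))).
apply: pf_eq h _ _ _ => [A|A X|A X Y] /=.
- rewrite mxE; apply: eq_bigr => l _; rewrite mulrC; congr (_ * _).
  by rewrite mxE.
- rewrite mxE; apply: eq_bigr => l _; rewrite mulrC; congr (_ * _).
  by rewrite mxE.
- by rewrite big1 // => l _; rewrite big1 ?mulr0 // => k _; rewrite mulr0.
Qed.

Lemma pf_subst (U W : M) F dF ddF : pf F dF ddF ->
  pf (fun A => F (U *m A *m W)) (fun A X => dF (U *m A *m W) (U *m X *m W))
     (fun A X Y => ddF (U *m A *m W) (U *m X *m W) (U *m Y *m W)).
Proof.
elim=> {F dF ddF} [c|i j|F dF ddF G dG ddG _ IF _ IG|F dF ddF G dG ddG _ IF _ IG].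
- exact: pf_const.
- exact: pf_entry.
- exact: pf_add IF IG.
- exact: pf_mul IF IG.
Qed.

(* [fun A => dF A (A *m X)] is the derivative of [F] along the left-invariant
   vector field of [X]. *)
Lemma pf_left_inv X F dF ddF : pf F dF ddF -> exists d2,
  pf (fun A => dF A (A *m X)) (fun A Y => ddF A (A *m X) Y + dF A (Y *m X)) d2.
Proof.
elim=> {F dF ddF} [c|i j|F dF ddF G dG ddG hF [IF HF] hG [IG HG]|F dF ddF G dG ddG hF [IF HF] hG [IG HG]].
- exists (fun _ _ _ => 0); apply: pf_eq (pf_const 0) _ _ _ => //= *; by rewrite addr0.
- exists (fun _ _ _ => 0); apply: pf_eq (pf_entry 1%:M X i j) _ _ _ => //= *.
    by rewrite mul1mx.
  by rewrite add0r mul1mx.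
- eexists; apply: pf_eq (pf_add HF HG) _ _ _ => //= *; ring.
- eexists; apply: pf_eq (pf_add (pf_mul HF hG) (pf_mul hF HG)) _ _ _ => //= *; ring.
Qed.

Lemma pf_dbound F dF ddF : pf F dF ddF -> forall A,
  exists2 C, 0 <= C & forall X, `|dF A X| <= C * nrm X.
Proof.
move=> H A; exists (\sum_(i < n) \sum_(j < n) `|dF A (delta_mx i j)|).
  by apply: sumr_ge0 => i _; apply: sumr_ge0.
move=> X; rewrite {1}(matrix_sum_delta X) (pf_sumr H).
rewrite (le_trans (ler_norm_sum _ _ _)) // mulr_suml; apply: ler_sum => i _.
rewrite (pf_sumr H) (le_trans (ler_norm_sum _ _ _)) // mulr_suml; apply: ler_sum => j _.
by rewrite (pf_scaler H) normrM mulrC ler_wpM2l ?nrm_entry.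
Qed.

Lemma pf_taylor F dF ddF : pf F dF ddF -> forall A, exists2 C, 0 <= C &
  forall X, nrm X <= 1 -> `|F (A + X) - F A - dF A X| <= C * nrm X ^+ 2.
Proof.
elim=> {F dF ddF} [c|i j|F dF ddF G dG ddG hF IF hG IG|F dF ddF G dG ddG hF IF hG IG] A.
- by exists 0 => // X _; rewrite mul0r !subr0 subrr normr0.
- by exists 0 => // X _; rewrite mul0r mxE (addrC (A i j)) addrK subrr normr0.
- have [C C0 HC] := IF A; have [D D0 HD] := IG A.
  exists (C + D) => [|X X1]; first by rewrite addr_ge0.
  rewrite (_ : _ - _ - _ = (F (A + X) - F A - dF A X) + (G (A + X) - G A - dG A X)); last by ring.
  by rewrite mulrDl (le_trans (ler_normD _ _)) // lerD ?HC ?HD.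
- have [C C0 HC] := IF A; have [D D0 HD] := IG A.
  have [c c0 Hc] := pf_dbound hF A; have [d d0 Hd] := pf_dbound hG A.
  exists (c * d + (`|F A| + c) * D + C * (`|G A| + d + D)) => [|X X1].
    by rewrite !addr_ge0 ?mulr_ge0 ?addr_ge0.
  have x0 := nrm_ge0 X.
  have x2 : nrm X ^+ 2 <= 1 by rewrite -(expr1n R 2) lerXn2r // nnegrE.
  move: (HC X X1) (HD X X1) (Hc X) (Hd X).
  set r := F (A + X) - _ - _; set s := G (A + X) - _ - _ => Hr Hs Hf Hg.
  (* Leibniz rule for remainders: the only new term is the product of the two first-order terms,
     which is quadratic. *)
  rewrite (_ : _ - _ = dF A X * dG A X + (F A + dF A X) * s + r * (G A + dG A X + s)); last first.
    by rewrite /r /s; ring.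
  rewrite 2!(mulrDl _ _ (nrm X ^+ 2)).
  apply: le_trans (ler_normD _ _) (lerD _ _).
    apply: le_trans (ler_normD _ _) (lerD _ _).
      by rewrite normrM expr2 mulrACA ler_pM.
    rewrite normrM -mulrA ler_pM // (le_trans (ler_normD _ _)) // lerD2l.
    by rewrite (le_trans Hf) // ler_piMr.
  rewrite normrM mulrAC ler_pM //.
  apply: le_trans (ler_normD _ _) (lerD _ _); last by rewrite (le_trans Hs) // ler_piMr.
  by rewrite (le_trans (ler_normD _ _)) // lerD2l (le_trans Hg) // ler_piMr.
Qed.

Lemma pf_lipschitz F dF ddF : pf F dF ddF -> forall A, exists2 C, 0 <= C &
  forall B, nrm (B - A) <= 1 -> `|F B - F A| <= C * nrm (B - A).
Proof.
move=> H A; have [C C0 HC] := pf_taylor H A; have [D D0 HD] := pf_dbound H A.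
exists (C + D) => [|B B1]; first by rewrite addr_ge0.
have := HC _ B1; have := HD (B - A); rewrite [A + _]addrC subrK => h2 h1.
have -> : F B - F A = (F B - F A - dF A (B - A)) + dF A (B - A) by ring.
rewrite mulrDl (le_trans (ler_normD _ _)) // lerD // (le_trans h1) // ler_wpM2l //.
by rewrite expr2 ler_piMr ?nrm_ge0.
Qed.

Lemma poly_const c : poly_fun (fun=> c).
Proof. by do 2!eexists; exact: pf_const. Qed.

Lemma poly_add F G : poly_fun F -> poly_fun G -> poly_fun (fun A => F A + G A).
Proof. by move=> [? [? H]] [? [? H']]; do 2!eexists; exact: pf_add H H'. Qed.

Lemma poly_mul F G : poly_fun F -> poly_fun G -> poly_fun (fun A => F A * G A).
Proof. by move=> [? [? H]] [? [? H']]; do 2!eexists; exact: pf_mul H H'. Qed.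

Lemma poly_entry (U W : M) i j : poly_fun (fun A => (U *m A *m W) i j).
Proof. by do 2!eexists; exact: pf_entry. Qed.

Lemma poly_coord i j : poly_fun (fun A => A i j).
Proof. by do 2!eexists; exact: pf_coord. Qed.

Lemma poly_sum I (r : seq I) F : (forall i : I, poly_fun (F i)) ->
  poly_fun (fun A => \sum_(i <- r) F i A).
Proof.
move=> H; elim: r => [|i r IH].
  by rewrite (_ : (fun _ => _) = fun=> 0); [exact: poly_const|apply/funext => A; rewrite big_nil].
rewrite (_ : (fun _ => _) = fun A => F i A + \sum_(j <- r) F j A).
  exact: poly_add.
by apply/funext => A; rewrite big_cons.
Qed.

Lemma poly_prod I (r : seq I) F : (forall i : I, poly_fun (F i)) ->
  poly_fun (fun A => \prod_(i <- r) F i A).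
Proof.
move=> H; elim: r => [|i r IH].
  by rewrite (_ : (fun _ => _) = fun=> 1); [exact: poly_const|apply/funext => A; rewrite big_nil].
rewrite (_ : (fun _ => _) = fun A => F i A * \prod_(j <- r) F j A).
  exact: poly_mul.
by apply/funext => A; rewrite big_cons.
Qed.

Lemma poly_exp F k : poly_fun F -> poly_fun (fun A => F A ^+ k).
Proof.
move=> H; elim: k => [|k IH].
  by under eq_fun do rewrite expr0; exact: poly_const.
by under eq_fun do rewrite exprS; exact: poly_mul.
Qed.

Lemma poly_ext F G : poly_fun F -> (forall A, F A = G A) -> poly_fun G.
Proof. by move=> H /funext <-. Qed.

Lemma poly_subst (U W : M) F : poly_fun F -> poly_fun (fun A => F (U *m A *m W)).
Proof. by move=> [? [? H]]; do 2!eexists; exact: pf_subst H. Qed.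

Lemma poly_det k (F : 'I_k -> 'I_k -> M -> R) : (forall i j, poly_fun (F i j)) ->
  poly_fun (fun A => \det (\matrix_(i, j) F i j A)).
Proof.
move=> H; apply: (@poly_ext (fun A => \sum_(s <- index_enum {perm 'I_k})
    (-1) ^+ s * \prod_(i <- index_enum 'I_k) F i (s i) A)).
  apply: poly_sum => s; apply: poly_mul; first exact: poly_const.
  by apply: poly_prod => i; exact: H.
move=> A; apply: eq_bigr => s _; congr (_ * _); apply: eq_bigr => i _.
by rewrite mxE.
Qed.

End PolynomialFunctions.

(** * Tangent spaces at the identity *)

Section TangentSpace.
Variables (R : realFieldType) (n : nat).
Notation M := 'M[R]_n.
Implicit Types S : M -> Prop.

Definition vanish S (F : M -> R) := forall s, S s -> F s = 0.

(* The Zariski closure of [S]; [tang S] is its tangent space at [1], meaningful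
   when [S 1]. *)
Definition zc S (A : M) := forall F, poly_fun F -> vanish S F -> F A = 0.

Definition tang S (X : M) :=
  forall F dF ddF, pf F dF ddF -> vanish S F -> dF 1%:M X = 0.

Lemma zc_sub S s : S s -> zc S s.
Proof. by move=> Ss F _; apply. Qed.

Lemma tang_lin S a X Y : tang S X -> tang S Y -> tang S (a *: X + Y).
Proof.
move=> hX hY F dF ddF H V.
by rewrite (pf_linear H) (hX _ _ _ H V) (hY _ _ _ H V) mulr0 addr0.
Qed.

Lemma tang0 S : tang S 0.
Proof. by move=> F dF ddF H _; exact: pf_zero H _. Qed.

Lemma tangZ S a X : tang S X -> tang S (a *: X).
Proof. by move=> h; rewrite -[_ *: _]addr0; apply: tang_lin => //; exact: tang0. Qed.

Lemma tangD S X Y : tang S X -> tang S Y -> tang S (X + Y).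
Proof. by move=> hX hY; rewrite -[X]scale1r; exact: tang_lin. Qed.

Lemma tangB S X Y : tang S X -> tang S Y -> tang S (X - Y).
Proof. by move=> hX hY; rewrite -scaleN1r; apply: tangD => //; exact: tangZ. Qed.

Lemma tang_sum S I (r : seq I) (X : I -> M) :
  (forall i, tang S (X i)) -> tang S (\sum_(i <- r) X i).
Proof.
by move=> H; elim/big_rec: _ => [|i x _ hx]; [exact: tang0|exact: tangD].
Qed.

Lemma tang_mono S S' X : (forall s, S' s -> zc S s) -> tang S' X -> tang S X.
Proof.
move=> H h F dF ddF hF V; apply: h (hF) _ => s /H; apply => //.
by exists dF, ddF.
Qed.

(** Left translation by [s] preserves the functions vanishing on the semigroup [S]; the derivative
    of the translate at 1 along [X] is the derivative of [F] at [s] along the left-invariant field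
    of [X]. *)
Lemma tang_derivation S X F dF ddF :
  (forall s t, S s -> S t -> S (s *m t)) -> tang S X ->
  pf F dF ddF -> vanish S F -> vanish S (fun A => dF A (A *m X)).
Proof.
move=> SM h hF V s Ss; have := h _ _ _ (pf_subst s 1%:M hF).
rewrite !mulmx1; apply => x Sx; rewrite mulmx1; apply: V; exact: SM.
Qed.

(** Each of [X] and [Y] is applied to the derivative of [F] along the field of the other; in the
    difference the symmetric [ddF] terms cancel and [dF 1%:M] at the bracket remains. *)
Lemma tang_bracket S X Y :
  (forall s t, S s -> S t -> S (s *m t)) -> tang S X -> tang S Y ->
  tang S (X *m Y - Y *m X).
Proof.
move=> SM hX hY F dF ddF hF V.
have [d2 hd] := pf_left_inv X hF; have [d2' hd'] := pf_left_inv Y hF.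
have e1 := hY _ _ _ hd (tang_derivation SM hX hF V).
have e2 := hX _ _ _ hd' (tang_derivation SM hY hF V).
rewrite addrC -scaleN1r (pf_linear hF).
move: e1 e2; rewrite !mul1mx (pf_sym hF 1%:M Y) => e1 e2; lra.
Qed.

(** Each entry of the equation is an affine function vanishing on [S], and its derivative is the
    same equation at [X]. It carries commutation with [S] over to tangent vectors. *)
Lemma tang_linear_eq S (U V W Z : M) X :
  (forall s, S s -> U *m (s - 1%:M) *m V = W *m (s - 1%:M) *m Z) ->
  tang S X -> U *m X *m V = W *m X *m Z.
Proof.
move=> H hX; apply/matrixP => i j; apply/eqP; rewrite -subr_eq0; apply/eqP.
pose c := - (U *m V - W *m Z) i j.
have h := pf_add (pf_add (pf_entry U V i j) (pf_scale (-1) (pf_entry W Z i j))) (pf_const _ c).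
have := hX _ _ _ h; rewrite /= addr0 mulN1r; apply => s /H /matrixP /(_ i j).
rewrite !mulmxBr !mulmxBl !mulmx1 /c !mxE; lra.
Qed.

Lemma tang_quadratic S (J : M) X :
  (forall s, S s -> s^T *m J *m s = J) -> tang S X -> X^T *m J + J *m X = 0.
Proof.
move=> H hX; apply/matrixP => i j.
have h := pf_add (pf_sum (index_enum 'I_n) (fun l => pf_sum (index_enum 'I_n) (fun k =>
   pf_mul (pf_scale (J k l) (pf_coord R k i)) (pf_coord R l j)))) (pf_const n (- J i j)).
have := hX _ _ _ h; rewrite /=.
have E : forall s : M, \sum_l (\sum_k J k l * s k i * s l j) = (s^T *m J *m s) i j.
  move=> s; rewrite mxE; apply: eq_bigr => l _; rewrite mxE mulr_suml.
  by apply: eq_bigr => k _; rewrite mxE [J k l * _]mulrC.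
case/(_ _)/Wrap => [s Ss|]; first by rewrite E H // subrr.
rewrite addr0 => E2.
rewrite [RHS]mxE -[RHS]E2 mxE; under eq_bigr do rewrite big_split /=.
rewrite big_split /=; congr (_ + _).
- rewrite mxE [RHS](bigD1 j) //= [X in _ + X]big1 ?addr0 => [|l lj].
    by apply: eq_bigr => k _; rewrite !mxE eqxx mulr1 mulrC.
  by rewrite big1 // => k _; rewrite !mxE (negPf lj) mulr0.
- rewrite mxE; apply: eq_bigr => l _; rewrite (bigD1 i) //= big1 => [|k ki].
    by rewrite !mxE eqxx mulr1 addr0.
  by rewrite !mxE (negPf ki) mulr0 mul0r.
Qed.

(* If the tangent space vanished, linear algebra would bound every entry of
   [s - 1] by a quadratic remainder, isolating [1]. *)
Lemma tang_nonisolated S :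
  (forall e, 0 < e -> exists s, [/\ S s, s != 1%:M & nrm (s - 1%:M) < e]) ->
  S 1%:M -> exists2 X, tang S X & X != 0.
Proof.
move=> nis S1; apply: contrapT => H.
have {}H X : tang S X -> X = 0.
  by move=> hX; apply: contrapT => /eqP X0; apply: H; exists X.
pose T := {F : (M -> R) * (M -> M -> R) * (M -> M -> M -> R)
          | pf F.1.1 F.1.2 F.2 /\ vanish S F.1.1}.
have key i j : exists2 C, 0 <= C & forall s, S s -> nrm (s - 1%:M) <= 1 ->
    `|(s - 1%:M) i j| <= C * nrm (s - 1%:M) ^+ 2.
  have [phi Hphi|c Hc] := @span_of_annihilator_fin R ('I_n * 'I_n)%type T
    (fun t kl => (projT1 t).1.2 1%:M (delta_mx kl.1 kl.2)) (fun kl => (kl == (i, j))%:R).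
    have phi0 : \sum_kl phi kl *: (delta_mx kl.1 kl.2 : M) = 0.
      apply: H => F dF ddF hF V; rewrite (pf_sumr hF).
      have := Hphi (exist _ (F, dF, ddF) (conj hF V)); rewrite /= => E.
      rewrite -[RHS]E.
      by apply: eq_bigr => kl _; rewrite (pf_scaler hF) mulrC.
    rewrite big1 // => -[k l] _.
    suff -> : phi (k, l) = 0 by rewrite mulr0.
    move: phi0 => /matrixP /(_ k l); rewrite summxE (bigD1 (k, l)) //= big1 => [|[k' l'] kl].
      by rewrite !mxE !eqxx /= mulr1 addr0.
    rewrite !mxE /=; case: eqP => [e1|]; case: eqP => [e2|]; rewrite ?mulr0 //.
    by rewrite e1 e2 eqxx in kl.
  have [G [dG [ddG [hG [VG EG]]]]] : exists G dG ddG, pf G dG ddG /\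
       (vanish S G /\ forall X : M, dG 1%:M X = X i j).
    pose G x A := x.1 * (projT1 x.2).1.1 A : R.
    have h := pf_sum c (fun x : R * T => pf_scale x.1 (proj1 (projT2 x.2))).
    do 3!eexists; split; first exact: h.
    split=> [s Ss /=|X].
      by rewrite big1 // => -[a t] _ /=; rewrite (proj2 (projT2 t)) ?mulr0.
    rewrite {1}(matrix_sum_delta X) /=.
    transitivity (\sum_kl X kl.1 kl.2 * ((kl == (i, j))%:R : R)).
      rewrite pair_big /=; have := pf_sumr h 1%:M (index_enum ('I_n * 'I_n)%type)
        (fun kl => X kl.1 kl.2 *: delta_mx kl.1 kl.2) => /= ->.
      by apply: eq_bigr => kl _; have := pf_scaler h 1%:M => /= ->; rewrite -Hc.
    rewrite (bigD1 (i, j)) //= eqxx mulr1 big1 ?addr0 // => kl /negPf ->.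
    by rewrite mulr0.
  have [C C0 HC] := pf_taylor hG 1%:M; exists C => // s Ss s1.
  have := HC _ s1; rewrite [1%:M + _]addrC subrK (VG _ Ss) (VG _ S1) subrr sub0r normrN.
  by rewrite EG.
have /choice[C HC] : forall ij : 'I_n * 'I_n, exists C, 0 <= C /\ forall s, S s ->
    nrm (s - 1%:M) <= 1 -> `|(s - 1%:M) ij.1 ij.2| <= C * nrm (s - 1%:M) ^+ 2.
  by move=> [i j]; have [C C0 h] := key i j; exists C.
pose D := \sum_ij C ij.
have D0 : 0 <= D by apply: sumr_ge0 => ij _; exact: (HC ij).1.
(* Below this radius D x^2 < x for x = [nrm (s - 1%:M)], against the quadratic bound on the largest
   entry. *)
have e0 : 0 < (D + 1)^-1 by rewrite invr_gt0; lra.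
have [s [Ss s1 se]] := nis _ e0.
have s_le1 : nrm (s - 1%:M) <= 1.
  by apply: le_trans (ltW se) _; rewrite invf_le1; lra.
have snz : s - 1%:M != 0 by rewrite subr_eq0.
have [i [j Eij]] := nrm_attained snz.
have := (HC (i, j)).2 s Ss s_le1; rewrite /= -Eij.
have p0 := nrm_gt0 snz; rewrite expr2 mulrA -{1}[nrm _]mul1r ler_pM2r //.
apply/negP; rewrite -ltNge.
have CD : C (i, j) <= D.
  by rewrite /D (bigD1 (i, j)) //= lerDl sumr_ge0 // => ij _; exact: (HC ij).1.
apply: le_lt_trans (ler_wpM2r (ltW p0) CD) _.
have D1 : 0 < D + 1 by lra.
have : (D + 1) * nrm (s - 1%:M) < (D + 1) * (D + 1)^-1 by rewrite ltr_pM2l.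
rewrite mulfV ?lt0r_neq0 //; lra.
Qed.

Lemma tang_transport S S' (g h X : M) : g *m h = 1%:M ->
  (forall x, S x -> S' (g *m x *m h)) -> tang S X -> tang S' (g *m X *m h).
Proof.
move=> gh H hX F dF ddF hF V.
have := hX _ _ _ (pf_subst g h hF); rewrite mulmx1 gh; apply.
by move=> x /H /V.
Qed.

Lemma zc_transport S S' (g h A : M) :
  (forall x, S x -> S' (g *m x *m h)) -> zc S A -> zc S' (g *m A *m h).
Proof.
move=> H hA F hF V; have := hA _ (poly_subst g h hF); apply.
by move=> x /H /V.
Qed.

End TangentSpace.

(** * Cayley curves and generation of orthogonal groups *)

Section OrderAtZero.
Variable R : numFieldType.
Implicit Types p q : {poly R}.

Definition dvdX k p := exists q, p = q * 'X^k.

Lemma dvdX_mull k p q : dvdX k p -> dvdX k (q * p).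
Proof. by move=> [r ->]; exists (q * r); rewrite mulrA. Qed.

Lemma dvdX_add k p q : dvdX k p -> dvdX k q -> dvdX k (p + q).
Proof. by move=> [r ->] [r' ->]; exists (r + r'); rewrite mulrDl. Qed.

Lemma dvdX_cancel k d p : d.[0] != 0 -> dvdX k (d * p) -> dvdX k p.
Proof.
move=> d0; elim: k p => [|k IH] p [q]; first by exists p; rewrite expr0 mulr1.
move=> E; have : p.[0] = 0.
  have := congr1 (horner^~ 0) E; rewrite !hornerM hornerXn expr0n /= mulr0.
  by move/eqP; rewrite mulf_eq0 (negPf d0) => /eqP.
move/eqP/factor_theorem => [r]; rewrite subr0 => Ep.
have [] := IH r; first exists q.
  apply: (@mulIf _ (polyX R)); first by rewrite polyX_eq0.
  by rewrite -mulrA -Ep E exprSr mulrA.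
by move=> r' Er; exists r'; rewrite Ep Er exprSr mulrA.
Qed.

(** In characteristic 0 the coefficients of positive index can be read off the derivative. *)
Lemma dvdX_deriv k p : p.[0] = 0 -> dvdX k p^`() -> dvdX k.+1 p.
Proof.
move=> p0 [q E]; exists (drop_poly k.+1 p).
rewrite -{1}(poly_take_drop k.+1 p); apply/eqP; rewrite -subr_eq0 addrK.
apply/eqP/polyP => i; rewrite coef_take_poly coef0; case: ltnP => // ik.
case: i ik => [|i] ik; first by rewrite -horner_coef0.
have := congr1 (fun r : {poly R} => r`_i) E.
rewrite coef_deriv coefMXn -ltnS ik => /eqP.
by rewrite mulrn_eq0 /= => /eqP.
Qed.

Lemma dvdX_all p : (forall k, dvdX k p) -> p = 0.
Proof.
move=> H; apply/polyP => i; rewrite coef0.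
by have [q ->] := H i.+1; rewrite coefMXn ltnSn.
Qed.

Lemma poly_vanish p : (forall t, p.[t] = 0) -> p = 0.
Proof.
move=> H; apply/eqP; apply: contraT => p0.
pose rs := [seq (i%:R : R) | i <- iota 0 (size p)].
have := max_poly_roots p0 (_ : all (root p) rs) (_ : uniq rs).
rewrite size_map size_iota ltnn; apply.
  by apply/allP => x _; apply/eqP.
by rewrite map_inj_uniq ?iota_uniq // => i j /eqP; rewrite eqr_nat => /eqP.
Qed.

Lemma poly_eq_off d p q : d != 0 -> (forall t, d.[t] != 0 -> p.[t] = q.[t]) -> p = q.
Proof.
move=> d0 H; apply/eqP; rewrite -subr_eq0; apply/eqP.
apply: (mulfI d0); rewrite mulr0; apply: poly_vanish => t.
rewrite hornerM; have [->|dt] := eqVneq d.[t] 0; first by rewrite mul0r.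
by rewrite hornerD hornerN H // subrr mulr0.
Qed.

End OrderAtZero.

(** * Polynomial functions along rational curves *)

Section RationalCurve.
Variables (R : realFieldType) (n : nat).
Notation M := 'M[R]_n.
Variables (d : {poly R}) (N : 'M[{poly R}]_n) (G G' : R -> M).
Hypothesis HN : forall t, d.[t] != 0 -> forall i j, (N i j).[t] = d.[t] * G t i j.
Hypothesis HN' : forall t, d.[t] != 0 -> forall i j,
  d.[t] * (N i j)^`().[t] = d^`().[t] * (N i j).[t] + d.[t] ^+ 2 * G' t i j.

(** For G = N / d with velocity [G'], [HN'] is the quotient rule with denominators cleared.
    Induction on [F] gives the same rule for F(G) = P / d^m, so only formal derivatives of
    polynomials in t occur. *)
Lemma pf_rational F dF ddF : pf F dF ddF -> exists m (P : {poly R}), forall t, d.[t] != 0 ->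
  P.[t] = d.[t] ^+ m * F (G t) /\
  d.[t] * P^`().[t] = m%:R * d^`().[t] * P.[t] + d.[t] ^+ m.+1 * dF (G t) (G' t).
Proof.
have derX m t : d.[t] * (d ^+ m)^`().[t] = m%:R * d^`().[t] * d.[t] ^+ m.
  rewrite deriv_exp hornerMn hornerM horner_exp.
  by case: m => [|m]; rewrite ?mulr0n ?mulr0 ?mul0r //= -mulr_natl exprS; ring.
elim=> {F dF ddF} [c|i j|F dF ddF K dK ddK _ [m [P IF]] _ [l [Q IG]]
                  |F dF ddF K dK ddK _ [m [P IF]] _ [l [Q IG]]].
- exists 0%N, c%:P => t _; split; first by rewrite hornerC expr0 mul1r.
  by rewrite derivC horner0 !mulr0 !mul0r addr0.
- exists 1%N, (N i j) => t dt; split; first by rewrite expr1 HN.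
  by rewrite HN' // mul1r.
- exists (m + l)%N, (d ^+ l * P + d ^+ m * Q) => t dt.
  have [e1 e2] := IF t dt; have [e3 e4] := IG t dt.
  have x1 := derX l t; have x2 := derX m t.
  split; first by rewrite hornerD !hornerM !horner_exp e1 e3 exprD; ring.
  rewrite derivD !derivM !(hornerD, hornerM) !horner_exp.
  rewrite mulrDr 2!(mulrDr d.[t]) !mulrA x1 x2 -!mulrA !(mulrCA d.[t]) e2 e4.
  by rewrite !exprS !exprD natrD; ring.
- exists (m + l)%N, (P * Q) => t dt.
  have [e1 e2] := IF t dt; have [e3 e4] := IG t dt.
  split; first by rewrite hornerM e1 e3 exprD; ring.
  rewrite derivM hornerD !hornerM mulrDr mulrA e2 (mulrCA d.[t]) e4 e1 e3.
  by rewrite !exprS !exprD natrD; ring.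
Qed.

End RationalCurve.

(** * The orthogonal group and the Lie algebra of a diagonal form *)

Section DiagonalForm.
Variables (R : realFieldType) (n : nat) (eps : 'I_n -> R).
Hypothesis Heps : forall i, eps i * eps i = 1.
Notation M := 'M[R]_n.

Definition Jmx : M := diag_mx (\row_i eps i).
Notation J := Jmx.
Definition OJ (A : M) := A^T *m J *m A = J.
Definition soJ (X : M) := X^T *m J + J *m X = 0.
(** Spanning vectors of the Lie algebra. [Emx b a] is a sign times [Emx a b] and [Emx a a] is 0; the
    factor 1/2 of [soJ_expand] comes from each pair being counted twice. *)
Definition Emx a b : M := delta_mx a b - (eps a * eps b) *: delta_mx b a.
(** Adjoint for the form, [J] being its own inverse. On the group it is the inverse, with the
    advantage of being linear. *)
Definition adjJ (A : M) : M := J *m A^T *m J.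

Lemma JmxE i j : J i j = eps i *+ (i == j).
Proof. by rewrite !mxE; case: eqP => [->|]. Qed.

Lemma mulJmx m (A : 'M[R]_(n, m)) i j : (J *m A) i j = eps i * A i j.
Proof.
rewrite mxE (bigD1 i) //= JmxE eqxx mulr1n big1 ?addr0 // => k ki.
by rewrite JmxE eq_sym (negPf ki) mulr0n mul0r.
Qed.

Lemma mulmxJ m (A : 'M[R]_(m, n)) i j : (A *m J) i j = A i j * eps j.
Proof.
rewrite mxE (bigD1 j) //= JmxE eqxx mulr1n big1 ?addr0 // => k ki.
by rewrite JmxE (negPf ki) mulr0n mulr0.
Qed.

Lemma trJ : J^T = J.
Proof. by apply/matrixP => i j; rewrite mxE !JmxE eq_sym; case: eqP => [->|]. Qed.

Lemma JJ : J *m J = 1%:M.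
Proof.
apply/matrixP => i j; rewrite mulJmx JmxE mxE; case: eqP => [->|]; last by rewrite mulr0n mulr0.
by rewrite mulr1n Heps.
Qed.

Lemma OJP A : OJ A <-> adjJ A *m A = 1%:M.
Proof.
rewrite /OJ /adjJ; split=> H; first by rewrite -!mulmxA (mulmxA A^T) H JJ.
by have := congr1 (mulmx J) H; rewrite !mulmxA JJ mul1mx mulmx1.
Qed.

Lemma OJ_inv A : OJ A -> A *m adjJ A = 1%:M.
Proof. by move=> /OJP; exact: mulmx1C. Qed.

Lemma adjJM A B : adjJ (A *m B) = adjJ B *m adjJ A.
Proof. by rewrite /adjJ trmx_mul -!mulmxA (mulmxA J J) JJ mul1mx. Qed.

Lemma adjJD A B : adjJ (A + B) = adjJ A + adjJ B.
Proof. by rewrite /adjJ raddfD /= mulmxDr mulmxDl. Qed.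

Lemma adjJB A B : adjJ (A - B) = adjJ A - adjJ B.
Proof. by rewrite /adjJ raddfB /= mulmxBr mulmxBl. Qed.

Lemma adjJ1 : adjJ 1%:M = 1%:M.
Proof. by rewrite /adjJ trmx1 mulmx1 JJ. Qed.

Lemma adjJK A : adjJ (adjJ A) = A.
Proof.
by rewrite /adjJ !trmx_mul trJ trmxK -!mulmxA JJ mulmx1 mulmxA JJ mul1mx.
Qed.

Lemma adjJE A i j : adjJ A i j = eps i * eps j * A j i.
Proof. by rewrite /adjJ mulmxJ mulJmx mxE; ring. Qed.

Lemma OJM A B : OJ A -> OJ B -> OJ (A *m B).
Proof.
move=> /OJP hA /OJP hB; apply/OJP.
by rewrite adjJM -mulmxA (mulmxA (adjJ A)) hA mul1mx.
Qed.

Lemma OJ_adj A : OJ A -> OJ (adjJ A).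
Proof. by move=> /OJ_inv h; apply/OJP; rewrite adjJK. Qed.

Lemma soJP X : soJ X <-> adjJ X = - X.
Proof.
rewrite /soJ /adjJ; split => [H|H].
  have := congr1 (mulmx J) H; rewrite mulmxDr mulmx0 !mulmxA JJ mul1mx => /eqP.
  by rewrite addr_eq0 => /eqP.
have := congr1 (mulmx J) H; rewrite !mulmxA JJ mul1mx mulmxN => ->.
by rewrite addNr.
Qed.

Lemma soJE X : soJ X <-> forall i j, X j i = - (eps i * eps j) * X i j.
Proof.
rewrite soJP; split=> [H i j|H].
  have := congr1 (fun A : M => A i j) H; rewrite adjJE mxE => e.
  have -> : X i j = - (eps i * eps j * X j i) by rewrite e opprK.
  transitivity ((eps i * eps i) * (eps j * eps j) * X j i); last by ring.
  by rewrite !Heps !mul1r.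
apply/matrixP => i j; rewrite adjJE mxE (H i j).
transitivity (- (eps i * eps i) * (eps j * eps j) * X i j); first by ring.
by rewrite !Heps mulr1 mulN1r.
Qed.

Lemma soJ_lin a X Y : soJ X -> soJ Y -> soJ (a *: X + Y).
Proof. by move=> /soJE hX /soJE hY; apply/soJE => i j; rewrite !mxE hX hY; ring. Qed.

Lemma soJB X Y : soJ X -> soJ Y -> soJ (X - Y).
Proof. by move=> /soJE hX /soJE hY; apply/soJE => i j; rewrite !mxE hX hY; ring. Qed.

Lemma soJ_diag X i : soJ X -> X i i = 0.
Proof. by move=> /soJE /(_ i i); rewrite Heps mulN1r => h; lra. Qed.

Lemma EmxE a b i j :
  Emx a b i j = ((i == a) && (j == b))%:R - eps a * eps b * ((i == b) && (j == a))%:R.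
Proof. by rewrite !mxE. Qed.

Lemma soJ_Emx a b : soJ (Emx a b).
Proof.
apply/soJE => i j; rewrite !EmxE [(j == a) && _]andbC [(j == b) && _]andbC.
set u := (i == a) && _; set v := (i == b) && _.
have hu : eps i * eps j * u%:R = eps a * eps b * u%:R.
  by rewrite /u; case: andP => [[/eqP-> /eqP->]|]; rewrite ?mulr0.
have hv : eps i * eps j * v%:R = eps a * eps b * v%:R.
  by rewrite /v; case: andP => [[/eqP-> /eqP->]|]; rewrite ?mulr0 // [eps b * _]mulrC.
have c2 : (eps a * eps b) * (eps a * eps b) = 1.
  by rewrite mulrACA !Heps mulr1.
rewrite mulNr mulrBr hu mulrCA hv mulrA c2; ring.
Qed.

Lemma soJ_expand X : soJ X -> X = 2^-1 *: \sum_a \sum_b X a b *: Emx a b.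
Proof.
move=> /soJE hX; apply/matrixP => i j; rewrite mxE summxE.
under eq_bigr do rewrite summxE.
rewrite (eq_bigr (fun a => \sum_b X a b * ((i == a) && (j == b))%:R
   - \sum_b X a b * (eps a * eps b * ((i == b) && (j == a))%:R))); last first.
  by move=> a _; rewrite -sumrB; apply: eq_bigr => b _; rewrite mxE EmxE mulrBr.
rewrite sumrB (bigD1 i) //= [X in _ + X - _]big1 => [|a ai]; last first.
  by rewrite big1 // => b _; rewrite eq_sym (negPf ai) mulr0.
rewrite (bigD1 j) //= [X in _ + X + _ - _]big1 => [|b bj]; last first.
  by rewrite eq_sym (negPf bj) andbF mulr0.
rewrite (bigD1 j) //= [X in _ - (_ + X)]big1 => [|a ai]; last first.
  by rewrite big1 // => b _; rewrite [j == a]eq_sym (negPf ai) andbF !mulr0.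
rewrite (bigD1 i) //= [X in _ - (_ + X + _)]big1 => [|b bj]; last first.
  by rewrite eq_sym (negPf bj) !mulr0.
rewrite !eqxx /= !mulr1 !addr0 (hX i j).
have -> : eps j * eps i = eps i * eps j by rewrite mulrC.
have -> : - (eps i * eps j) * X i j * (eps i * eps j) = - ((eps i * eps i) * (eps j * eps j) * X i j) by ring.
by rewrite !Heps !mul1r opprK; field.
Qed.

End DiagonalForm.

(** * The Cayley curve and its velocity *)

Section CayleyCurve.
Variables (R : realFieldType) (n : nat) (s X : 'M[R]_n).
Notation M := 'M[R]_n.

Let pc (A : M) : 'M[{poly R}]_n := map_mx (@polyC R) A.
Let ev (t : R) (A : 'M[{poly R}]_n) : M := map_mx (horner_eval t) A.
Let tX : 'M[{poly R}]_n := 'X *: pc X.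
Let Z : 'M[{poly R}]_n := 1%:M - tX *m tX.
Let d := \det Z.
Let N : 'M[{poly R}]_n := pc s *m ((1%:M + tX) *m (1%:M + tX)) *m \adj Z.
Let Zt t : M := 1%:M - (t *: X) *m (t *: X).
Let dmx (A : 'M[{poly R}]_n) := map_mx (@deriv R) A.

Definition cayley_denom := d.
Definition cayley_num := N.
(** Logarithmic derivative of the curve: that of (1 + tX)(1 - tX)^-1 is 2X (1 - t^2 X^2)^-1. *)
Definition cayley_speed t : M := 2 *: (X *m invmx (Zt t)).
Definition cayley_speed_num : 'M[{poly R}]_n := 2 *: (pc X *m \adj Z).
(* [(1 + Y)^2 (1 - Y^2)^-1] is the Cayley transform of [Y = t X], written with a
   denominator that [adjJ] fixes. *)
Definition cayley_curve t : M :=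
  s *m ((1%:M + t *: X) *m (1%:M + t *: X)) *m invmx (Zt t).

Lemma ev_pc t A : ev t (pc A) = A.
Proof. by apply/matrixP => i j; rewrite !mxE /horner_eval hornerC. Qed.

Lemma ev_tX t : ev t tX = t *: X.
Proof. by apply/matrixP => i j; rewrite !mxE /horner_eval hornerM hornerX hornerC. Qed.

Lemma ev_1tX t : ev t (1%:M + tX) = 1%:M + t *: X.
Proof. by rewrite /ev map_mxD map_mx1 -/(ev t tX) ev_tX. Qed.

Lemma ev_Z t : ev t Z = Zt t.
Proof. by rewrite /ev map_mxB map_mx1 map_mxM -/(ev t tX) ev_tX. Qed.

Lemma cayley_denomE t : d.[t] = \det (Zt t).
Proof. by rewrite -ev_Z det_map_mx. Qed.

Lemma Zt_unit t : d.[t] != 0 -> Zt t \in unitmx.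
Proof. by rewrite cayley_denomE unitmxE unitfE. Qed.

Lemma ev_adjZ t : d.[t] != 0 -> ev t (\adj Z) = d.[t] *: invmx (Zt t).
Proof.
move=> dt; rewrite /ev map_mx_adj -/(ev t Z) ev_Z.
by rewrite /invmx Zt_unit // cayley_denomE scalerA mulfV ?scale1r // -cayley_denomE.
Qed.

Lemma cayley_numE t i j : d.[t] != 0 -> (N i j).[t] = d.[t] * cayley_curve t i j.
Proof.
move=> dt; transitivity (ev t N i j); first by rewrite [RHS]mxE.
rewrite {1}/ev !map_mxM -!/(ev t _) ev_pc ev_1tX ev_adjZ //.
by rewrite /cayley_curve -scalemxAr mxE.
Qed.

Lemma cayley_speed_numE t i j : d.[t] != 0 ->
  (cayley_speed_num i j).[t] = d.[t] * cayley_speed t i j.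
Proof.
move=> dt; transitivity (ev t cayley_speed_num i j); first by rewrite [RHS]mxE.
rewrite /ev /cayley_speed_num map_mxZ map_mxM -!/(ev t _) ev_pc ev_adjZ //.
rewrite /cayley_speed -!scalemxAr !mxE /horner_eval.
by rewrite (_ : 2%:R = (2%:R)%:P) ?hornerC ?polyCMn //; ring.
Qed.

Lemma dmxM A B : dmx (A *m B) = dmx A *m B + A *m dmx B.
Proof.
apply/matrixP => i j; rewrite !mxE raddf_sum -big_split /=.
by apply: eq_bigr => k _; rewrite !mxE derivM.
Qed.

Lemma dmxD A B : dmx (A + B) = dmx A + dmx B.
Proof. by apply/matrixP => i j; rewrite !mxE derivD. Qed.

Lemma dmxN A : dmx (- A) = - dmx A.
Proof. by apply/matrixP => i j; rewrite !mxE derivN. Qed.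

Lemma dmxZ c A : dmx (c *: A) = c^`() *: A + c *: dmx A.
Proof. by apply/matrixP => i j; rewrite !mxE derivM. Qed.

Lemma dmx_pc A : dmx (pc A) = 0.
Proof. by apply/matrixP => i j; rewrite !mxE derivC. Qed.

Lemma dmx1 : dmx 1%:M = 0.
Proof. by apply/matrixP => i j; rewrite !mxE; case: (_ == _); rewrite ?derivC ?deriv0. Qed.

Lemma dmx_tX : dmx tX = pc X.
Proof. by rewrite /tX dmxZ dmx_pc scaler0 addr0 derivX scale1r. Qed.

(** The product rule is applied to [N *m Z] = d s (1 + tX)^2, which is free of inverses; the result
    is evaluated at t and solved for the derivative of [N]. *)
Lemma cayley_num_deriv t i j : d.[t] != 0 ->
  d.[t] * (N i j)^`().[t] = d^`().[t] * (N i j).[t]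
     + d.[t] ^+ 2 * (cayley_curve t *m cayley_speed t) i j.
Proof.
move=> dt.
have E : N *m Z = d *: (pc s *m ((1%:M + tX) *m (1%:M + tX))).
  by rewrite /N -mulmxA mul_adj_mx mul_mx_scalar.
have := congr1 (fun A => ev t (dmx A)) E.
have evN : ev t N = d.[t] *: cayley_curve t.
  by apply/matrixP => k l; rewrite [LHS]mxE [RHS]mxE; exact: cayley_numE.
have scal c A : ev t (c *: A) = c.[t] *: ev t A.
  by apply/matrixP => k l; rewrite !mxE /horner_eval hornerM.
have evD A B : ev t (A + B) = ev t A + ev t B by rewrite /ev map_mxD.
have evNg A : ev t (- A) = - ev t A by rewrite /ev map_mxN.
have evM A B : ev t (A *m B) = ev t A *m ev t B by rewrite /ev map_mxM.
rewrite (dmxM N Z) dmxZ; set D0 := dmx N.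
rewrite {2}/Z !(dmxM, dmxD, dmxN, dmx1, dmx_tX, dmx_pc) -/Z.
rewrite !(evD, evNg, evM, scal, ev_pc, ev_tX, evN, ev_Z).
set D := ev t D0.
have ev1 : ev t 1%:M = 1%:M by rewrite /ev map_mx1.
have ev0 : ev t 0 = 0 by rewrite /ev map_mx0.
rewrite ev1 ev0 mul0mx !add0r.
set Y := t *: X.
have cZ : cayley_curve t *m Zt t = s *m ((1%:M + Y) *m (1%:M + Y)).
  by rewrite /cayley_curve mulmxKV ?Zt_unit.
set c := cayley_curve t in cZ *.
(* This turns s (1 + Y) 2X into c (1 - Y) 2X; adding the remaining term c Y 2X gives c 2X. *)
have cY : c *m (1%:M - Y) = s *m (1%:M + Y).
  have U : 1%:M + Y \in unitmx.
    have := Zt_unit dt; rewrite (_ : Zt t = (1%:M - Y) *m (1%:M + Y)).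
      by rewrite unitmx_mul => /andP[].
    by rewrite mulmxBl mul1mx mulmxDr mulmx1 opprD addrA addrK.
  rewrite -[LHS](mulmxK U) -[RHS](mulmxK U); congr (_ *m _).
  rewrite -[RHS]mulmxA -cZ -mulmxA; congr (_ *m _).
  by rewrite mulmxBl mul1mx mulmxDr mulmx1 opprD addrA addrK.
move=> F.
have {F} : (D - d^`().[t] *: c) *m Zt t = d.[t] *: (c *m (2 *: X)).
  rewrite mulmxBl -scalemxAl cZ.
  have -> : D *m Zt t = d^`().[t] *: (s *m ((1%:M + Y) *m (1%:M + Y))) +
      d.[t] *: (s *m (X *m (1%:M + Y) + (1%:M + Y) *m X))
      + d.[t] *: c *m (X *m Y + Y *m X).
    by move/eqP: F; rewrite mulmxN subr_eq => /eqP.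
  rewrite -[X in X - _]addrA addrAC subrr add0r.
  rewrite -scalemxAl -scalerDr; congr (_ *: _).
  have XY : X *m Y = Y *m X by rewrite /Y -scalemxAl -scalemxAr.
  have -> : X *m (1%:M + Y) + (1%:M + Y) *m X = (1%:M + Y) *m (2 *: X).
    have -> : X *m (1%:M + Y) = (1%:M + Y) *m X.
      by rewrite mulmxDr mulmxDl mulmx1 mul1mx XY.
    by rewrite -scalemxAr scaler_nat mulr2n.
  rewrite mulmxA -cY -mulmxA -mulmxDr; congr (_ *m _).
  rewrite XY mulmxBl mul1mx -scalemxAr !scaler_nat !mulr2n opprD addrACA.
  by rewrite subrK addrK.
move=> F.
have F2 : D - d^`().[t] *: c = d.[t] *: (c *m cayley_speed t).
  rewrite -[LHS](mulmxK (Zt_unit dt)) F -scalemxAl /cayley_speed.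
  by rewrite -!scalemxAr -!scalemxAl mulmxA.
have := congr1 (fun A : M => A i j) F2.
have DE : D i j = (N i j)^`().[t] by rewrite /D /D0 [LHS]mxE [X in horner_eval t X]mxE.
rewrite [X in X = _]mxE [X in _ + X = _]mxE [X in _ - X = _]mxE DE [RHS]mxE => e.
have -> : (N i j)^`().[t] = d^`().[t] * c i j + d.[t] * (c *m cayley_speed t) i j.
  by rewrite -e; ring.
by rewrite cayley_numE // -/c; ring.
Qed.

End CayleyCurve.

(** * Diagonal sign matrices *)

Section SignLemma.
Variables (R : numFieldType) (n : nat).

Definition sgn_mx (f : {set 'I_n}) : 'M[R]_n := diag_mx (\row_i (-1) ^+ (i \in f)).

Lemma sgn_mxE f i j : sgn_mx f i j = (-1) ^+ (i \in f) *+ (i == j).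
Proof. by rewrite !mxE; case: eqP => [->|]. Qed.

Lemma mul_sgn_mx f m (A : 'M[R]_(n, m)) i j : (sgn_mx f *m A) i j = (-1) ^+ (i \in f) * A i j.
Proof.
rewrite mxE (bigD1 i) //= sgn_mxE eqxx mulr1n big1 ?addr0 // => k ki.
by rewrite sgn_mxE eq_sym (negPf ki) mulr0n mul0r.
Qed.

Lemma sgn_mxK f : sgn_mx f *m sgn_mx f = 1%:M.
Proof.
apply/matrixP => i j; rewrite mul_sgn_mx sgn_mxE mxE; case: eqP => [->|_]; last by rewrite mulr0n mulr0.
by rewrite !mulr1n -signr_addb addbb.
Qed.

Lemma det_sgn_mx f : \det (sgn_mx f) = (-1) ^+ #|f|.
Proof.
rewrite det_diag -sum1_card -prodrXr [RHS]big_mkcond /=.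
by apply: eq_bigr => i _; rewrite mxE; case: (i \in f).
Qed.

(* Multilinearity in the signs: the signed sum of the determinants over all
   sign patterns is [2 ^ n]. *)
Lemma sign_det (A : 'M[R]_n) : exists f, \det (sgn_mx f + A) != 0.
Proof.
apply/existsP; apply: contraT; rewrite negb_exists => /forallP H.
pose sg (g : {ffun 'I_n -> bool}) : R := \prod_i (-1) ^+ g i.
have E : \sum_(g : {ffun 'I_n -> bool}) sg g * \det (sgn_mx [set i | g i] + A) = 2 ^+ n.
  rewrite -(det_scalar n 2).
  under eq_bigr do rewrite mulr_sumr.
  rewrite exchange_big /=; apply: eq_bigr => s _.
  under eq_bigr do rewrite mulrCA.
  rewrite -mulr_sumr; congr (_ * _).
  under [RHS]eq_bigr do rewrite mxE.
  (* The sum over sign patterns factors over the rows; the factor of row i is 2 if i = s i and 0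
     otherwise. *)
  transitivity (\prod_i \sum_(c : bool) (-1) ^+ c * ((-1) ^+ c *+ (i == s i) + A i (s i))).
    rewrite bigA_distr_bigA /=; apply: eq_bigr => g _.
    rewrite -big_split /=; apply: eq_bigr => i _.
    by rewrite [in LHS]mxE sgn_mxE inE.
  apply: eq_bigr => i _; rewrite big_bool /= expr1 expr0.
  by case: (i == s i); rewrite ?mulr1n ?mulr0n; ring.
move: E; rewrite big1 => [/esym/eqP|g _]; last first.
  by have := H [set i | g i]; rewrite negbK => /eqP ->; rewrite mulr0.
by rewrite expf_eq0 pnatr_eq0 andbF.
Qed.

End SignLemma.

(** * Orthogonal matrices in a Zariski closure *)

Section OrthogonalGroupGeneration.
Variables (R : realFieldType) (n : nat) (eps : 'I_n -> R).
Hypothesis Heps : forall i, eps i * eps i = 1.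
Variable B : pred 'I_n.
Notation M := 'M[R]_n.
Notation J := (Jmx eps).
Variable S : M -> Prop.
Hypothesis SM : forall s t, S s -> S t -> S (s *m t).
Hypothesis StE : forall a b, B a -> B b -> tang S (Emx eps a b).

Definition supp_on (X : M) := forall i j, ~~ (B i && B j) -> X i j = 0.

Lemma supp_rows (X Y : M) i j : supp_on X -> ~~ B i -> (X *m Y) i j = 0.
Proof. by move=> hX b; rewrite mxE big1 // => k _; rewrite hX ?mul0r // negb_and b. Qed.

Lemma supp_cols (X Y : M) i j : supp_on X -> ~~ B j -> (Y *m X) i j = 0.
Proof. by move=> hX b; rewrite mxE big1 // => k _; rewrite hX ?mulr0 // negb_and b orbT. Qed.

(* Along the curve, every function of the ideal vanishes to infinite order at
   [t = 0]: its derivative is again a function of the ideal, up to a factor. *)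
Lemma cayley_zc (s X : M) : zc S s -> soJ eps X -> supp_on X ->
  \det (1%:M - X *m X) != 0 ->
  zc S (s *m ((1%:M + X) *m (1%:M + X)) *m invmx (1%:M - X *m X)).
Proof.
move=> hs hX suppX d1.
pose d := cayley_denom X; pose G := cayley_curve s X; pose Y := cayley_speed X.
have d0 : d.[0] = 1 by rewrite /d cayley_denomE !scale0r mulmx0 subr0 det1.
have dnz : d != 0 by apply: contra_eq_neq d0 => ->; rewrite horner0 eq_sym oner_eq0.
have rat := @pf_rational R n d (cayley_num s X) G (fun t => G t *m Y t)
  (fun t dt i j => cayley_numE s i j dt) (fun t dt i j => cayley_num_deriv s i j dt).
have YsoJ t : d.[t] != 0 -> soJ eps (Y t) /\ supp_on (Y t).
  move=> dt; have U := Zt_unit dt; rewrite /Y /cayley_speed.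
  set Z := 1%:M - (t *: X) *m (t *: X) in U *.
  have XZ : X *m Z = Z *m X.
    by rewrite /Z mulmxBr mulmxBl mulmx1 mul1mx -!scalemxAl -!scalemxAr -scalemxAl mulmxA.
  have XZi : X *m invmx Z = invmx Z *m X.
    by rewrite -[LHS](mulKmx U) (mulmxA Z) -XZ mulmxK.
  have aX : adjJ eps X = - X by apply/soJP.
  have adjZ c (A : M) : adjJ eps (c *: A) = c *: adjJ eps A.
    by rewrite /adjJ linearZ /= -scalemxAr -scalemxAl.
  have aZ : adjJ eps Z = Z.
    by rewrite /Z adjJB adjJ1 // adjJM // !adjZ aX !scalerN mulmxN mulNmx opprK.
  have aZi : adjJ eps (invmx Z) = invmx Z.
    have : adjJ eps (invmx Z) *m Z = 1%:M by rewrite -{2}aZ -adjJM // mulmxV // adjJ1.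
    by move=> /(congr1 (mulmx^~ (invmx Z))); rewrite mulmxK // mul1mx.
  split.
    by apply/soJP => //; rewrite adjZ adjJM // aZi aX mulmxN scalerN XZi.
  move=> i j; rewrite negb_and mxE => /orP[b|b]; last rewrite XZi.
    by rewrite supp_rows ?mulr0.
  by rewrite supp_cols ?mulr0.
have speedE t i j : d.[t] != 0 -> (cayley_speed_num X i j).[t] = d.[t] * Y t i j.
  exact: cayley_speed_numE.
have d1' : d.[1] != 0 by rewrite /d cayley_denomE scale1r.
clearbody d.
have claim k : forall F dF ddF, pf F dF ddF -> vanish S F ->
   forall m P, (forall t, d.[t] != 0 -> P.[t] = d.[t] ^+ m * F (G t) /\
    d.[t] * P^`().[t] = m%:R * d^`().[t] * P.[t] + d.[t] ^+ m.+1 * dF (G t) (G t *m Y t)) ->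
   dvdX k P.
  elim: k => [|k IH] F dF ddF hF VF m P HP; first by exists P; rewrite expr0 mulr1.
  apply: dvdX_deriv.
    have [-> _] := HP 0 (eq_ind_r (fun x => x != 0) (oner_neq0 _) d0).
    rewrite d0 expr1n mul1r /G /cayley_curve !scale0r !addr0 mulmx0 subr0 invmx1 !mulmx1.
    by apply: hs VF; exists dF, ddF.
  pose Fab ab A := dF A (A *m Emx eps ab.1 ab.2).
  have /choice[Q HQ] : forall ab : 'I_n * 'I_n, exists mP : nat * {poly R},
      B ab.1 && B ab.2 -> dvdX k mP.2 /\
      forall t, d.[t] != 0 -> mP.2.[t] = d.[t] ^+ mP.1 * Fab ab (G t).
    move=> [a b]; have [/andP[Ba Bb]|] := boolP (B a && B b); last by exists (0%N, 0).
    have [d2 hd] := pf_left_inv (Emx eps a b) hF.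
    have [l [Q HQ]] := rat _ _ _ hd.
    exists (l, Q) => _; split; last by move=> t dt; have [] := HQ t dt.
    exact: IH hd (tang_derivation SM (StE Ba Bb) hF VF) _ _ HQ.
  (* A common exponent puts all numerators [Q ab] over one power of [d]; as [d] is 1 at t = 0, such
     powers do not affect the order of vanishing there. *)
  pose l := \sum_ab (Q ab).1.
  have lE ab : (l = (l - (Q ab).1) + (Q ab).1)%N.
    by rewrite subnK // /l (bigD1 ab) //= leq_addr.
  pose rhs := m%:R *: (d ^+ l.+1 * d^`() * P) + 2^-1 *: (d ^+ m.+1 *
     \sum_(ab | B ab.1 && B ab.2) cayley_speed_num X ab.1 ab.2 * d ^+ (l - (Q ab).1) * (Q ab).2).
  have E : d ^+ l.+2 * P^`() = rhs.
    apply: (poly_eq_off dnz) => t dt; have [_ e] := HP t dt.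
    rewrite /rhs !(hornerD, hornerZ, hornerM, horner_exp).
    rewrite (_ : d.[t] * _ * P^`().[t] = d.[t] ^+ l.+1 * (d.[t] * P^`().[t])); last by ring.
    rewrite e.
    rewrite mulrDr; congr (_ + _); first by ring.
    rewrite horner_sum mulr_sumr.
    have [sY tY] := YsoJ t dt.
    have -> : G t *m Y t = 2^-1 *: \sum_(ab | B ab.1 && B ab.2) Y t ab.1 ab.2 *: (G t *m Emx eps ab.1 ab.2).
      rewrite {1}(soJ_expand Heps sY) -scalemxAr pair_big /= mulmx_sumr; congr (_ *: _).
      rewrite [RHS]big_mkcond; apply: eq_bigr => ab _; rewrite -scalemxAr.
      by case: ifP => // /negbT /tY ->; rewrite scale0r.
    rewrite (pf_scaler hF) -big_filter (pf_sumr hF) -[in RHS]big_filter.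
    rewrite (mulrCA (d.[t] ^+ m.+1)) (mulrCA (d.[t] ^+ l.+1)); congr (_ * _).
    rewrite mulrA mulr_sumr; apply: eq_big_seq => ab; rewrite mem_filter => /andP[Bab _].
    have [_ h] := HQ ab Bab.
    rewrite !hornerM horner_exp h // speedE // (pf_scaler hF) -/(Y t).
    rewrite -/(Fab ab (G t)) exprS {1}(lE ab) exprD.
    by ring.
  apply: (@dvdX_cancel _ _ (d ^+ l.+2)).
    by rewrite horner_exp d0 expr1n oner_neq0.
  rewrite E; apply: dvdX_add.
    by rewrite -mul_polyC; do 2!apply: dvdX_mull; apply: IH hF VF _ _ HP.
  rewrite -mul_polyC; do 2!apply: dvdX_mull.
  rewrite -big_filter big_seq; elim/big_rec: _ => [|ab x].
    by exists 0; rewrite mul0r.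
  rewrite mem_filter => /andP[Bab _] hx; apply: dvdX_add hx; apply: dvdX_mull.
  by have [] := HQ ab Bab.
move=> F [dF [ddF hF]] VF.
have [m [P HP]] := rat _ _ _ hF.
have P0 : P = 0 by apply: dvdX_all => k; exact: claim hF VF m P HP.
have [+ _] := HP 1 d1'; rewrite P0 horner0 => /esym/eqP.
by rewrite mulf_eq0 expf_eq0 (negPf d1') andbF /= /G /cayley_curve !scale1r => /eqP.
Qed.

(** Inverse Cayley transform: as -1 is not an eigenvalue of [k], X = (k - 1)(k + 1)^-1 exists, lies
    in the Lie algebra with the support of [k - 1%:M], and the curve from [s] reaches s k at time
    1. *)
Lemma zc_cayley_mulr (s k : M) : zc S s -> OJ eps k -> supp_on (k - 1%:M) ->
  \det (k + 1%:M) != 0 -> zc S (s *m k).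
Proof.
move=> hs hk sk dk.
have U : k + 1%:M \in unitmx by rewrite unitmxE unitfE.
pose X := (k - 1%:M) *m invmx (k + 1%:M).
have comm : (k - 1%:M) *m (k + 1%:M) = (k + 1%:M) *m (k - 1%:M).
  by rewrite mulmxBl mul1mx mulmxDr mulmx1 mulmxDl mul1mx mulmxBr mulmx1 opprD !addrA addrK subrK.
have X1 : X *m (k + 1%:M) = k - 1%:M by rewrite /X mulmxKV.
have X2 : X = invmx (k + 1%:M) *m (k - 1%:M).
  by rewrite -[RHS](mulmxK U) -(mulmxA _ (k - _)) comm mulmxA mulVmx // mul1mx.
have X3 : (k + 1%:M) *m X = k - 1%:M by rewrite X2 mulKVmx.
have kX : k *m (1%:M - X) = 1%:M + X.
  have E : k *m X = k - 1%:M - X by move: X3; rewrite mulmxDl mul1mx => <-; rewrite addrK.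
  by rewrite mulmxBr mulmx1 E; apply/matrixP => i j; rewrite !mxE; ring.
have U1 : 1%:M - X \in unitmx.
  have e : (2^-1 *: (1%:M - X)) *m (k + 1%:M) = 1%:M.
    by rewrite -scalemxAl mulmxBl mul1mx X1; apply/matrixP => i j; rewrite !mxE; field.
  by have [] := mulmx1_unit e; rewrite unitmxZ ?unitfE ?invr_eq0 ?pnatr_eq0.
have Uk : k \in unitmx by have [] := mulmx1_unit (OJ_inv Heps hk).
have X4 : 1%:M - X *m X = (1%:M - X) *m (1%:M + X).
  by rewrite mulmxBl mul1mx mulmxDr mulmx1 opprD addrA addrK.
have Ud : 1%:M - X *m X \in unitmx by rewrite X4 -kX !unitmx_mul U1 Uk.
have soX : soJ eps X.
  apply/soJP => //; have /OJP hk' := hk.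
  have ak : adjJ eps (k + 1%:M) = adjJ eps k + 1%:M by rewrite adjJD adjJ1.
  have : (adjJ eps (k + 1%:M)) *m (adjJ eps X + X) *m (k + 1%:M) = 0.
    rewrite (mulmxDr (adjJ eps (k + 1%:M))) -adjJM // X1 mulmxDl -(mulmxA _ X) X1 ak adjJB adjJ1 //.
    rewrite mulmxBl mulmxDl !mulmxDr !mulmxN !mulmx1 !mul1mx hk' //.
    by apply/matrixP => i j; rewrite !mxE; ring.
  have Ua : adjJ eps (k + 1%:M) \in unitmx.
    rewrite /adjJ !unitmx_mul unitmx_tr U andbT.
    by have [-> _] := mulmx1_unit (JJ Heps).
  move: (adjJ eps (k + 1%:M)) (adjJ eps X) Ua => ka aX Ua.
  move=> /(congr1 (fun A => invmx ka *m A *m invmx (k + 1%:M))).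
  rewrite /= mulmx0 mul0mx -!mulmxA (mulKmx Ua) (mulmxV U) mulmx1.
  by move/eqP; rewrite addr_eq0 => /eqP.
have suppX : supp_on X.
  move=> i j; rewrite negb_and => /orP[b|b]; last by rewrite X2 supp_cols.
  by rewrite /X supp_rows.
have := cayley_zc hs soX suppX; rewrite -unitfE -unitmxE => /(_ Ud).
have -> // : s *m ((1%:M + X) *m (1%:M + X)) *m invmx (1%:M - X *m X) = s *m k.
rewrite -mulmxA; congr (_ *m _); rewrite -{1}kX -(mulmxA k) -X4.
by rewrite mulmxK.
Qed.

(* With [u = sin t] and [v = cos t - 1] (or [sinh], [cosh]) this is the rotation
   (or boost) of angle [t] in the plane of [a] and [b]. *)
Definition planar a b u v : M :=
  1%:M + u *: Emx eps a b + v *: (delta_mx a a + delta_mx b b).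

Section Planar.
Variables (a b : 'I_n).
Hypothesis ab : a != b.
Let P : M := delta_mx a a + delta_mx b b.
Let X := Emx eps a b.
Let e := eps a * eps b.

Let XP : X *m P = X.
Proof.
rewrite /X /Emx /P mulmxBl !mulmxDr -!scalemxAl !mul_delta_mx_cond !eqxx.
by rewrite (eq_sym b a) (negPf ab) !mulr0n !mulr1n ?scaler0 ?add0r ?addr0.
Qed.

Let PX : P *m X = X.
Proof.
rewrite /X /Emx /P mulmxBr !mulmxDl -!scalemxAr !mul_delta_mx_cond !eqxx.
by rewrite (eq_sym b a) (negPf ab) !mulr0n !mulr1n ?scaler0 ?add0r ?addr0.
Qed.

Let PP : P *m P = P.
Proof.
rewrite /P mulmxDl !mulmxDr !mul_delta_mx_cond !eqxx.
by rewrite (eq_sym b a) (negPf ab) !mulr0n !mulr1n ?scaler0 ?add0r ?addr0.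
Qed.

Let XX : X *m X = (- e) *: P.
Proof.
rewrite /X /Emx /P mulmxBl !mulmxBr -!scalemxAl -!scalemxAr !mul_delta_mx_cond !eqxx.
rewrite (eq_sym b a) (negPf ab) !mulr0n !mulr1n /e.
by apply/matrixP => i j; rewrite !mxE; ring.
Qed.

Notation planar := (planar a b).

Lemma planarM u v u' v' : planar u v *m planar u' v' =
  planar (u + u' + u * v' + v * u') (v + v' - e * u * u' + v * v').
Proof.
rewrite /planar !mulmxDl !mulmxDr -!scalemxAl -!scalemxAr !mul1mx !mulmx1 XX XP PX PP.
by apply/matrixP => i j; rewrite !mxE; ring.
Qed.

Lemma adjJ_planar u v : adjJ eps (planar u v) = planar (- u) v.
Proof.
have adjZ c (A : M) : adjJ eps (c *: A) = c *: adjJ eps A.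
  by rewrite /adjJ linearZ /= -scalemxAr -scalemxAl.
have adjP : adjJ eps P = P.
  apply/matrixP => i j; rewrite adjJE // !mxE mulrDr.
  rewrite [(j == a) && _]andbC [(j == b) && _]andbC.
  by congr (_ + _); case: andP => [[/eqP-> /eqP->]|_]; rewrite ?Heps ?mulr1 ?mulr0.
rewrite /planar !adjJD !adjZ adjJ1 // adjP.
by have /soJP -> // := soJ_Emx Heps a b; rewrite scalerN scaleNr.
Qed.

(** The condition reads (1 + v)^2 + e u^2 = 1: cos^2 + sin^2 or cosh^2 - sinh^2, according to the
    sign [e]. *)
Lemma OJ_planar u v : v ^+ 2 + 2 * v + e * u ^+ 2 = 0 -> OJ eps (planar u v).
Proof.
move=> h; apply/OJP => //; rewrite adjJ_planar planarM.
rewrite (_ : 1%:M = planar 0 0); last by rewrite /planar !scale0r !addr0.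
congr planar; last by rewrite -h; ring.
ring.
Qed.

(** On the plane of [a] and [b], [planar u v + 1%:M] has determinant 2 (2 + v); [v != -2] is what
    the Cayley transform requires. *)
Lemma planar_zc s u v : B a -> B b -> v ^+ 2 + 2 * v + e * u ^+ 2 = 0 -> v != -2 ->
  zc S s -> zc S (s *m planar u v).
Proof.
move=> Ba Bb h v2 hs.
apply: zc_cayley_mulr => //.
- exact: OJ_planar.
- move=> i j; rewrite /planar -[X in X - _]addrA addrAC subrr add0r => nB.
  rewrite !mxE; have -> : (i == a) && (j == b) = false.
    by apply: contraNF nB => /andP[/eqP-> /eqP->]; rewrite Ba.
  have -> : (i == b) && (j == a) = false.
    by apply: contraNF nB => /andP[/eqP-> /eqP->]; rewrite Ba Bb.
  have -> : (i == a) && (j == a) = false.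
    by apply: contraNF nB => /andP[/eqP-> /eqP->]; rewrite Ba.
  have -> : (i == b) && (j == b) = false.
    by apply: contraNF nB => /andP[/eqP-> /eqP->]; rewrite Bb.
  by rewrite /= !mulr0n; ring.
- rewrite -unitfE -unitmxE.
  have w2 : 2 + v != 0 by rewrite addrC -(opprK 2) subr_eq0.
  have E : (planar u v + 1%:M) *m (2^-1 *: planar (- u / (2 + v)) 0) = 1%:M.
    rewrite -scalemxAr mulmxDl mul1mx planarM /planar.
    have h' : e * u ^+ 2 = - (v * (2 + v)) by move: h; lra.
    have -> : v + 0 - e * u * (- u / (2 + v)) + v * 0 = 0.
      rewrite (_ : e * u * (- u / (2 + v)) = - (e * u ^+ 2) / (2 + v)); last by ring.
      by rewrite h' opprK mulfK //; ring.
    have -> : u + - u / (2 + v) + u * 0 + v * (- u / (2 + v)) = u / (2 + v) by field.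
    apply/matrixP => i j; rewrite !mxE; field. 
    by rewrite w2.
  by have [] := mulmx1_unit E.
Qed.

Lemma sgn_pair_zc s : B a -> B b -> zc S s -> zc S (s *m sgn_mx R [set a; b]).
Proof.
move=> Ba Bb hs.
have -> : sgn_mx R [set a; b] = planar 0 (-2).
  apply/matrixP => i j; rewrite sgn_mxE /planar scale0r addr0 !mxE !inE.
  have [<-|ij] := eqVneq i j.
    have [->|ia] := eqVneq i a; first by rewrite (negPf ab) /= !mulr1n expr1; ring.
    by have [_|ib] := eqVneq i b; rewrite /= ?mulr1n ?mulr0n ?expr1 ?expr0; ring.
  have -> : (i == a) && (j == a) = false.
    by apply: contraNF ij => /andP[/eqP-> /eqP->].
  have -> : (i == b) && (j == b) = false.
    by apply: contraNF ij => /andP[/eqP-> /eqP->].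
  by rewrite !mulr0n; ring.
have ha := Heps a; have hb := Heps b.
have : e * e = 1 by rewrite /e mulrACA ha hb mulr1.
move=> /eqP; rewrite -expr2 sqrf_eq1 => /orP[/eqP e1|/eqP e1].
  (* A half-turn has eigenvalue -1, but it is the square of a quarter-turn. *)
  have -> : planar 0 (-2) = planar 1 (-1) *m planar 1 (-1).
    by rewrite planarM e1; congr planar; ring.
  have h : (-1 : R) ^+ 2 + 2 * -1 + e * 1 ^+ 2 = 0 by rewrite e1; ring.
  have h2 : (-1 : R) != -2 by rewrite eqr_opp lt_eqF // ltr1n.
  by rewrite mulmxA; do 2!apply: planar_zc => //.
(* In a hyperbolic plane, -1 is the product of the boost with cosh = 5/3, sinh = 4/3 and of minus
   its inverse; the latter has eigenvalues -3 and -1/3, so neither factor has eigenvalue -1. *)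
have -> : planar 0 (-2) = planar (4 / 3) (- 8 / 3) *m planar (4 / 3) (2 / 3).
  by rewrite planarM e1; congr planar; field.
rewrite mulmxA; apply: planar_zc => //; last apply: planar_zc => //.
- by rewrite e1; field.
- by apply/eqP => h; lra.
- by rewrite e1; field.
- by apply/eqP => h; lra.
Qed.

End Planar.

Lemma sgn_even_zc s (f : {set 'I_n}) : {subset f <= B} -> ~~ odd #|f| ->
  zc S s -> zc S (s *m sgn_mx R f).
Proof.
have [m] := ubnP #|f|; elim: m f s => // m IH f s fm fB ev hs.
have [->|[a af]] := set_0Vmem f.
  have -> : sgn_mx R finset.set0 = 1%:M :> M.
    by apply/matrixP => i j; rewrite sgn_mxE inE mxE expr0.
  by rewrite mulmx1.
have [f0|[b]] := set_0Vmem (f :\ a).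
  by move: ev; rewrite (cardsD1 a) af f0 cards0.
rewrite !inE => /andP[ba bf].
have bf' : b \in f :\ a by rewrite !inE ba.
have E : sgn_mx R f = sgn_mx R [set a; b] *m sgn_mx R (f :\ a :\ b) :> M.
  apply/matrixP => i j; rewrite mul_sgn_mx !sgn_mxE !inE.
  case: (i == j); rewrite ?mulr0n ?mulr0 // !mulr1n.
  have [->|ia] := eqVneq i a; first by rewrite af /= andbF expr0 mulr1.
  by have [->|ib] := eqVneq i b; rewrite ?bf ?orbT /= ?expr0 ?mulr1 ?mul1r.
have cf : #|f| = #|f :\ a :\ b|.+2 by rewrite (cardsD1 a f) af (cardsD1 b (f :\ a)) bf'.
rewrite E mulmxA; apply: IH.
- by move: fm; rewrite cf !ltnS => /ltnW.
- by move=> i; rewrite !inE => /andP[_ /andP[_ /fB]].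
- by move: ev; rewrite cf /= negbK.
- by apply: sgn_pair_zc => //; [rewrite eq_sym|exact: fB|exact: fB].
Qed.

(** A sign matrix D with det (D + k) nonzero makes c = D k accessible to the Cayley transform, since
    c + 1 = D (D + k). Then det c = 1 shows that D has evenly many signs -1, so D is a product of
    half-turns. *)
Lemma orthogonal_zc_mulr (s k : M) : zc S s -> OJ eps k -> \det k = 1 ->
  supp_on (k - 1%:M) -> zc S (s *m k).
Proof.
move=> hs hk dk sk; have [f df] := sign_det k.
(* Outside [B] the rows of [k] are those of 1, and a sign -1 would annihilate a row of D + k. *)
have fB : {subset f <= B}.
  move=> i fi; apply: contraT => nB; case/negP: df.
  rewrite (expand_det_row _ i) big1 // => j _.
  have := sk i j; rewrite negb_and nB => /(_ isT); rewrite !mxE => /eqP.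
  rewrite subr_eq0 => /eqP ->; rewrite fi expr1.
  by case: (i == j); rewrite ?mulr0n ?mulr1n ?addNr ?addr0 mul0r.
pose c := sgn_mx R f *m k.
have sJ : OJ eps (sgn_mx R f).
  apply/matrixP => i j; rewrite /OJ (_ : (sgn_mx R f)^T = sgn_mx R f); last first.
    by apply/matrixP => k' l; rewrite mxE !sgn_mxE eq_sym; case: eqP => [->|].
  rewrite -mulmxA mul_sgn_mx mulJmx sgn_mxE JmxE.
  case: (i == j); rewrite ?mulr0n ?mulr0 // !mulr1n mulrCA -signr_addb addbb.
  by rewrite mulr1.
have cJ : OJ eps c by exact: OJM.
have E : c + 1%:M = sgn_mx R f *m (sgn_mx R f + k) by rewrite mulmxDr sgn_mxK addrC.
have dc : \det (c + 1%:M) != 0.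
  by rewrite E det_mulmx mulf_neq0 // det_sgn_mx signr_eq0.
(* c + 1 is the product of its adjoint with c, and the adjoint has the same determinant. *)
have det_c : \det c = 1.
  have /OJP h := cJ.
  have : \det (c + 1%:M) = \det (adjJ eps (c + 1%:M)) * \det c.
    by rewrite -det_mulmx adjJD adjJ1 // mulmxDl mul1mx h // addrC.
  have -> : \det (adjJ eps (c + 1%:M)) = \det (c + 1%:M).
    rewrite /adjJ !det_mulmx det_tr mulrAC -det_mulmx JJ // det1 mul1r //.
  by rewrite -{1}[\det (c + 1%:M)]mulr1 => /(mulfI dc) <-.
have ev : ~~ odd #|f|.
  move: det_c; rewrite /c det_mulmx dk mulr1 det_sgn_mx -signr_odd.
  by case: (odd _) => //= /eqP; rewrite expr1 lt_eqF //; lra.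
have sc : supp_on (c - 1%:M).
  move=> i j nB; have kij : k i j = (1%:M : M) i j.
    by have := sk i j nB; rewrite !mxE => /eqP; rewrite subr_eq0 => /eqP.
  have -> : (c - 1%:M) i j = c i j - (1%:M : M) i j by rewrite [LHS]mxE [X in _ + X]mxE.
  rewrite /c mul_sgn_mx kij !mxE.
  have [ij|_] := eqVneq i j; last by rewrite mulr0n mulr0 subrr.
  have [fi|_] := boolP (i \in f); last by rewrite expr0 mul1r subrr.
  by move: nB; rewrite -ij andbb => /negP[]; exact: fB.
have -> : s *m k = (s *m sgn_mx R f) *m c by rewrite /c -mulmxA (mulmxA (sgn_mx R f)) sgn_mxK mul1mx.
by apply: zc_cayley_mulr => //; exact: sgn_even_zc.
Qed.

End OrthogonalGroupGeneration.

(** * Small elements of orthogonal groups *)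

Section Contraction.
Variables (R : realType) (n : nat).
Notation M := 'M[R]_n.

Lemma geometric_le0 (x c : R) : (forall k, x <= c * 2^-1 ^+ k) -> x <= 0.
Proof.
move=> H; rewrite leNgt; apply/negP => x0.
have c0 : 0 < c by have := H 0%N; rewrite expr0 mulr1; exact: lt_le_trans.
have [k hk] : exists k : nat, c / x < k%:R.
  by exists (Num.bound (c / x)); apply: archi_boundP; rewrite divr_ge0 ?ltW.
have := H k; apply/negP; rewrite -ltNge exprVn.
rewrite ltr_pdivrMr ?exprn_gt0 // mulrC -ltr_pdivrMr //.
apply: lt_trans hk _; rewrite -natrX ltr_nat; exact: ltn_expl.
Qed.

(* Subtracting tangent vectors does not change the value of [dF 1%:M] at [X],
   while the remainder tends to [0]. *)
Lemma tang_contraction (S A : M -> Prop) :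
  (forall X, A X -> exists X', [/\ tang S X', A (X - X') & nrm (X - X') <= 2^-1 * nrm X]) ->
  forall X, A X -> tang S X.
Proof.
move=> H X AX F dF ddF hF VF; have [C C0 HC] := pf_dbound hF 1%:M.
suff {X AX} K k : forall X, A X -> `|dF 1%:M X| <= C * nrm X * 2^-1 ^+ k.
  apply/eqP; rewrite -normr_le0; apply: (@geometric_le0 _ (C * nrm X)) => k.
  exact: K.
elim: k => [|k IH] X AX; first by rewrite expr0 mulr1.
have [X' [tX' AX' le]] := H X AX.
have -> : dF 1%:M X = dF 1%:M (X - X').
  by rewrite -scaleN1r addrC (pf_linear hF) (tX' _ _ _ hF VF) mulr0 add0r.
apply: le_trans (IH _ AX') _.
rewrite exprS mulrA ler_wpM2r ?exprn_ge0 ?invr_ge0 // -mulrA ler_wpM2l // mulrC //.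
Qed.

End Contraction.

Section Zassenhaus.
Variables (R : realType) (n : nat) (eps : 'I_n -> R).
Hypothesis Heps : forall i, eps i * eps i = 1.
Notation M := 'M[R]_n.

Lemma nrm_adjJ (A : M) : nrm (adjJ eps A) = nrm A.
Proof.
have e1 i : `|eps i| = 1.
  by apply/eqP; rewrite -[_ == 1](@eqrXn2 _ 2) ?normr_ge0 // expr1n -normrX expr2 Heps normr1.
have le (B : M) : nrm (adjJ eps B) <= nrm B.
  apply: nrm_le => [|i j]; first exact: nrm_ge0.
  by rewrite adjJE !normrM !e1 !mul1r nrm_entry.
by apply/le_anti; rewrite le /= -{1}(adjJK Heps A) le.
Qed.

(* Take [a] in [G] nearly closest to [1]: commutators with the elements of [Q]
   are closer, so [a] commutes with [Q] and the largest entry of [a - 1] is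
   diagonal; but [OJ] makes diagonal entries quadratic in [a - 1]. *)
Lemma zassenhaus (G Q : M -> Prop) (r : R) :
  (0 < n)%N -> r * (16 * n%:R ^+ 3) <= 1 ->
  (forall g, G g -> OJ eps g) -> (forall g h, G g -> G h -> G (g *m h)) ->
  (forall g, G g -> G (adjJ eps g)) ->
  (forall g, Q g -> G g /\ nrm (g - 1%:M) <= r) ->
  (exists2 g, Q g & g != 1%:M) ->
  (forall a, G a -> (forall g, Q g -> a *m g = g *m a) ->
     forall i j, i != j -> `|(a - 1%:M) i j| <= 2^-1 * nrm (a - 1%:M)) ->
  forall e, 0 < e -> exists s, [/\ G s, s != 1%:M & nrm (s - 1%:M) < e].
Proof.
move=> n0 hr GO GM GV QG [g0 Qg0 g01] HQ e e0.
have nge1 : 1 <= n%:R :> R by rewrite ler1n.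
apply: contrapT => iso.
have {}iso s : G s -> s != 1%:M -> e <= nrm (s - 1%:M).
  by move=> Gs s1; rewrite leNgt; apply/negP => lt; apply: iso; exists s.
pose D : set R := [set x | exists s, [/\ G s, s != 1%:M & x = nrm (s - 1%:M)]]%classic.
have [Gg0 g0r] := QG _ Qg0.
have Dg0 : D (nrm (g0 - 1%:M)) by exists g0.
have hD : has_inf D.
  split; first by exists (nrm (g0 - 1%:M)).
  by exists e => _ [s [Gs s1 ->]]; exact: iso.
pose m := inf D.
have m0 : 0 < m.
  apply: lt_le_trans e0 _; apply: lb_le_inf; first by case: hD.
  by move=> _ [s [Gs s1 ->]]; exact: iso.
have mle s : G s -> s != 1%:M -> m <= nrm (s - 1%:M).
  by move=> Gs s1; apply: ge_inf; [case: hD|exists s].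
have [_ [a [Ga a1 ->]] am] := inf_adherent m0 hD.
set x := nrm (a - 1%:M) in am; have xm : x < 2 * m by move: am; rewrite -/m; lra.
have mr : m <= r by apply: le_trans (mle _ Gg0 g01) g0r.
have r16 : 16 * r <= 1.
  have n3 : 1 <= n%:R ^+ 3 :> R by rewrite exprn_ege1.
  have r0 : 0 <= r by lra.
  have := ler_wpM2l r0 n3; lra.
have nrm2 g : nrm (g - 1%:M) <= 1 -> nrm g <= 2 :> R.
  move=> g1; rewrite -(subrK 1%:M g); apply: le_trans (nrmD _ _) _.
  apply: lerD => //; apply: le_trans (nrm_scalar_le _ _) _.
  by rewrite normr1.
have comm g : Q g -> a *m g = g *m a.
  move=> Qg; have [Gg gr] := QG _ Qg.
  pose c := a *m g *m adjJ eps a *m adjJ eps g.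
  have Gc : G c by apply: (GM _ _ _ (GV _ Gg)); apply: (GM _ _ _ (GV _ Ga)); exact: GM.
  have Va := OJ_inv Heps (GO _ Ga); have Vg := OJ_inv Heps (GO _ Gg).
  (* Thus c - 1 has norm at most 8 n^3 r x, which the bound on [r] makes at most x / 2 < m. *)
  have cE : c - 1%:M = ((a - 1%:M) *m (g - 1%:M) - (g - 1%:M) *m (a - 1%:M)) *m adjJ eps a *m adjJ eps g.
    rewrite (_ : (a - 1%:M) *m (g - 1%:M) - (g - 1%:M) *m (a - 1%:M) = a *m g - g *m a).
      by rewrite !mulmxBl -(mulmxA g a) Va mulmx1 Vg.
    by rewrite !mulmxBl !mulmxBr !mulmx1 !mul1mx; apply/matrixP => i j; rewrite !mxE; ring.
  have cm : nrm (c - 1%:M) < m.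
    have na : nrm (adjJ eps a) <= 2 by rewrite nrm_adjJ nrm2 // -/x; lra.
    have ng : nrm (adjJ eps g) <= 2 by rewrite nrm_adjJ nrm2 //; lra.
    have x0 : 0 <= x by exact: nrm_ge0.
    have h1 := nrmM_le (lexx x) gr; have h2 := nrmM_le gr (lexx x).
    have h3 := le_trans (nrmB _ _) (lerD h1 h2).
    have h4 := nrmM_le (nrmM_le h3 na) ng.
    rewrite cE; apply: le_lt_trans h4 _.
    rewrite (_ : _ * 2 = (r * (16 * n%:R ^+ 3)) * (x / 2)); last by field.
    have : r * (16 * n%:R ^+ 3) * (x / 2) <= 1 * (x / 2) by rewrite ler_wpM2r // divr_ge0.
    lra.
  have [c1|cn1] := eqVneq c 1%:M; last first.
    by have := mle _ Gc cn1; rewrite leNgt cm.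
  have Vg' : adjJ eps g *m g = 1%:M by apply/OJP => //; exact: GO.
  have Va' : adjJ eps a *m a = 1%:M by apply/OJP => //; exact: GO.
  have := congr1 (fun A => A *m g *m a) c1.
  rewrite /= mul1mx /c -(mulmxA _ (adjJ eps g)) Vg' mulmx1.
  by rewrite -(mulmxA _ (adjJ eps a)) Va' mulmx1.
have HT := HQ _ Ga comm; rewrite -/x in HT.
have x0 : 0 < x by apply: nrm_gt0; rewrite subr_eq0.
have [i [j xij]] : exists i j, x = `|(a - 1%:M) i j|.
  by apply: nrm_attained; rewrite subr_eq0.
have ij : i = j.
  by apply/eqP; apply: contraT => /HT; rewrite -xij; lra.
rewrite -{j}ij in xij.
pose T := a - 1%:M.
(* The (i, i) entry of T^T J + J T + T^T J T = 0, which says that 1 + T preserves the form. *)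
have E : 2 * (eps i * T i i) = - \sum_k T k i * (eps k * T k i).
  have aE : a = 1%:M + T by rewrite /T addrC subrK.
  have h : Jmx eps + T^T *m Jmx eps + (Jmx eps *m T + T^T *m (Jmx eps *m T)) = Jmx eps.
    have aT : a^T = 1%:M + T^T by rewrite {1}aE [LHS]raddfD /= trmx1.
    have := GO _ Ga; rewrite /OJ aT -mulmxA {1}aE mulmxDr mulmx1 mulmxDl mul1mx mulmxDr.
    by rewrite addrACA.
  have := congr1 (fun A : M => A i i) h.
  rewrite [LHS]mxE [X in X + _]mxE [X in _ + X = _]mxE mulmxJ mulJmx.
  rewrite [T^T i i]mxE (_ : (T^T *m (Jmx eps *m T)) i i = \sum_k T k i * (eps k * T k i)).
    lra.
  by rewrite mxE; apply: eq_bigr => k _; rewrite mulJmx mxE.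
have e1 k : `|eps k| = 1.
  by apply/eqP; rewrite -[_ == 1](@eqrXn2 _ 2) ?normr_ge0 // expr1n -normrX expr2 Heps normr1.
have : 2 * x <= n%:R * x ^+ 2.
  have -> : 2 * x = `|2 * (eps i * T i i)|.
    by rewrite !normrM e1 mul1r [in LHS]xij ger0_norm.
  rewrite E normrN.
  apply: le_trans (ler_norm_sum _ _ _) _.
  have -> : n%:R * x ^+ 2 = \sum_(k < n) x * x by rewrite sumr_const card_ord expr2 mulr_natl.
  apply: ler_sum => k _; rewrite !normrM e1 mul1r ler_pM //; exact: nrm_entry.
rewrite expr2 mulrA ler_pM2r // => h.
have n3 : n%:R <= n%:R ^+ 3 :> R by rewrite -{1}(expr1 n%:R) ler_weXn2l.
have : n%:R * x < n%:R * (2 * r) by rewrite ltr_pM2l; lra.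
have r0 : 0 <= r by lra.
have : r * n%:R <= r * n%:R ^+ 3 by rewrite ler_wpM2l.
lra.
Qed.

End Zassenhaus.

(** * Powers of orthogonal matrices *)

Section MatrixPowers.
Variables (R : realType) (n : nat).
Notation M := 'M[R]_n.

Definition mpow (A : M) k := iter k (mulmx A) 1%:M.

Lemma mpowD A k l : mpow A (k + l) = mpow A k *m mpow A l.
Proof.
elim: k => [|k IH]; first by rewrite mul1mx.
by rewrite addSn [LHS]/= -/(mpow A (k + l)) IH mulmxA.
Qed.

Lemma mpowM A k l : mpow A (k * l) = mpow (mpow A k) l.
Proof. by elim: l => [|l IH] /=; rewrite ?muln0 // mulnS mpowD IH. Qed.

Lemma mpow_comm A T k : T *m A = A *m T -> T *m mpow A k = mpow A k *m T.
Proof.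
move=> c; elim: k => [|k IH] /=; first by rewrite mulmx1 mul1mx.
by rewrite mulmxA c -!mulmxA IH.
Qed.

Lemma poly_mpow k i j : poly_fun (fun A : M => mpow A k i j).
Proof.
elim: k i j => [|k IH] i j /=; first exact: poly_const.
apply: (@poly_ext _ _ (fun A => \sum_(l <- index_enum 'I_n) A i l * mpow A k l j)).
  by apply: poly_sum => l; apply: poly_mul; [exact: poly_coord|exact: IH].
by move=> A; rewrite mxE.
Qed.

Lemma orthogonal_entry (A : M) : A^T *m A = 1%:M -> nrm A <= 1.
Proof.
move=> h; apply: nrm_le => // i j.
have := congr1 (fun B : M => B j j) h; rewrite !mxE eqxx mulr1n (bigD1 i) //= mxE => e.
have : 0 <= \sum_(k < n | k != i) A^T j k * A k j.
  by apply: sumr_ge0 => k _; rewrite mxE -expr2 sqr_ge0.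
move=> S0; rewrite -(expr_le1 (_ : 0 < 2)%N) ?normr_ge0 // real_normK ?num_real //.
by rewrite expr2; lra.
Qed.

Lemma orthogonal_mpow (A : M) k : A^T *m A = 1%:M -> (mpow A k)^T *m mpow A k = 1%:M.
Proof.
move=> h; elim: k => [|k IH] /=; first by rewrite trmx1 mulmx1.
by rewrite trmx_mul -mulmxA (mulmxA A^T) h mul1mx.
Qed.

(* Pigeonhole on the powers of [A], whose entries lie in [[-1, 1]]. *)
Lemma power_near_one (r : R) : 0 < r -> exists K : nat, forall A : M, A^T *m A = 1%:M ->
  exists m, [/\ (0 < m)%N, (m <= K)%N & nrm (mpow A m - 1%:M) <= r].
Proof.
move=> r0.
(* Mesh of a grid on [-1, 1]: powers in the same cell differ by at most [d], and multiplying by an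
   inverse power costs a factor n. *)
pose d := r / (n%:R + 1); have n1 : 0 < n%:R + 1 :> R by have := ler0n R n; lra.
have d0 : 0 < d by rewrite divr_gt0.
pose L := (Num.truncn (2 / d)).+1.
pose K := #|{ffun 'I_n * 'I_n -> 'I_L}|.
exists K => A hA.
have lt1 k ij : (Num.truncn ((mpow A k ij.1 ij.2 + 1) / d) < L)%N.
  rewrite ltnS; apply: le_truncn; rewrite ler_pM2r ?invr_gt0 //.
  have := le_trans (nrm_entry (mpow A k) ij.1 ij.2) (orthogonal_entry (orthogonal_mpow k hA)).
  by rewrite ler_norml => /andP[_]; lra.
pose f (k : 'I_K.+1) : {ffun 'I_n * 'I_n -> 'I_L} := [ffun ij => Ordinal (lt1 k ij)].
have /injectivePn[k1 [k2 k12 fk]] : ~~ injectiveb f.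
  by apply/negP => /injectiveP /leq_card; rewrite card_ord -/K ltnn.
wlog lt12 : k1 k2 k12 fk / (k1 < k2)%N.
  move=> H; have [|] := ltnP k1 k2; first exact: H.
  rewrite leq_eqVlt => /orP[/eqP e|lt]; last by apply: (H k2 k1) => //; rewrite eq_sym.
  by case/eqP: k12; apply/val_inj.
exists (k2 - k1)%N; split; first by rewrite subn_gt0.
  by rewrite (leq_trans (leq_subr _ _)) // -ltnS.
have orth := orthogonal_mpow k1 hA.
have -> : mpow A (k2 - k1) - 1%:M = (mpow A k1)^T *m (mpow A k2 - mpow A k1).
  by rewrite mulmxBr orth -{2}(subnKC (ltnW lt12)) mpowD mulmxA orth mul1mx.
have h1 : nrm (mpow A k1)^T <= 1 by rewrite nrm_tr orthogonal_entry.
have h2 : nrm (mpow A k2 - mpow A k1) <= d.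
  apply: nrm_le => [|i j]; first exact: ltW.
  have := congr1 (fun g : {ffun 'I_n * 'I_n -> 'I_L} => val (g (i, j))) fk.
  rewrite !ffunE /= => e.
  have pos k : 0 <= (mpow A k i j + 1) / d.
    apply: divr_ge0 (ltW d0).
    have := le_trans (nrm_entry (mpow A k) i j) (orthogonal_entry (orthogonal_mpow k hA)).
    by rewrite ler_norml => /andP[]; lra.
  have /andP[a1 a2] := truncn_itv (pos k1); have /andP[b1 b2] := truncn_itv (pos k2).
  rewrite e in a1 a2; set t := Num.truncn _ in a1 a2 b1 b2.
  rewrite -natr1 in a2 b2.
  move: a1 a2 b1 b2; rewrite ler_pdivlMr // ltr_pdivrMr // ler_pdivlMr // ltr_pdivrMr // => a1 a2 b1 b2.
  by rewrite !mxE ler_norml; apply/andP; split; lra.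
apply: le_trans (nrmM_le h1 h2) _; rewrite mulr1 /d mulrA ler_pdivrMr //.
by rewrite mulrC ler_wpM2l //; lra.
Qed.

End MatrixPowers.

(** * Commutant and unit operators near a dense representation *)

Section BlockForm.
Variables (R : realType) (n : nat) (b : 'I_n -> bool).
Notation M := 'M[R]_n.

Definition bsign (i : 'I_n) : R := (-1) ^+ b i.
Notation eps := bsign.

Lemma bsignK i : eps i * eps i = 1.
Proof. by rewrite /bsign -signr_addb addbb. Qed.
Hint Resolve bsignK : core.

Definition rot x y (theta : R) : M := planar eps x y (sin theta) (cos theta - 1).

Lemma bsign_same x y : b x = b y -> eps x * eps y = 1.
Proof. by move=> e; rewrite /bsign e -/(bsign y) bsignK. Qed.

Lemma rotD x y s t : x != y -> b x = b y -> rot x y s *m rot x y t = rot x y (s + t).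
Proof.
move=> xy bxy; rewrite /rot planarM // bsign_same // sinD cosD.
by congr planar; ring.
Qed.

Lemma rot0 x y : rot x y 0 = 1%:M.
Proof. by rewrite /rot /planar sin0 cos0 subrr !scale0r !addr0. Qed.

Lemma OJ_rot x y t : x != y -> b x = b y -> OJ eps (rot x y t).
Proof.
move=> xy bxy; apply: OJ_planar => //; rewrite bsign_same // mul1r.
have := cos2Dsin2 t; rewrite !expr2 => h.
by rewrite (_ : _ + _ + _ = cos t * cos t + sin t * sin t - 1); [rewrite h subrr|ring].
Qed.

Lemma rot_mpow x y t k : x != y -> b x = b y -> mpow (rot x y t) k = rot x y (k%:R * t).
Proof.
move=> xy bxy; elim: k => [|k IH]; first by rewrite mul0r rot0.
by rewrite /= -/(mpow _ k) IH rotD // -{1}[t]mul1r -mulrDl nat1r.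
Qed.

Lemma rot_piE x y i j : x != y -> b x = b y ->
  rot x y pi i j = (-1) ^+ ((i == x) || (i == y)) *+ (i == j).
Proof.
move=> xy bxy; rewrite /rot /planar sinpi cospi scale0r addr0 !mxE.
have [<-|ij] := eqVneq i j.
  have [->|ix] := eqVneq i x; first by rewrite (negPf xy) /= !mulr1n expr1; ring.
  by have [_|iy] := eqVneq i y; rewrite /= ?mulr1n ?mulr0n ?expr1 ?expr0; ring.
have -> : (i == x) && (j == x) = false.
  by apply: contraNF ij => /andP[/eqP-> /eqP->].
have -> : (i == y) && (j == y) = false.
  by apply: contraNF ij => /andP[/eqP-> /eqP->].
by rewrite !mulr0n; ring.
Qed.

Lemma mul_rot_pi x y (A : M) i j : x != y -> b x = b y ->
  (rot x y pi *m A) i j = (-1) ^+ ((i == x) || (i == y)) * A i j.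
Proof.
move=> xy bxy; rewrite mxE (bigD1 i) //= rot_piE // eqxx mulr1n big1 ?addr0 // => k ki.
by rewrite rot_piE // [i == k]eq_sym (negPf ki) mulr0n mul0r.
Qed.

Lemma mulmx_rot_pi x y (A : M) i j : x != y -> b x = b y ->
  (A *m rot x y pi) i j = A i j * (-1) ^+ ((j == x) || (j == y)).
Proof.
move=> xy bxy; rewrite mxE (bigD1 j) //= rot_piE // eqxx mulr1n big1 ?addr0 // => k ki.
by rewrite rot_piE // (negPf ki) mulr0n mulr0.
Qed.

Hypothesis Hblk : forall c (s : seq 'I_n), (size s <= 4)%N -> exists2 y, b y = c & y \notin s.

(** The half-turn in the plane of i and of an index y of its block, y different from j, negates row
    i and fixes column j, which kills an off-diagonal [T i j]. Quarter-turns then compare diagonal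
    entries. *)
Lemma rot_commutant (T : M) :
  (forall x y t, x != y -> b x = b y -> T *m rot x y t = rot x y t *m T) ->
  (forall i j, i != j -> T i j = 0) /\ (forall i j, b i = b j -> T i i = T j j).
Proof.
move=> H.
have off i j : i != j -> T i j = 0.
  move=> ij; have [y by_ ny] := Hblk (b i) (isT : size [:: i; j] <= 4)%N.
  move: ny; rewrite !inE negb_or => /andP[yi yj].
  have := congr1 (fun A : M => A i j) (H i y pi _ (esym by_)).
  rewrite eq_sym => /(_ yi); rewrite mul_rot_pi ?mulmx_rot_pi //; try by rewrite eq_sym.
  rewrite eqxx [j == i]eq_sym (negPf ij) eq_sym (negPf yj) /= expr0 expr1; lra.
split=> // i j bij; have [->//|ij] := eqVneq i j.
have := congr1 (fun A : M => A i j) (H i j (pi / 2) ij bij).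
rewrite [LHS]mxE (bigD1 i) //= big1 => [|k ki]; last by rewrite off ?mul0r // eq_sym.
rewrite [RHS]mxE (bigD1 j) //= [X in _ = _ + X]big1 => [|k kj]; last by rewrite off ?mulr0.
have -> : rot i j (pi / 2) i j = 1.
  rewrite /rot /planar sin_pihalf cos_pihalf !mxE !eqxx (negPf ij) [j == i]eq_sym (negPf ij) /=.
  by rewrite !mulr0n mulr1n; ring.
by rewrite !addr0 mulr1 mul1r.
Qed.

End BlockForm.

(** * The commutant near a dense representation *)

Section Neighborhood.
Variables (R : realType) (n : nat) (b : 'I_n -> bool).
Notation M := 'M[R]_n.
Notation eps := (bsign R b).
Variables (Gamma : groupType) (rho0 : Gamma -> M).
Hypothesis rho0M : forall x y, rho0 (x * y)%g = rho0 x *m rho0 y.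
Hypothesis rho01 : rho0 1%g = 1%:M.
Hypothesis rho0_orth : forall x, (rho0 x)^T *m rho0 x = 1%:M.
Hypothesis Hblk : forall c (s : seq 'I_n), (size s <= 4)%N -> exists2 y, b y = c & y \notin s.
Variable rep : bool -> 'I_n.
Hypothesis Hrep : forall c, b (rep c) = c.

Definition image_of (rho : Gamma -> M) : M -> Prop := fun A => exists x, A = rho x.
Hypothesis Hrot : forall x y t, x != y -> b x = b y -> zc (image_of rho0) (rot b x y t).

Lemma mpow_rho0 x k : mpow (rho0 x) k = rho0 (x ^+ k)%g.
Proof. by elim: k => [|k IH] /=; rewrite ?expg0 ?rho01 // expgS rho0M -IH. Qed.

(** Closeness to 1 does not pass to the Zariski closure, but powers do: each rho0 x has a power of
    exponent at most K close to 1, so [T] commutes with all N-th powers for N = K!. This is a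
    polynomial condition, hence valid on the closure, where every rotation is the N-th power of a
    rotation. *)
Lemma near_one_commutant (r : R) (T : M) : 0 < r ->
  (forall x, nrm (rho0 x - 1%:M) <= r -> T *m rho0 x = rho0 x *m T) ->
  (forall i j, i != j -> T i j = 0) /\ (forall i j, b i = b j -> T i i = T j j).
Proof.
move=> r0 H; have [K HK] := power_near_one n r0.
pose N := K`!.
have comm x : T *m mpow (rho0 x) N = mpow (rho0 x) N *m T.
  have [m [m0 mK mr]] := HK _ (rho0_orth x).
  have mN : N = (m * (N %/ m))%N by rewrite mulnC divnK // dvdn_fact // m0.
  rewrite mN mpowM; apply: mpow_comm; rewrite mpow_rho0; apply: H.
  by rewrite -mpow_rho0.
apply: (@rot_commutant _ _ b Hblk T) => x y t xy bxy.
have N0 : N%:R != 0 :> R by rewrite pnatr_eq0 -lt0n fact_gt0.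
rewrite (_ : rot b x y t = mpow (rot b x y (t / N%:R)) N); last first.
  by rewrite rot_mpow // mulrC divfK.
apply/matrixP => i j; apply/eqP; rewrite -subr_eq0; apply/eqP.
pose F (A : M) := (T *m mpow A N) i j + (-1) * (mpow A N *m T) i j.
have polyF : poly_fun F.
  apply: poly_add; last apply: poly_mul; first 2 last.
  - apply: (@poly_ext _ _ (fun A => \sum_(l <- index_enum 'I_n) mpow A N i l * T l j)).
      by apply: poly_sum => l; apply: poly_mul; [exact: poly_mpow|exact: poly_const].
    by move=> A; rewrite mxE.
  - apply: (@poly_ext _ _ (fun A => \sum_(l <- index_enum 'I_n) T i l * mpow A N l j)).
      by apply: poly_sum => l; apply: poly_mul; [exact: poly_const|exact: poly_mpow].
    by move=> A; rewrite mxE.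
  - exact: poly_const.
have := Hrot (t / N%:R) xy bxy polyF; rewrite /F mulN1r; apply.
by move=> _ [z ->]; rewrite mulN1r comm subrr.
Qed.

(** A linear projection onto the commutant of the two block groups. That it reads only one entry per
    block later lets two entries determine a commuting matrix. *)
Definition blockdiag (T : M) : M := \matrix_(i, j) (T (rep (b i)) (rep (b i)) *+ (i == j)).

Lemma blockdiag_sum I (r : seq I) (c : I -> R) (A : I -> M) :
  blockdiag (\sum_(i <- r) c i *: A i) = \sum_(i <- r) c i *: blockdiag (A i).
Proof.
apply/matrixP => i j; rewrite mxE !summxE -sumrMnl; apply: eq_bigr => k _.
by rewrite !mxE -mulrnAr.
Qed.

(** By duality each entry of [T - blockdiag T] is a fixed finite combination of entries of
    commutators of [T] with rho0 x, x in the small part. If [T] commutes with rho x, such a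
    commutator is that of rho x - rho0 x with [T], small relative to [T]. *)
Lemma commutant_near (r eta : R) : 0 < r -> 0 < eta -> exists (s : seq Gamma) (d : R),
  [/\ 0 < d, forall x, x \in s -> nrm (rho0 x - 1%:M) <= r &
    forall rho : Gamma -> M, (forall x, x \in s -> nrm (rho x - rho0 x) <= d) ->
    forall T, (forall x, x \in s -> T *m rho x = rho x *m T) ->
      nrm (T - blockdiag T) <= eta * nrm T].
Proof.
move=> r0 eta0.
pose G := {x : Gamma | nrm (rho0 x - 1%:M) <= r}.
pose bracket (x : Gamma) (T : M) := T *m rho0 x - rho0 x *m T.
have decomp (T : M) : T = \sum_(kl : 'I_n * 'I_n) T kl.1 kl.2 *: delta_mx kl.1 kl.2.
  by rewrite {1}(matrix_sum_delta T) pair_big.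
have key (ab : 'I_n * 'I_n) : exists c : seq (R * (G * ('I_n * 'I_n))), forall T : M,
    (T - blockdiag T) ab.1 ab.2 =
    \sum_(x <- c) x.1 * bracket (sval x.2.1) T x.2.2.1 x.2.2.2.
  have [phi Hphi|c Hc] := @span_of_annihilator_fin R ('I_n * 'I_n)%type (G * ('I_n * 'I_n))%type
    (fun t kl => bracket (sval t.1) (delta_mx kl.1 kl.2) t.2.1 t.2.2)
    (fun kl => (delta_mx kl.1 kl.2 - blockdiag (delta_mx kl.1 kl.2)) ab.1 ab.2).
    pose T : M := \matrix_(k, l) phi (k, l).
    have TE : T = \sum_(kl : 'I_n * 'I_n) phi kl *: delta_mx kl.1 kl.2.
      by rewrite {1}(decomp T); apply: eq_bigr => -[k l] _; rewrite mxE.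
    have [off dia] : (forall i j, i != j -> T i j = 0) /\ (forall i j, b i = b j -> T i i = T j j).
      apply: (near_one_commutant r0) => x xr; apply/eqP; rewrite -subr_eq0; apply/eqP/matrixP => i j.
      rewrite [RHS]mxE -[RHS](Hphi (exist _ x xr, (i, j))) /= -/(bracket x T).
      rewrite TE /bracket mulmx_suml mulmx_sumr -sumrB summxE; apply: eq_bigr => kl _.
      by rewrite -scalemxAl -scalemxAr -scalerBr mxE mulrC.
    have : (T - blockdiag T) ab.1 ab.2 = 0.
      rewrite !mxE; have [<-|/off] := eqVneq ab.1 ab.2; last by rewrite mxE mulr0n subr0.
      have := dia ab.1 (rep (b ab.1)); rewrite Hrep => /(_ erefl).
      by rewrite !mxE mulr1n => ->; rewrite subrr.
    move=> E0; rewrite -[RHS]E0 [in RHS]TE.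
    rewrite blockdiag_sum -sumrB summxE; apply: eq_bigr => kl _.
    by rewrite -scalerBr [RHS]mxE mulrC.
  exists c => T.
  transitivity (\sum_(kl : 'I_n * 'I_n) T kl.1 kl.2 *
      (delta_mx kl.1 kl.2 - blockdiag (delta_mx kl.1 kl.2)) ab.1 ab.2).
    rewrite [in LHS](decomp T) blockdiag_sum -sumrB summxE; apply: eq_bigr => kl _.
    by rewrite -scalerBr [LHS]mxE.
  under eq_bigr => kl _ do rewrite Hc mulr_sumr.
  rewrite exchange_big /=; apply: eq_bigr => x _.
  transitivity (x.1 * \sum_(kl : 'I_n * 'I_n) T kl.1 kl.2 *
      bracket (sval x.2.1) (delta_mx kl.1 kl.2) x.2.2.1 x.2.2.2).
    by rewrite mulr_sumr; apply: eq_bigr => kl _; rewrite mulrCA.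
  congr (_ * _); rewrite /bracket [in RHS](decomp T) mulmx_suml mulmx_sumr -sumrB summxE.
  by apply: eq_bigr => kl _; rewrite -scalemxAl -scalemxAr -scalerBr [RHS]mxE.
have /choice[c Hc] := key.
pose C := \sum_ab \sum_(x <- c ab) `|x.1|.
have C0 : 0 <= C by apply: sumr_ge0 => ab _; apply: sumr_ge0.
pose s := flatten [seq [seq sval x.2.1 | x <- c ab] | ab <- enum {: 'I_n * 'I_n}].
have C1 : 0 < 2 * n%:R * C + 1 by have := mulr_ge0 (ler0n R n) C0; lra.
(* [C] bounds the sums of coefficients, and each commutator entry is at most 2 n d times [nrm T]. *)
pose d := eta / (2 * n%:R * C + 1).
have d0 : 0 < d by rewrite divr_gt0.
exists s, d; split=> // [x /flattenP[_ /mapP[ab _ ->] /mapP[t _ ->]]|rho Hrho T HT].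
  exact: (svalP t.2.1).
apply: nrm_le => [|i j]; first by rewrite mulr_ge0 ?nrm_ge0 // ltW.
rewrite (Hc (i, j)).
have bound x : x \in s -> forall k l, `|bracket x T k l| <= 2 * n%:R * d * nrm T.
  move=> xs k l; apply: le_trans (nrm_entry _ _ _) _.
  have -> : bracket x T = (rho x - rho0 x) *m T - T *m (rho x - rho0 x).
    by rewrite /bracket mulmxBl mulmxBr HT // opprB [RHS]addrC addrA subrK.
  have h1 := nrmM_le (Hrho x xs) (lexx (nrm T)).
  have h2 := nrmM_le (lexx (nrm T)) (Hrho x xs).
  by apply: le_trans (nrmB _ _) _; apply: le_trans (lerD h1 h2) _; rewrite le_eqVlt; apply/orP; left; apply/eqP; ring.
apply: (@le_trans _ _ (\sum_(x <- c (i, j)) `|x.1| * (2 * n%:R * d * nrm T))).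
  rewrite (le_trans (ler_norm_sum _ _ _)) // big_seq [leRHS]big_seq; apply: ler_sum => x xc.
  rewrite normrM ler_wpM2l // bound //; apply/flattenP.
  exists [seq sval x.2.1 | x <- c (i, j)]; first by apply: map_f; rewrite mem_enum.
  exact: (map_f (fun x : R * (G * ('I_n * 'I_n)) => sval x.2.1) xc).
rewrite -mulr_suml.
have CC : \sum_(x <- c (i, j)) `|x.1| <= C.
  by rewrite /C (bigD1 (i, j)) //= lerDl; apply: sumr_ge0 => ab _; apply: sumr_ge0.
have p : 0 <= 2 * n%:R * d * nrm T.
  apply: mulr_ge0 (nrm_ge0 _); apply: mulr_ge0 (ltW d0); exact: mulr_ge0.
apply: le_trans (ler_wpM2r p CC) _.
rewrite mulrA ler_wpM2r ?nrm_ge0 // /d.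
rewrite (_ : C * _ = eta * (2 * n%:R * C / (2 * n%:R * C + 1))); last by ring.
rewrite -[leRHS]mulr1 ler_wpM2l ?(ltW eta0) // ler_pdivrMr //; lra.
Qed.

End Neighborhood.

(** Two translations: [B] is treated with s in [S] fixed on the left, then [A] with [B] fixed on the
    right. *)
Lemma zc_mul (R : realFieldType) n (S : 'M[R]_n -> Prop) A B :
  (forall s t, S s -> S t -> S (s *m t)) -> zc S A -> zc S B -> zc S (A *m B).
Proof.
move=> SM hA hB F hF VF.
have h s : S s -> F (s *m B) = 0.
  move=> Ss; have := hB _ (poly_subst s 1%:M hF); rewrite mulmx1; apply => t St.
  by rewrite mulmx1; apply: VF; exact: SM.
have := hA _ (poly_subst 1%:M B hF); rewrite mul1mx; apply => s Ss.
by rewrite mul1mx; exact: h.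
Qed.

(** * Unit operators in the span of the adjoint action *)

Section Units.
Variables (R : realType) (n : nat) (b : 'I_n -> bool).
Notation M := 'M[R]_n.
Notation eps := (bsign R b).
Notation E := (Emx eps).
Let Heps : forall i, eps i * eps i = 1 := @bsignK R n b.
Variables (Gamma : groupType) (rho0 : Gamma -> M).
Hypothesis rho0M : forall x y, rho0 (x * y)%g = rho0 x *m rho0 y.
Hypothesis rho01 : rho0 1%g = 1%:M.
Hypothesis rho0_orth : forall x, (rho0 x)^T *m rho0 x = 1%:M.
Hypothesis Hblk : forall c (s : seq 'I_n), (size s <= 4)%N -> exists2 y, b y = c & y \notin s.
Hypothesis Hrot : forall x y t, x != y -> b x = b y -> zc (image_of rho0) (rot b x y t).

Let S0 := image_of rho0.

(** The linear span of Ad k for k in the closure of the image, with [adjJ] as inverse; an algebra,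
    since the closure is stable under products. *)
Inductive spanAd : (M -> M) -> Prop :=
| span_ad k : zc S0 k -> spanAd (fun X => k *m X *m adjJ eps k)
| span_add f g : spanAd f -> spanAd g -> spanAd (fun X => f X + g X)
| span_scale a f : spanAd f -> spanAd (fun X => a *: f X).

Lemma spanAd_ext f g : spanAd f -> (forall X, f X = g X) -> spanAd g.
Proof. by move=> h /funext <-. Qed.

Lemma spanAd_comp f g : spanAd f -> spanAd g -> spanAd (fun X => f (g X)).
Proof.
elim=> [k hk|f1 f2 _ IH1 _ IH2|a f1 _ IH] hg; last 2 first.
- exact: span_add (IH1 hg) (IH2 hg).
- exact: span_scale (IH hg).
elim: hg => [l hl|f1 f2 _ IH1 _ IH2|a f1 _ IH].
- have SM s t : S0 s -> S0 t -> S0 (s *m t).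
    by move=> [x ->] [y ->]; exists (x * y)%g; rewrite rho0M.
  apply: (spanAd_ext (span_ad (zc_mul SM hk hl))) => X.
  by rewrite adjJM // !mulmxA.
- by apply: (spanAd_ext (span_add IH1 IH2)) => X; rewrite mulmxDr mulmxDl.
- by apply: (spanAd_ext (span_scale a IH)) => X; rewrite -scalemxAr -scalemxAl.
Qed.

Definition unit_op (ab cd : 'I_n * 'I_n) := exists2 f, spanAd f &
  forall X, soJ eps X -> f X = X cd.1 cd.2 *: E ab.1 ab.2.

Let sg (xy : 'I_n * 'I_n) i : R := (-1) ^+ ((i == xy.1) || (i == xy.2)).

Let sg2 xy i : sg xy i * sg xy i = 1.
Proof. by rewrite /sg -signr_addb addbb. Qed.

(** The mean of the identity and of plus or minus Ad of a half-turn keeps the entries on which the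
    half-turn acts with the same sign as on (c, d), and kills the others. *)
Lemma proj_op c d (l : seq ('I_n * 'I_n)) :
  (forall xy, xy \in l -> xy.1 != xy.2 /\ b xy.1 = b xy.2) ->
  exists2 f, spanAd f & forall X i j,
    f X i j = X i j * \prod_(xy <- l) (2^-1 * (1 + sg xy c * sg xy d * (sg xy i * sg xy j))).
Proof.
elim: l => [|xy l IH] hl.
  exists (fun X => 1%:M *m X *m adjJ eps 1%:M).
    by apply: span_ad; apply: zc_sub; exists 1%g.
  by move=> X i j; rewrite adjJ1 // mulmx1 mul1mx big_nil mulr1.
have [xy1 xy2] := hl xy (mem_head _ _).
have [|f hf fE] := IH; first by move=> z zl; apply: hl; rewrite inE zl orbT.
have h1 : spanAd (fun X => 1%:M *m X *m adjJ eps 1%:M).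
  by apply: span_ad; apply: zc_sub; exists 1%g.
have h2 := span_ad (Hrot pi xy1 xy2).
have h3 := span_scale 2^-1 (span_add h1 (span_scale (sg xy c * sg xy d) h2)).
exists (fun X => 2^-1 *: (1%:M *m f X *m adjJ eps 1%:M + (sg xy c * sg xy d) *:
    (rot b xy.1 xy.2 pi *m f X *m adjJ eps (rot b xy.1 xy.2 pi)))).
  exact: (spanAd_comp h3 hf).
move=> X i j; rewrite adjJ1 // mulmx1 mul1mx big_cons.
have -> : adjJ eps (rot b xy.1 xy.2 pi) = rot b xy.1 xy.2 pi.
  by rewrite /rot adjJ_planar // sinpi oppr0.
rewrite mxE [X in _ * X]mxE [X in _ * (_ + X)]mxE mulmx_rot_pi // mul_rot_pi // fE.
by rewrite -/(sg xy i) -/(sg xy j); ring.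
Qed.

(** Only (c, d) and (d, c) survive all half-turns: any other off-diagonal entry has an index outside
    {c, d}, and the half-turn pairing this index with a fresh one of its block has opposite signs on
    the two entries. *)
Lemma unit_op_diag c d : c != d -> unit_op (c, d) (c, d).
Proof.
move=> cd.
pose l := [seq xy <- enum {: 'I_n * 'I_n} | (xy.1 != xy.2) && (b xy.1 == b xy.2)].
have hl xy : xy \in l -> xy.1 != xy.2 /\ b xy.1 = b xy.2.
  by rewrite mem_filter => /andP[/andP[h /eqP h'] _].
have [f hf fE] := proj_op c d hl; exists f => // X hX.
have off i j : i != j -> ~~ ((i == c) && (j == d)) -> ~~ ((i == d) && (j == c)) -> f X i j = 0.
  move=> ij n1 n2; rewrite fE.
  suff [xy xyl E0] : exists2 xy, xy \in l & sg xy c * sg xy d * (sg xy i * sg xy j) = -1.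
    by rewrite (big_rem xy xyl) /= E0 subrr mulr0 mul0r mulr0.
  have pick x : x \in [:: i; j; c; d] ->
      exists2 y, (x, y) \in l & [/\ y != i, y != j, y != c & y != d].
    move=> xs; have [y by_ ny] := Hblk (b x) (isT : size [:: i; j; c; d] <= 4)%N.
    have xy : x != y by apply: contraNneq ny => <-.
    move: ny; rewrite !inE !negb_or => /and4P[? ? ? ?].
    by exists y => //; rewrite mem_filter mem_enum /= xy by_ eqxx.
  have [ic|ic] := boolP ((i == c) || (i == d)).
    have jcd : (j != c) && (j != d).
      move: n1 n2 ij; case/orP: ic => /eqP ->; rewrite ?eqxx /=.
        by move=> n1 n2; rewrite eq_sym => ->.
      by move=> n1 n2; rewrite (eq_sym d j) => ->; rewrite andbT.
    have /andP[jc jd] := jcd.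
    have [|y xyl [yi yj yc yd]] := pick j; first by rewrite !inE eqxx orbT.
    exists (j, y) => //; rewrite /sg /= eqxx [c == j]eq_sym [d == j]eq_sym.
    rewrite (negPf jc) (negPf jd) (negPf ij) ![_ == y]eq_sym (negPf yi) (negPf yc) (negPf yd).
    by rewrite /= expr0 expr1 !mul1r.
  move: ic; rewrite negb_or => /andP[ic id_].
  have [|y xyl [yi yj yc yd]] := pick i; first by rewrite !inE eqxx.
  exists (i, y) => //; rewrite /sg /= eqxx [c == i]eq_sym [d == i]eq_sym [j == i]eq_sym.
  rewrite (negPf ic) (negPf id_) (negPf ij) ![_ == y]eq_sym (negPf yj) (negPf yc) (negPf yd).
  by rewrite /= expr0 expr1 !mul1r mulr1.
have one i j : (sg^~ c) =1 (sg^~ i) -> (sg^~ d) =1 (sg^~ j) -> f X i j = X i j.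
  move=> ci dj; rewrite fE big1 ?mulr1 // => xy _.
  rewrite -(ci xy) -(dj xy) mulrACA !sg2 mulr1.
  by rewrite mulVf // pnatr_eq0.
have one' i j : (sg^~ c) =1 (sg^~ j) -> (sg^~ d) =1 (sg^~ i) -> f X i j = X i j.
  move=> ci dj; rewrite fE big1 ?mulr1 // => xy _.
  rewrite -(ci xy) -(dj xy) [sg xy d * _]mulrC mulrACA !sg2 mulr1.
  by rewrite mulVf // pnatr_eq0.
apply/matrixP => i j; rewrite [RHS]mxE EmxE /=.
have [<-|ij] := eqVneq i j.
  rewrite fE (soJ_diag Heps _ hX) mul0r.
  have [->|ic] := eqVneq i c; first by rewrite (negPf cd) /= mulr0 subr0 mulr0.
  by rewrite andbF mulr0 subr0 mulr0.
have [/andP[/eqP-> /eqP->]|n1] := boolP ((i == c) && (j == d)).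
  by rewrite one // (negPf cd) /= mulr0 subr0 mulr1.
have [/andP[/eqP-> /eqP->]|n2] := boolP ((i == d) && (j == c)).
  rewrite one' // mulr1 sub0r; have /(soJE Heps) h := hX.
  by rewrite (h c d); ring.
by rewrite off // mulr0 subrr mulr0.
Qed.

Lemma unit_op_trans ab cd ef : cd.1 != cd.2 -> unit_op ab cd -> unit_op cd ef -> unit_op ab ef.
Proof.
move=> ncd [f hf fE] [g hg gE]; exists (fun X => f (g X)); first exact: spanAd_comp.
move=> X hX; rewrite gE // fE; last first.
  by rewrite -[_ *: _]addr0; apply: soJ_lin => //; [exact: soJ_Emx|apply/soJE => // i j; rewrite !mxE mulr0].
by rewrite mxE EmxE !eqxx (negPf ncd) /= mulr0 subr0 mulr1.
Qed.

Lemma unit_op_swap a c d e : unit_op (a, c) (d, e) -> unit_op (c, a) (e, d).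
Proof.
move=> [f hf fE]; exists (fun X => (eps a * eps c * (eps d * eps e)) *: f X).
  exact: span_scale.
move=> X hX; rewrite fE //=; have /(soJE Heps) h := hX; rewrite (h d e).
apply/matrixP => i j; rewrite !mxE.
set u := (_ && _)%:R; set v := (_ && _)%:R.
have ca : (eps a * eps c) * (eps a * eps c) = 1 by rewrite mulrACA !Heps mulr1.
transitivity (eps d * eps e * X d e * (eps a * eps c * u - (eps a * eps c) * (eps a * eps c) * v)).
  by ring.
by rewrite ca; ring.
Qed.

(** Ad of the quarter-turn in the plane of c and k sends E c d to -E k d, whence the scalar -1. *)
Lemma unit_op_move c d k : c != d -> k != c -> k != d -> b k = b c -> unit_op (k, d) (c, d).
Proof.
move=> cd kc kd bk.
have [f hf fE] := unit_op_diag kd; have [g hg gE] := unit_op_diag cd.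
have ck : c != k by rewrite eq_sym.
pose r := rot b c k (pi / 2 : R).
have hr : spanAd (fun X => r *m X *m adjJ eps r) by apply: span_ad; apply: Hrot.
exists (fun X => -1 *: f (r *m g X *m adjJ eps r)).
  apply: span_scale; apply: spanAd_comp hf _; exact: spanAd_comp hr hg.
move=> X hX; rewrite gE //=.
have soEr : soJ eps (r *m E c d *m adjJ eps r).
  apply/soJP => //; rewrite (adjJM Heps (r *m _)) adjJK // (adjJM Heps r).
  by have /soJP -> // := soJ_Emx Heps c d; rewrite mulNmx mulmxN mulmxA.
rewrite -scalemxAr -scalemxAl fE; last first.
  by rewrite -[_ *: _]addr0; apply: soJ_lin => //; apply/soJE => // i j; rewrite !mxE mulr0.
rewrite mxE /= scalerA; congr (_ *: _).
suff -> : (r *m E c d *m adjJ eps r) k d = -1 by ring.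
have rE i j : r i j = (i == j)%:R + E c k i j - ((i == c) && (j == c))%:R - ((i == k) && (j == k))%:R.
  rewrite /r /rot /planar sin_pihalf cos_pihalf !mxE; case: (i == j); rewrite ?mulr1n ?mulr0n; ring.
have arE i j : adjJ eps r i j = (i == j)%:R - E c k i j - ((i == c) && (j == c))%:R - ((i == k) && (j == k))%:R.
  rewrite /r /rot adjJ_planar // /planar sin_pihalf cos_pihalf !mxE.
  case: (i == j); rewrite ?mulr1n ?mulr0n; ring.
rewrite /Emx mulmxBr mulmxBl -!scalemxAr -scalemxAl mxE [X in _ + X]mxE [X in _ - X]mxE.
have dE i j (A B : M) p q : (A *m delta_mx i j *m B) p q = A p i * B j q.
  rewrite mxE (bigD1 j) //= big1 ?addr0 => [|l lj].
    rewrite mxE (bigD1 i) //= big1 ?addr0 => [|l li]; first by rewrite mxE !eqxx mulr1.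
    by rewrite mxE (negPf li) mulr0.
  by rewrite mxE big1 ?mul0r // => m _; rewrite mxE (negPf lj) andbF mulr0.
rewrite !dE !rE !arE !EmxE !eqxx.
rewrite (negPf kc) (negPf kd) (negPf ck) [d == c]eq_sym (negPf cd) [d == k]eq_sym (negPf kd) /=.
rewrite ?andbF ?andbT /= (bsign_same R (esym bk)).
by ring.
Qed.

Lemma unit_opP a c d e : a != c -> d != e -> b a = b d -> b c = b e -> unit_op (a, c) (d, e).
Proof.
have mv1 x y z : x != y -> z != y -> b z = b x -> unit_op (z, y) (x, y).
  move=> xy zy bz; have [->|zx] := eqVneq z x; first exact: unit_op_diag.
  exact: unit_op_move.
have mv2 x y z : x != y -> x != z -> b z = b y -> unit_op (x, z) (x, y).
  by move=> xy xz bz; apply: unit_op_swap; apply: mv1 => //; rewrite eq_sym.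
move=> ac de bad bce; have [dc|dc] := eqVneq d c; last first.
  by apply: (@unit_op_trans _ (d, c)) => //; [exact: mv1|exact: mv2].
(* For d = c the intermediate pair (d, c) is degenerate; the path from (d, e) goes through (x, e)
   and (x, c) with a fresh x. *)
have [x bx nx] := Hblk (b d) (isT : size [:: a; c; d; e] <= 4)%N.
move: nx; rewrite !inE !negb_or => /and4P[xa xc xd xe].
apply: (@unit_op_trans _ (x, c)) => //.
  by apply: mv1 => //; rewrite bx bad.
apply: (@unit_op_trans _ (x, e)) => //; first exact: mv2.
exact: mv1.
Qed.

Definition Ad_comb (rho : Gamma -> M) (s : seq (R * Gamma)) (X : M) : M :=
  \sum_(x <- s) x.1 *: (rho x.2 *m X *m adjJ eps (rho x.2)).

Lemma Ad_comb_sum rho s I (r : seq I) (X : I -> M) a :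
  Ad_comb rho s (a *: \sum_(i <- r) X i) = a *: \sum_(i <- r) Ad_comb rho s (X i).
Proof.
rewrite /Ad_comb [in RHS]exchange_big [in RHS]scaler_sumr /=; apply: eq_bigr => x _.
rewrite -scalemxAr -scalemxAl scalerA mulrC -scalerA mulmx_sumr mulmx_suml.
by congr (_ *: _); rewrite scaler_sumr.
Qed.

Lemma Ad_combZ rho s a X : Ad_comb rho s (a *: X) = a *: Ad_comb rho s X.
Proof. by have := Ad_comb_sum rho s [:: X] id a; rewrite !big_seq1. Qed.

(** A linear functional evaluated at Ad k is a quadratic polynomial in k. If it vanishes on the
    image it vanishes on the closure, hence at the unit operator, and duality replaces elements of
    the closure by elements of the image. *)
Lemma unit_op_image a c d e : unit_op (a, c) (d, e) -> exists s : seq (R * Gamma),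
  forall X, soJ eps X -> Ad_comb rho0 s X = X d e *: E a c.
Proof.
move=> [f hf fE].
pose I := (('I_n * 'I_n) * ('I_n * 'I_n))%type.
have [phi Hphi|s Hs] := @span_of_annihilator_fin R I Gamma
  (fun x i => (rho0 x *m E i.1.1 i.1.2 *m adjJ eps (rho0 x)) i.2.1 i.2.2)
  (fun i => (E i.1.1 i.1.2 d e *: E a c) i.2.1 i.2.2).
  have Hk k : zc S0 k -> \sum_i (k *m E i.1.1 i.1.2 *m adjJ eps k) i.2.1 i.2.2 * phi i = 0.
    move=> hk.
    pose F (A : M) := \sum_(i <- index_enum I) phi i *
       \sum_(l <- index_enum 'I_n) (A *m E i.1.1 i.1.2) i.2.1 l * (eps l * eps i.2.2 * A i.2.2 l).
    have FE A : F A = \sum_i (A *m E i.1.1 i.1.2 *m adjJ eps A) i.2.1 i.2.2 * phi i.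
      apply: eq_bigr => i _; rewrite mulrC; congr (_ * _); rewrite [RHS]mxE.
      by apply: eq_bigr => l _; rewrite adjJE.
    rewrite -FE; apply: hk => [|_ [x ->]]; last by rewrite FE Hphi.
    apply: poly_sum => i; apply: poly_mul; first exact: poly_const.
    apply: poly_sum => l; apply: poly_mul.
      by apply: (poly_ext (poly_entry 1%:M (E i.1.1 i.1.2) i.2.1 l)) => A; rewrite mul1mx.
    by apply: poly_mul; [exact: poly_const|exact: poly_coord].
  have Hf g : spanAd g -> \sum_i (g (E i.1.1 i.1.2)) i.2.1 i.2.2 * phi i = 0.
    elim=> [k /Hk //|g1 g2 _ IH1 _ IH2|u g1 _ IH].
      under eq_bigr do rewrite mxE mulrDl.
      by rewrite big_split /= IH1 IH2 addr0.
    under eq_bigr do rewrite mxE -mulrA.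
    by rewrite -mulr_sumr IH mulr0.
  apply: etrans (Hf _ hf); apply: eq_bigr => i _; rewrite fE //.
  exact: soJ_Emx.
exists s => X hX.
have base k l : Ad_comb rho0 s (E k l) = E k l d e *: E a c.
  apply/matrixP => i j; rewrite (Hs ((k, l), (i, j))) /= /Ad_comb summxE.
  by apply: eq_bigr => x _; rewrite [LHS]mxE.
have XE : X d e = 2^-1 * \sum_k \sum_l X k l * E k l d e.
  rewrite {1}(soJ_expand Heps hX) mxE summxE; congr (_ * _); apply: eq_bigr => k _.
  by rewrite summxE; apply: eq_bigr => l _; rewrite [LHS]mxE.
rewrite XE {1}(soJ_expand Heps hX) Ad_comb_sum -scalerA; congr (_ *: _).
rewrite scaler_suml; apply: eq_bigr => k _.
rewrite -[\sum_l _ *: _]scale1r Ad_comb_sum scale1r scaler_suml.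
by apply: eq_bigr => l _; rewrite Ad_combZ base scalerA.
Qed.

Lemma units_near (eta : R) : 0 < eta -> exists (s : seq Gamma) (dl : R), 0 < dl /\
  forall rho : Gamma -> M, (forall x, x \in s -> nrm (rho x - rho0 x) <= dl) ->
  forall a c d e, a != c -> d != e -> b a = b d -> b c = b e -> exists cs,
    forall X, soJ eps X -> nrm (Ad_comb rho cs X - X d e *: E a c) <= eta * nrm X.
Proof.
move=> eta0.
pose I := (('I_n * 'I_n) * ('I_n * 'I_n))%type.
have /choice[cs Hcs] : forall i : I, exists s : seq (R * Gamma),
    i.1.1 != i.1.2 -> i.2.1 != i.2.2 -> b i.1.1 = b i.2.1 -> b i.1.2 = b i.2.2 ->
    forall X, soJ eps X -> Ad_comb rho0 s X = X i.2.1 i.2.2 *: E i.1.1 i.1.2.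
  move=> [[a c] [d e]] /=.
  have [/and4P[h1 h2 /eqP h3 /eqP h4]|h] := boolP [&& a != c, d != e, b a == b d & b c == b e].
    by have [s Hs] := unit_op_image (unit_opP h1 h2 h3 h4); exists s.
  by exists [::] => h1 h2 h3 h4; move: h; rewrite h1 h2 h3 h4 !eqxx.
pose C := \sum_i \sum_(x <- cs i) `|x.1|.
have C0 : 0 <= C by apply: sumr_ge0 => i _; apply: sumr_ge0.
(* For [dl <= 1], replacing rho0 x by rho x moves Ad applied to X by at most 3 n^2 [dl] times
   [nrm X]; [C] bounds the sums of coefficients. *)
pose N := 3 * n%:R ^+ 2 * C + 1 : R.
have N0 : 0 < N by rewrite ltr_wpDl // !mulr_ge0 // exprn_ge0.
pose dl := Num.min 1 (eta / N).
have dl0 : 0 < dl by rewrite lt_min ltr01 divr_gt0.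
have dl1 : dl <= 1 by rewrite ge_min lexx.
have dlN : dl * N <= eta by rewrite -ler_pdivlMr // ge_min lexx orbT.
exists (flatten [seq [seq x.2 | x <- cs i] | i <- enum {: I}]), dl; split=> // rho Hrho.
move=> a c d e ac de bad bce; exists (cs ((a, c), (d, e))) => X hX.
have := Hcs ((a, c), (d, e)) ac de bad bce X hX; rewrite /= => <-.
rewrite /Ad_comb -sumrB.
apply: le_trans (nrm_sum _ _ _) _.
apply: (@le_trans _ _ (\sum_(x <- cs ((a, c), (d, e))) `|x.1| * (3 * n%:R ^+ 2 * dl * nrm X))).
  rewrite big_seq [leRHS]big_seq; apply: ler_sum => x xc.
  have hd : nrm (rho x.2 - rho0 x.2) <= dl.
    apply: Hrho; apply/flattenP; exists [seq x.2 | x <- cs ((a, c), (d, e))].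
      by apply: (map_f (fun i => [seq x.2 | x <- cs i])); rewrite mem_enum.
    exact: map_f.
  have h0 := orthogonal_entry (rho0_orth x.2).
  have h2 : nrm (rho x.2) <= 2.
    rewrite -(subrK (rho0 x.2) (rho x.2)); apply: le_trans (nrmD _ _) _.
    by rewrite (_ : 2 = 1 + 1) //; apply: lerD => //; apply: le_trans hd _.
  rewrite -scalerBr; apply: le_trans (nrmZ _ _) _; rewrite ler_wpM2l //.
  rewrite (_ : _ - _ = (rho x.2 - rho0 x.2) *m X *m adjJ eps (rho x.2)
      + rho0 x.2 *m X *m adjJ eps (rho x.2 - rho0 x.2)); last first.
    by rewrite adjJB mulmxBr !mulmxBl addrA subrK.
  have g1 := nrmM_le (nrmM_le hd (lexx (nrm X))) (_ : nrm (adjJ eps (rho x.2)) <= 2).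
  have g2 := nrmM_le (nrmM_le h0 (lexx (nrm X))) (_ : nrm (adjJ eps (rho x.2 - rho0 x.2)) <= dl).
  rewrite !nrm_adjJ // in g1 g2.
  apply: le_trans (nrmD _ _) _; apply: le_trans (lerD (g1 h2) (g2 hd)) _.
  by rewrite le_eqVlt; apply/orP; left; apply/eqP; ring.
rewrite -mulr_suml.
have CC : \sum_(x <- cs ((a, c), (d, e))) `|x.1| <= C.
  by rewrite /C (bigD1 ((a, c), (d, e))) //= lerDl; apply: sumr_ge0 => i _; apply: sumr_ge0.
have p : 0 <= 3 * n%:R ^+ 2 * dl * nrm X.
  by apply: mulr_ge0 (nrm_ge0 _); apply: mulr_ge0 (ltW dl0); rewrite mulr_ge0 // exprn_ge0.
apply: le_trans (ler_wpM2r p CC) _.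
rewrite mulrA ler_wpM2r ?nrm_ge0 //; apply: le_trans dlN; rewrite /N mulrDr mulr1.
rewrite (_ : C * _ = dl * (3 * n%:R ^+ 2 * C)); last by ring.
by rewrite lerDl ltW.
Qed.

End Units.

(** * Block types of the tangent space and the Casimir element *)

Section TangentTypes.
Variables (R : realType) (n : nat) (b : 'I_n -> bool).
Notation M := 'M[R]_n.
Notation eps := (bsign R b).
Notation E := (Emx eps).
Let Heps : forall i, eps i * eps i = 1 := @bsignK R n b.
Variables (S : M -> Prop) (eta : R).
Hypothesis SM : forall s t, S s -> S t -> S (s *m t).
Hypothesis SV : forall s, S s -> S (adjJ eps s).
Hypothesis SO : forall s, S s -> OJ eps s.
Hypothesis eta0 : 0 < eta.
Hypothesis eta_small : eta * (200 * n%:R ^+ 3) <= 1.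
Hypothesis n0 : (0 < n)%N.

(** What is used of a combination of the Ad (rho x). Commuting with left multiplication by the
    commutant lets it act separately on the components of an invariant splitting. *)
Definition Ad_like (f : M -> M) := (forall X, tang S X -> tang S (f X)) /\
  (forall g X, (forall s, S s -> g *m s = s *m g) -> f (g *m X) = g *m f X).

Hypothesis Hunits : forall a c d e, a != c -> d != e -> b a = b d -> b c = b e ->
  exists2 f, Ad_like f & forall X, soJ eps X -> nrm (f X - X d e *: E a c) <= eta * nrm X.

(* A tangent vector with a dominant [(d, e)] entry can be moved to every
   [(a, c)] of the same block type. *)
Definition full p q := forall a c, a != c -> b a = p -> b c = q ->
  exists2 Z, tang S Z & nrm (Z - E a c) <= 4 * eta.

Lemma eta_bounds : [/\ 200 * eta <= 1, 200 * (eta * n%:R) <= 1 & 200 * (eta * n%:R ^+ 2) <= 1].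
Proof.
have n1 : 1 <= n%:R :> R by rewrite ler1n.
have h1 : eta * 1 <= eta * n%:R by rewrite ler_wpM2l // ltW.
have h2 : eta * n%:R * 1 <= eta * n%:R * n%:R by rewrite ler_wpM2l // mulr_ge0 // ltW.
have h3 : eta * n%:R * n%:R * 1 <= eta * n%:R * n%:R * n%:R.
  by rewrite ler_wpM2l // !mulr_ge0 // ltW.
have h4 : eta * (200 * n%:R ^+ 3) = 200 * (eta * n%:R * n%:R * n%:R) by ring.
have h5 : eta * n%:R ^+ 2 = eta * n%:R * n%:R by ring.
by move: eta_small; rewrite h4 h5; split; lra.
Qed.

Lemma tang_soJ X : tang S X -> soJ eps X.
Proof. exact: (tang_quadratic SO). Qed.

Lemma Emx_swap a c : E c a = - (eps a * eps c) *: E a c.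
Proof.
apply/matrixP => i j; rewrite [RHS]mxE !EmxE [eps c * _]mulrC.
set u := _%:R; set v := _%:R.
have ac : (eps a * eps c) * (eps a * eps c) = 1 by rewrite mulrACA !Heps mulr1.
rewrite (_ : _ * (v - _) = eps a * eps c * (eps a * eps c) * u - eps a * eps c * v); last by ring.
by rewrite ac mul1r.
Qed.

Lemma Emx_diag a : E a a = 0.
Proof. by apply/matrixP => i j; rewrite EmxE mxE Heps mul1r subrr. Qed.

Lemma bsign_norm i : `|eps i| = 1.
Proof. by rewrite /bsign normrX normrN1 expr1n. Qed.

Lemma nrm_Emx a c : a != c -> nrm (E a c) <= 1.
Proof.
move=> ac; apply: nrm_le => // i j; rewrite EmxE.
have [/andP[/eqP-> /eqP->]|_] := boolP ((i == a) && _).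
  by rewrite (negPf ac) /= mulr0 subr0 normr1.
rewrite sub0r normrN normrM normrM !bsign_norm !mul1r.
by case: (_ && _); rewrite ?normr1 ?normr0.
Qed.

(** Dividing by the entry turns the error [eta * nrm X] into at most 4 [eta]. The factor 4 leaves
    room for an entry that is large but not the largest. *)
Lemma full_of X d e : tang S X -> X != 0 -> d != e -> nrm X <= 4 * `|X d e| -> full (b d) (b e).
Proof.
move=> hX X0 de le a c ac bd be_.
have [f [fh _] fE] := Hunits ac de bd be_.
have Xp := nrm_gt0 X0; have Xde : X d e != 0 by rewrite -normr_gt0; lra.
exists ((X d e)^-1 *: f X); first by apply: tangZ; exact: fh.
have -> : E a c = (X d e)^-1 *: (X d e *: E a c) by rewrite scalerA mulVf ?scale1r.
rewrite -scalerBr.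
apply: le_trans (nrmZ _ _) _; rewrite normfV ler_pdivrMl ?normr_gt0 //.
apply: le_trans (fE _ (tang_soJ hX)) _.
by rewrite [leRHS]mulrC -mulrA mulrCA ler_wpM2l // ltW.
Qed.

Lemma full_sym p q : full p q -> full q p.
Proof.
move=> H a c ac ba bc; have [|Z hZ Zc] := H c a _ bc ba; first by rewrite eq_sym.
exists (- (eps c * eps a) *: Z); first exact: tangZ.
rewrite (Emx_swap c a) -scalerBr; apply: le_trans (nrmZ _ _) _.
by rewrite normrN normrM !bsign_norm !mul1r.
Qed.

Lemma full_exists X : tang S X -> X != 0 -> exists p q, [/\ full p q &
  exists d e, [/\ d != e, b d = p, b e = q & nrm X = `|X d e|]].
Proof.
move=> hX X0; have [d [e XE]] := nrm_attained X0.
have de : d != e.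
  apply: contra_neq X0 => de; move: XE; rewrite de (soJ_diag Heps _ (tang_soJ hX)).
  by rewrite normr0 => h; apply: nrm_eq0; rewrite h.
exists (b d), (b e); split; last by exists d, e.
by apply: full_of hX X0 de _; rewrite -XE; have := nrm_ge0 X; lra.
Qed.

Hypothesis Hblk : forall c (s : seq 'I_n), (size s <= 4)%N -> exists2 y, b y = c & y \notin s.

(** For a, c in block p and m in the other, the bracket of E a m and E c m is a sign times E a c;
    the approximations perturb it by at most 24 n [eta]. *)
Lemma full_bracket p : full p (~~ p) -> full p p.
Proof.
move=> H; have [e1 e2 _] := eta_bounds.
have [a ba _] := Hblk p (isT : size ([::] : seq 'I_n) <= 4)%N.
have [c bc] := Hblk p (isT : size [:: a] <= 4)%N; rewrite inE => ca.
have [m bm _] := Hblk (~~ p) (isT : size ([::] : seq 'I_n) <= 4)%N.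
have am : a != m by apply/eqP => h; move: ba; rewrite h bm; case: (p).
have cm : c != m by apply/eqP => h; move: bc; rewrite h bm; case: (p).
have [Z1 h1 z1] := H a m am ba bm; have [Z2 h2 z2] := H c m cm bc bm.
have hW := tang_bracket SM h1 h2; set W := _ - _ in hW.
pose W0 := E a m *m E c m - E c m *m E a m.
have near (A A' B B' : M) : nrm (A - A') <= 4 * eta -> nrm (B - B') <= 4 * eta -> nrm A' <= 1 -> nrm B' <= 1 ->
    nrm (A *m B - A' *m B') <= 12 * (eta * n%:R) :> R.
  move=> nA nB nA' nB'.
  have nB2 : nrm B <= 2.
    rewrite -(subrK B' B); apply: le_trans (nrmD _ _) _.
    by apply: le_trans (lerD nB nB') _; lra.
  rewrite (_ : _ - _ = (A - A') *m B + A' *m (B - B')); last by rewrite mulmxBl mulmxBr addrA subrK.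
  apply: le_trans (nrmD _ _) _; apply: le_trans (lerD (nrmM_le nA nB2) (nrmM_le nA' nB)) _.
  by rewrite le_eqVlt; apply/orP; left; apply/eqP; ring.
have dW : nrm (W - W0) <= 24 * (eta * n%:R).
  rewrite (_ : W - W0 = (Z1 *m Z2 - E a m *m E c m) - (Z2 *m Z1 - E c m *m E a m)); last first.
    by rewrite /W /W0 !opprB addrACA [RHS]addrACA [- (Z2 *m Z1) + _]addrC.
  apply: le_trans (nrmB _ _) _.
  apply: le_trans (lerD (near _ _ _ _ z1 z2 (nrm_Emx am) (nrm_Emx cm)) (near _ _ _ _ z2 z1 (nrm_Emx cm) (nrm_Emx am))) _.
  lra.
have W0E : W0 = - (eps a * eps m) *: E a c.
  have sac : eps a = eps c by rewrite /bsign ba bc.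
  rewrite /W0 /Emx !mulmxBl !mulmxBr -!scalemxAl -!scalemxAr !mul_delta_mx_cond !eqxx.
  rewrite [m == c]eq_sym [m == a]eq_sym (negPf cm) (negPf am) (negPf ca) [a == c]eq_sym (negPf ca).
  rewrite !mulr0n !mulr1n sac Heps.
  by apply/matrixP => i j; rewrite !mxE; ring.
have W0ac : `|W0 a c| = 1.
  rewrite W0E mxE normrM normrN normrM !bsign_norm !mul1r EmxE !eqxx [a == c]eq_sym (negPf ca) /=.
  by rewrite mulr0 subr0 normr1.
have nW0 : nrm W0 <= 1.
  rewrite W0E; apply: le_trans (nrmZ _ _) _; rewrite normrN normrM !bsign_norm !mul1r.
  by apply: nrm_Emx; rewrite eq_sym.
have nW : nrm W <= 2.
  rewrite -(subrK W0 W); apply: le_trans (nrmD _ _) _.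
  by apply: le_trans (lerD dW nW0) _; lra.
have Wac : 1 / 2 <= `|W a c|.
  have := le_trans (nrm_entry (W - W0) a c) dW; rewrite [(W - W0) a c]mxE [X in _ + X]mxE.
  have := ler_normB (W a c) (W a c - W0 a c).
  by rewrite subKr W0ac; lra.
have Wn0 : W != 0.
  by apply/eqP => h; move: Wac; rewrite h mxE normr0; lra.
have := @full_of W a c hW Wn0; rewrite eq_sym ca ba bc; apply=> //; lra.
Qed.

(** In the expansion of [X] along the E a c, those with [P a c] are replaced by nearby tangent
    vectors and the others dropped; the error is half a sum of n^2 terms. *)
Lemma tang_approx (P : 'I_n -> 'I_n -> bool) (theta : R) X :
  (forall a c, P a c -> full (b a) (b c)) -> soJ eps X -> 0 <= theta ->
  (forall a c, ~~ P a c -> `|X a c| <= theta * nrm X) ->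
  exists2 X', tang S X' & nrm (X - X') <= 2^-1 * n%:R ^+ 2 * (4 * eta + theta) * nrm X.
Proof.
move=> HP hX th0 Hth.
have /choice[Z HZ] : forall ac : 'I_n * 'I_n, exists Z, tang S Z /\
    nrm (X ac.1 ac.2 *: (E ac.1 ac.2 - Z)) <= (4 * eta + theta) * nrm X.
  move=> [a c] /=; have e4 : 0 <= 4 * eta by have := eta0; lra.
  have x0 := nrm_ge0 X.
  have [->|ac] := eqVneq a c.
    exists 0; split; first exact: tang0.
    by rewrite Emx_diag subrr scaler0 nrm0 mulr_ge0 // addr_ge0.
  have [Pac|nP] := boolP (P a c).
    have [Z hZ Zc] := HP a c Pac a c ac erefl erefl.
    exists Z; split=> //; apply: le_trans (nrmZ _ _) _.
    rewrite mulrC ler_pM ?nrm_ge0 ?nrm_entry // -nrmN opprB.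
    by apply: le_trans Zc _; rewrite lerDl.
  exists 0; split; first exact: tang0.
  rewrite subr0; apply: le_trans (nrmZ _ _) _.
  rewrite -[leRHS]mulr1; apply: ler_pM; rewrite ?nrm_ge0 ?nrm_Emx //.
  by apply: le_trans (Hth _ _ nP) _; rewrite ler_wpM2r // lerDr.
exists (2^-1 *: \sum_(ac : 'I_n * 'I_n) X ac.1 ac.2 *: Z ac).
  by apply: tangZ; apply: tang_sum => ac; apply: tangZ; exact: (HZ ac).1.
rewrite {1}(soJ_expand Heps hX) pair_big /= -scalerBr -sumrB.
apply: le_trans (nrmZ _ _) _; rewrite ger0_norm ?invr_ge0 // -!mulrA ler_wpM2l ?invr_ge0 //.
apply: le_trans (nrm_sum _ _ _) _.
apply: (@le_trans _ _ (\sum_(ac : 'I_n * 'I_n) (4 * eta + theta) * nrm X)).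
  by apply: ler_sum => ac _; rewrite -scalerBr; exact: (HZ ac).2.
by rewrite sumr_const card_prod card_ord -[leLHS]mulr_natl natrM !mulrA.
Qed.

Lemma full_tang : full true true -> full false false -> full true false -> forall X, soJ eps X -> tang S X.
Proof.
move=> htt hff htf; have [e1 e2 e3] := eta_bounds.
apply: tang_contraction => X hX.
have HP a c : true -> full (b a) (b c).
  by move=> _; case: (b a); case: (b c) => //; exact: full_sym.
have [X' hX' le] := tang_approx (P := fun _ _ => true) (theta := 0) HP hX (lexx 0) (fun _ _ => ltac:(by [])).
exists X'; split=> //; first by apply: soJB => //; exact: tang_soJ.
apply: le_trans le _; rewrite ler_wpM2r ?nrm_ge0 //.
have -> : 2^-1 * n%:R ^+ 2 * (4 * eta + 0) = 2 * (eta * n%:R ^+ 2) by field.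
lra.
Qed.

Lemma trace_entry (X : M) i j : \tr (X *m delta_mx i j) = X j i.
Proof.
rewrite /mxtrace (bigD1 j) //= big1 ?addr0 => [|k kj].
  rewrite mxE (bigD1 i) //= big1 ?addr0 => [|k ki]; first by rewrite mxE !eqxx mulr1.
  by rewrite mxE (negPf ki) mulr0.
by rewrite mxE big1 // => l _; rewrite mxE (negPf kj) andbF mulr0.
Qed.

Lemma trace_Emx (X : M) i j : soJ eps X -> \tr (X *m E i j) = 2 * X j i.
Proof.
move=> /(soJE Heps) h; rewrite /Emx mulmxBr -scalemxAr raddfB /= mxtraceZ !trace_entry.
by rewrite (h i j); ring.
Qed.

Lemma trace_bound (X Y : M) : `|\tr (X *m Y)| <= n%:R ^+ 2 * nrm X * nrm Y.
Proof.
rewrite /mxtrace; apply: le_trans (ler_norm_sum _ _ _) _.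
apply: (@le_trans _ _ (\sum_(i < n) nrm (X *m Y))).
  by apply: ler_sum => i _; exact: nrm_entry.
rewrite sumr_const card_ord -[leLHS]mulr_natl expr2 -!mulrA ler_wpM2l // mulrA.
exact: nrmM.
Qed.

(** Quantitative nondegeneracy of the trace form: for (d, e) the position of a largest entry, the
    trace of [X] against E d e has modulus 2 [nrm X], and approximating E d e costs at most 4 n^2
    [eta] [nrm X]. *)
Lemma tang_trace_lower X : tang S X -> X != 0 -> exists d e Z,
  [/\ d != e, full (b d) (b e), tang S Z, nrm (Z - E d e) <= 4 * eta & nrm X <= `|\tr (X *m Z)|].
Proof.
move=> hX X0; have [p [q [fpq [d [e [de bd be_ XE]]]]]] := full_exists hX X0.
have [Z hZ Zc] := fpq d e de bd be_.
exists d, e, Z; split=> //; first by rewrite bd be_.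
have [e1 e2 e3] := eta_bounds; have x0 := nrm_ge0 X.
have t1 : `|\tr (X *m E d e)| = 2 * nrm X.
  rewrite trace_Emx; last exact: tang_soJ.
  have /(soJE Heps) -> := tang_soJ hX.
  by rewrite !normrM normrN normrM !bsign_norm !mul1r -XE ger0_norm.
have t2 := trace_bound X (Z - E d e).
have t3 : n%:R ^+ 2 * nrm X * nrm (Z - E d e) <= n%:R ^+ 2 * nrm X * (4 * eta).
  by rewrite ler_wpM2l // mulr_ge0 // exprn_ge0.
have t4 : 200 * (eta * n%:R ^+ 2) * nrm X <= 1 * nrm X by rewrite ler_wpM2r.
have : \tr (X *m E d e) = \tr (X *m Z) - \tr (X *m (Z - E d e)).
  by rewrite -raddfB /= -mulmxBr opprB addrC subrK.
move=> t5; have := ler_normB (\tr (X *m Z)) (\tr (X *m (Z - E d e))).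
by rewrite -t5 t1; lra.
Qed.

(** Orthogonal projection onto the tangent space for the trace form; nondegeneracy makes the Gram
    matrix [G] of a basis invertible. *)
Lemma tang_projection : exists Pi : M -> M, [/\ forall Y, tang S (Pi Y),
  forall Y Z, tang S Z -> \tr (Pi Y *m Z) = \tr (Y *m Z) &
  forall Y X, tang S X -> (forall Z, tang S Z -> \tr (X *m Z) = \tr (Y *m Z)) -> Pi Y = X].
Proof.
have nondeg X : tang S X -> (forall Z, tang S Z -> \tr (X *m Z) = 0) -> X = 0.
  move=> hX H; apply/eqP; apply: contraT => X0.
  have [d [e [Z [_ _ hZ _]]]] := tang_trace_lower hX X0.
  by rewrite H // normr0 => /nrm_eq0 h; move: X0; rewrite h eqxx.
have P0 : tang S (vec_mx (0 : 'rV[R]_(n * n))) by rewrite linear0; exact: tang0.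
have PL a (u v : 'rV[R]_(n * n)) : tang S (vec_mx u) -> tang S (vec_mx v) ->
    tang S (vec_mx (a *: u + v)).
  by rewrite linearP; exact: tang_lin.
have [B HB] := subspace_matrix P0 PL.
(* [tau] transposes, since the trace of X Y is the dot product of X with the transpose of Y. *)
pose Hb := row_base B; pose tau : 'M[R]_(n * n) := lin_mx trmx.
have hbP (u : 'rV[R]_(\rank B)) : tang S (vec_mx (u *m Hb)).
  by apply/HB; rewrite (submx_trans (submxMl _ _)) // eq_row_base.
have hbE Z : tang S Z -> exists w, mxvec Z = w *m Hb.
  move=> hZ; apply/submxP; rewrite eq_row_base; apply/HB; by rewrite mxvecK.
have HbF : row_free Hb by exact: row_base_free.
clearbody Hb.
have trE (v w : 'rV[R]_(n * n)) : (v *m (w *m tau)^T) 0 0 = \tr (vec_mx v *m vec_mx w).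
  rewrite -{1}(vec_mxK v) -{1}(vec_mxK w) mul_vec_lin /=.
  move: (vec_mx v) (vec_mx w) => X Y.
  rewrite mxE /mxtrace; under [RHS]eq_bigr do rewrite mxE.
  rewrite pair_big /= (reindex _ (curry_mxvec_bij n n)) /=.
  by apply: eq_bigr => -[i j] _; rewrite [_^T _ _]mxE !mxvecE mxE.
pose G := Hb *m (Hb *m tau)^T.
have Gu : G \in unitmx.
  rewrite -row_free_unit -kermx_eq0; apply/eqP/row_matrixP => i; rewrite row0.
  set u := row i _; have uG : u *m G = 0.
    by apply/sub_kermxP; exact: row_sub.
  have : vec_mx (u *m Hb) = 0.
    apply: nondeg => // Z /hbE[w Ew]; rewrite -(mxvecK Z) -trE Ew -(mulmxA w Hb).
    by rewrite [(w *m _)^T]trmx_mul mulmxA -(mulmxA u) -/G uG !mul0mx mxE.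
  move/eqP; rewrite vec_mx_eq0 => /eqP h.
  by apply: (row_free_inj HbF); rewrite h mul0mx.
pose Pi (Y : M) := vec_mx (mxvec Y *m (Hb *m tau)^T *m invmx G *m Hb) : M.
have Pih Y : tang S (Pi Y) by exact: hbP.
have Pit Y Z : tang S Z -> \tr (Pi Y *m Z) = \tr (Y *m Z).
  move=> /hbE[w Ew]; rewrite -(mxvecK Z) /Pi -trE -{2}(mxvecK Y) -trE Ew.
  rewrite -(mulmxA w Hb) [(w *m _)^T]trmx_mul !mulmxA -(mulmxA _ Hb) -/G mulmxKV //.
exists Pi; split=> // Y X hX H.
apply/eqP; rewrite -subr_eq0; apply/eqP; apply: nondeg; first exact: tangB.
by move=> Z hZ; rewrite mulmxBl raddfB /= Pit // H // subrr.
Qed.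

Lemma tang_Ad s X : S s -> tang S X -> tang S (s *m X *m adjJ eps s).
Proof.
move=> Ss; apply: (tang_transport (S := S)) => [|x Sx]; first by apply: OJ_inv => //; exact: SO.
by apply: (SM (SM Ss Sx)); exact: SV.
Qed.

Section Casimir.
Variable Pi : M -> M.
Hypothesis Pi_tang : forall Y, tang S (Pi Y).
Hypothesis Pi_trace : forall Y Z, tang S Z -> \tr (Pi Y *m Z) = \tr (Y *m Z).
Hypothesis Pi_uniq : forall Y X, tang S X ->
  (forall Z, tang S Z -> \tr (X *m Z) = \tr (Y *m Z)) -> Pi Y = X.

Lemma Pi_lin a Y Y' : Pi (a *: Y + Y') = a *: Pi Y + Pi Y'.
Proof.
apply: Pi_uniq => [|Z hZ]; first exact: tang_lin.
by rewrite !mulmxDl -!scalemxAl !raddfD /= !mxtraceZ !Pi_trace.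
Qed.

Lemma PiB Y Y' : Pi (Y - Y') = Pi Y - Pi Y'.
Proof. by rewrite addrC -scaleN1r Pi_lin scaleN1r addrC. Qed.

Lemma Pi0 : Pi 0 = 0.
Proof. by apply: Pi_uniq => [|Z _]; [exact: tang0|rewrite !mul0mx]. Qed.

Lemma Pi_sum I (r : seq I) (c : I -> R) (Y : I -> M) :
  Pi (\sum_(i <- r) c i *: Y i) = \sum_(i <- r) c i *: Pi (Y i).
Proof. by elim/big_rec2: _ => [|i A B _ <-]; rewrite ?Pi0 ?Pi_lin. Qed.

Lemma Pi_Ad s Y : S s -> Pi (s *m Y *m adjJ eps s) = s *m Pi Y *m adjJ eps s.
Proof.
move=> Ss; apply: Pi_uniq => [|Z hZ]; first exact: tang_Ad.
have hs : adjJ eps s *m s = 1%:M by apply/OJP => //; exact: SO.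
have ht : tang S (adjJ eps s *m Z *m s).
  by have := tang_Ad (SV Ss) hZ; rewrite adjJK.
have conj (A : M) : \tr (s *m A *m adjJ eps s *m Z) = \tr (A *m (adjJ eps s *m Z *m s)).
  by rewrite -!mulmxA mxtrace_mulC !mulmxA.
by rewrite !conj Pi_trace.
Qed.

(* [tr (Pi Y *m X) = tr (Y *m X)] for tangent [X] makes this the Casimir element
   of the tangent space for the trace form. *)
Definition casimir : M := \sum_(p : 'I_n * 'I_n) Pi (delta_mx p.1 p.2) *m delta_mx p.2 p.1.

(** Elementary matrices and their transposes are dual bases for the trace form. Conjugation by [s]
    yields another pair of dual bases, and the sum does not depend on the pair. *)
Lemma casimir_comm s : S s -> casimir *m s = s *m casimir.
Proof.
move=> Ss; pose t := adjJ eps s.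
have ts : t *m s = 1%:M by apply/OJP => //; exact: SO.
have st : s *m t = 1%:M by apply: OJ_inv => //; exact: SO.
have PA Y : Pi (s *m Y *m t) = s *m Pi Y *m t by exact: Pi_Ad.
clearbody t.
suff E0 : s *m casimir *m t = casimir by rewrite -{1}E0 -mulmxA ts mulmx1.
rewrite /casimir mulmx_sumr mulmx_suml.
transitivity (\sum_(p : 'I_n * 'I_n) \sum_(q : 'I_n * 'I_n)
    Pi (delta_mx q.1 q.2) *m (s *m ((t p.2 q.2 * s q.1 p.1) *: delta_mx p.2 p.1) *m t)).
  apply: eq_bigr => p _.
  have -> : s *m (Pi (delta_mx p.1 p.2) *m delta_mx p.2 p.1) *m t =
      Pi (s *m delta_mx p.1 p.2 *m t) *m (s *m delta_mx p.2 p.1 *m t).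
    by rewrite PA !mulmxA -(mulmxA _ t s) ts mulmx1.
  have -> : s *m delta_mx p.1 p.2 *m t =
      \sum_(q : 'I_n * 'I_n) (t p.2 q.2 * s q.1 p.1) *: delta_mx q.1 q.2.
    rewrite {1}[_ *m t]matrix_sum_delta pair_big /=; apply: eq_bigr => q _.
    congr (_ *: _); rewrite mxE (bigD1 p.2) //= big1 ?addr0 => [|l lp].
      rewrite mxE (bigD1 p.1) //= big1 ?addr0 => [|l lp]; first by rewrite mxE !eqxx mulr1 mulrC.
      by rewrite mxE (negPf lp) mulr0.
    by rewrite mxE big1 ?mul0r // => m _; rewrite mxE (negPf lp) andbF mulr0.
  rewrite Pi_sum mulmx_suml; apply: eq_bigr => q _.
  by rewrite -scalemxAl -[in RHS]scalemxAr -[in RHS]scalemxAl -[in RHS]scalemxAr.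
rewrite exchange_big /=; apply: eq_bigr => q _.
rewrite -mulmx_sumr -mulmx_suml -mulmx_sumr; congr (_ *m _).
suff -> : \sum_(p : 'I_n * 'I_n) (t p.2 q.2 * s q.1 p.1) *: delta_mx p.2 p.1 = t *m delta_mx q.2 q.1 *m s.
  by rewrite !mulmxA st mul1mx -mulmxA st mulmx1.
rewrite [RHS]matrix_sum_delta pair_big /= (reindex (fun p : 'I_n * 'I_n => (p.2, p.1))) /=; last first.
  by exists (fun p : 'I_n * 'I_n => (p.2, p.1)) => -[].
apply: eq_bigr => -[i j] _ /=; congr (_ *: _).
rewrite [RHS]mxE (bigD1 q.1) //= big1 ?addr0 => [|l lp].
  rewrite mxE (bigD1 q.2) //= big1 ?addr0 => [|l lp]; first by rewrite mxE !eqxx mulr1.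
  by rewrite mxE (negPf lp) mulr0.
by rewrite mxE big1 ?mul0r // => m _; rewrite mxE (negPf lp) andbF mulr0.
Qed.

Lemma Pi_bound Y : nrm (Pi Y) <= 2 * n%:R ^+ 2 * nrm Y.
Proof.
have y0 := nrm_ge0 Y.
have [->|X0] := eqVneq (Pi Y) 0; first by rewrite nrm0 !mulr_ge0 // exprn_ge0.
have [d [e [Z [de _ hZ Zc le]]]] := tang_trace_lower (Pi_tang Y) X0.
have [e1 e2 e3] := eta_bounds.
apply: le_trans le _; rewrite Pi_trace //; apply: le_trans (trace_bound _ _) _.
have nZ : nrm Z <= 2.
  rewrite -(subrK (E d e) Z); apply: le_trans (nrmD _ _) _.
  by apply: le_trans (lerD Zc (nrm_Emx de)) _; lra.
have -> : 2 * n%:R ^+ 2 * nrm Y = n%:R ^+ 2 * nrm Y * 2 by ring.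
by rewrite ler_wpM2l // mulr_ge0 // exprn_ge0.
Qed.

(** If the type is full, a tangent vector near E a c is fixed by the bounded map [Pi]. If not, a
    largest entry of [Pi (E a c)] has some full type (d, e), and its size is bounded by the trace of
    E a c against an approximation of E d e, which is zero at (c, a). *)
Lemma Pi_Emx a c : a != c -> nrm (Pi (E a c) - (`[< full (b a) (b c) >])%:R *: E a c) <= 12 * (eta * n%:R ^+ 2).
Proof.
move=> ac; have [e1 e2 e3] := eta_bounds; have e0 := eta0.
have n1 : 1 <= n%:R ^+ 2 :> R by rewrite exprn_ege1 // ler1n.
have en : eta * 1 <= eta * n%:R ^+ 2 by rewrite ler_wpM2l // ltW.
case: asboolP => [f|nf] /=.
  have [Z hZ Zc] := f a c ac erefl erefl; rewrite scale1r.
  have PZ : Pi Z = Z by apply: Pi_uniq.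
  have -> : Pi (E a c) - E a c = (Z - E a c) - Pi (Z - E a c).
    by rewrite (PiB Z) PZ; move: (Pi (E a c)) (E a c) => u v; rewrite opprB [RHS]addrC addrA subrK.
  apply: le_trans (nrmB _ _) _.
  apply: le_trans (lerD Zc (Pi_bound _)) _.
  have : 2 * n%:R ^+ 2 * nrm (Z - E a c) <= 2 * n%:R ^+ 2 * (4 * eta).
    by rewrite ler_wpM2l // mulr_ge0 // exprn_ge0.
  lra.
rewrite scale0r subr0.
have [->|X0] := eqVneq (Pi (E a c)) 0; first by rewrite nrm0; lra.
have [d [e [Z [de fde hZ Zc le]]]] := tang_trace_lower (Pi_tang _) X0.
apply: le_trans le _; rewrite Pi_trace // mxtrace_mulC trace_Emx; last exact: tang_soJ.
have := nrm_entry (Z - E d e) c a; rewrite [(Z - E d e) c a]mxE [X in _ + X]mxE EmxE.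
have -> : (c == d) && (a == e) = false.
  by apply/negP => /andP[/eqP h1 /eqP h2]; apply: nf; apply: full_sym; rewrite h1 h2.
have -> : (c == e) && (a == d) = false.
  by apply/negP => /andP[/eqP h1 /eqP h2]; apply: nf; rewrite h1 h2.
rewrite mulr0 subrr subr0 normrM ger0_norm //; lra.
Qed.

(** [Pi] sees only the skew part of a matrix, whence the factor 1/2. The at most n errors 12 [eta]
    n^2 add up to 6 / 200. *)
Lemma casimir_diag a : `|casimir a a - 2^-1 * \sum_(j < n | j != a) (`[< full (b a) (b j) >])%:R| <= 6 / 200.
Proof.
have [e1 e2 e3] := eta_bounds.
have PiD i j : Pi (delta_mx i j) = 2^-1 *: Pi (E i j).
  apply: Pi_uniq => [|Z hZ]; first exact: tangZ.
  rewrite -scalemxAl mxtraceZ Pi_trace // mxtrace_mulC trace_Emx; last exact: tang_soJ.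
  by rewrite [in RHS]mxtrace_mulC trace_entry mulrA mulVf ?mul1r // pnatr_eq0.
have -> : casimir a a = 2^-1 * \sum_(j < n | j != a) Pi (E a j) a j.
  rewrite /casimir summxE -(pair_big predT predT (fun i j => (Pi (delta_mx i j) *m delta_mx j i) a a)) /=.
  have dE (A : M) i j : (A *m delta_mx j i) a a = A a j *+ (a == i).
    rewrite mxE (bigD1 j) //= big1 ?addr0 => [|l lj].
      by rewrite mxE eqxx /=; case: (a == i); rewrite ?mulr1 ?mulr0.
    by rewrite mxE (negPf lj) mulr0.
  rewrite (bigD1 a) //= [X in _ + X]big1 ?addr0 => [|i ia]; last first.
    by apply: big1 => j _; rewrite dE eq_sym (negPf ia).
  rewrite mulr_sumr (bigD1 a) //= dE PiD Emx_diag Pi0 scaler0 mxE mul0rn add0r.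
  by apply: eq_bigr => j _; rewrite dE eqxx mulr1n PiD mxE.
rewrite -mulrBr -sumrB normrM ger0_norm ?invr_ge0 //.
have : `|\sum_(j < n | j != a) (Pi (E a j) a j - (`[< full (b a) (b j) >])%:R)| <= n%:R * (12 * (eta * n%:R ^+ 2)).
  apply: le_trans (ler_norm_sum _ _ _) _.
  apply: (@le_trans _ _ (\sum_(j < n | j != a) 12 * (eta * n%:R ^+ 2))).
    apply: ler_sum => j ja; rewrite eq_sym in ja.
    have := le_trans (nrm_entry _ a j) (Pi_Emx ja).
    rewrite [X in `|X|]mxE [X in _ + X]mxE [X in _ - X]mxE EmxE !eqxx (negPf ja) /=.
    by rewrite mulr0 subr0 mulr1.
  rewrite sumr_const -[leLHS]mulr_natl ler_wpM2r //.
    by rewrite mulr_ge0 // mulr_ge0 ?exprn_ge0 // ltW.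
  by rewrite ler_nat (leq_trans (max_card _)) // card_ord.
have : n%:R * (12 * (eta * n%:R ^+ 2)) = 12 / 200 * (eta * (200 * n%:R ^+ 3)) by field.
move: eta_small; lra.
Qed.

Lemma casimir_block c a : b a = c -> ~ full c (~~ c) ->
  `|casimir a a - 2^-1 * (`[< full c c >] * (#|[pred j | b j == c]|.-1))%:R| <= 6 / 200.
Proof.
move=> ba nf; have := casimir_diag a; rewrite ba.
suff -> : \sum_(j < n | j != a) (`[< full c (b j) >])%:R = (`[< full c c >] * (#|[pred j | b j == c]|.-1))%:R :> R by [].
rewrite -natr_sum; congr (_%:R).
rewrite (bigID (fun j => b j == c)) /= [X in (_ + X)%N]big1 => [|j /andP[_ bj]]; last first.
  have -> : b j = ~~ c by move: bj; case: (b j); case: (c).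
  by apply/eqP; rewrite eqb0; apply/asboolP.
rewrite addn0 (eq_bigr (fun=> `[< full c c >] : nat)) => [|j /andP[_ /eqP ->]] //.
rewrite sum_nat_const mulnC; congr (_ * _)%N.
rewrite (cardD1 a [pred j | b j == c]) inE ba eqxx add1n /=.
by apply: eq_card => j; rewrite !inE.
Qed.

End Casimir.

(** The two entries are close to k1 / 2 and k2 / 2, where each integer is the block size minus 1 if
    the diagonal type is full and 0 otherwise. They differ since the sizes are distinct, greater
    than 1, and at least one diagonal type is full; the total error 12 / 200 is less than 1 / 2. *)
Lemma casimir_exists X : tang S X -> X != 0 -> ~ full true false ->
  #|[pred j | b j == true]| != #|[pred j | b j == false]| ->
  forall i j, b i = true -> b j = false ->
  exists2 Phi : M, (forall s, S s -> Phi *m s = s *m Phi) & Phi i i != Phi j j.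
Proof.
move=> hX X0 nf Nneq i j bi bj; have [Pi [P1 P2 P3]] := tang_projection.
exists (casimir Pi); first exact: casimir_comm.
have h1 := casimir_block P1 P2 P3 bi nf.
have nf' : ~ full false (~~ false) by move=> h; apply: nf; exact: full_sym.
have h2 := casimir_block P1 P2 P3 bj nf'.
set k1 := (`[< full true true >] * _)%N in h1; set k2 := (`[< full false false >] * _)%N in h2.
have k12 : k1 != k2.
  have card2 c : (1 < #|[pred j | b j == c]|)%N.
    have [x bx _] := Hblk c (isT : size ([::] : seq 'I_n) <= 4)%N.
    have [y by_] := Hblk c (isT : size [:: x] <= 4)%N; rewrite inE => yx.
    by apply/card_gt1P; exists x, y; rewrite !inE bx by_ eqxx eq_sym.
  have [c1 c2] := (card2 true, card2 false).
  have [p [q [fpq _]]] := full_exists hX X0.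
  have fc : `[< full true true >] || `[< full false false >].
    case: p q fpq => -[] h.
    - by rewrite (asboolT h).
    - by case: nf.
    - by case: nf; exact: full_sym.
    - by rewrite (asboolT h) orbT.
  rewrite /k1 /k2; move: Nneq c1 c2 fc.
  set n1 := #|_|; set n2 := #|_|.
  case: `[< full true true >]; case: `[< full false false >] => //=; rewrite ?mul1n ?mul0n; lia.
apply/eqP => h; rewrite h in h1.
have : `|k1%:R - k2%:R| < 1 :> R.
  have : 2^-1 * `|k1%:R - k2%:R| <= 12 / 200 :> R.
    rewrite -[X in X * _]ger0_norm ?invr_ge0 // -normrM mulrBr.
    have := ler_normB (casimir Pi j j - 2^-1 * k2%:R) (casimir Pi j j - 2^-1 * k1%:R).
    have -> : casimir Pi j j - 2^-1 * k2%:R - (casimir Pi j j - 2^-1 * k1%:R) = 2^-1 * k1%:R - 2^-1 * k2%:R by ring.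
    lra.
  lra.
have -> : k1%:R - k2%:R = (k1%:Z - k2%:Z)%:~R :> R by rewrite rmorphB /=.
rewrite -intr_norm -[1]/(1%:~R) ltr_int; move: k12; clear; lia.
Qed.

End TangentTypes.

(** * Invariant splittings *)

Section Idempotent.
Variables (R : realType) (n : nat) (b : 'I_n -> bool).
Notation M := 'M[R]_n.
Notation eps := (bsign R b).
Let Heps : forall i, eps i * eps i = 1 := @bsignK R n b.
Variable rep : bool -> 'I_n.
Hypothesis Hrep : forall c, b (rep c) = c.
Variables (S : M -> Prop) (eta : R).
Hypothesis SV : forall s, S s -> S (adjJ eps s).
Hypothesis eta0 : 0 < eta.
Hypothesis eta_small : eta * (200 * n%:R) <= 1.

Definition blockproj (c : bool) : M := \matrix_(i, j) ((b i == c) && (i == j))%:R.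

Definition commutes (T : M) := forall s, S s -> T *m s = s *m T.

Hypothesis Hcomm : forall T, commutes T -> nrm (T - blockdiag b rep T) <= eta * nrm T.

Lemma blockprojM c : blockproj c *m blockproj c = blockproj c.
Proof.
apply/matrixP => i j; rewrite mxE (bigD1 i) //= big1 ?addr0 => [|k ki].
  by rewrite !mxE eqxx andbT; case: (b i == c); rewrite /= ?mul1r ?mul0r.
by rewrite !mxE [i == k]eq_sym (negPf ki) andbF mul0r.
Qed.

Lemma nrm_blockproj c : nrm (blockproj c) <= 1.
Proof. by apply: nrm_le => // i j; rewrite mxE; case: (_ && _); rewrite ?normr1 ?normr0. Qed.

(** [blockdiag] vanishes, so [nrm T <= eta * nrm T]. Identities between commuting matrices thus need
    checking at two entries only. *)
Lemma commutes_eq0 T : commutes T -> T (rep true) (rep true) = 0 -> T (rep false) (rep false) = 0 -> T = 0.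
Proof.
move=> cT t0 f0; have n1 : 1 <= n%:R :> R.
  by rewrite ler1n; case: (n) (rep true) => // -[].
have bd0 : blockdiag b rep T = 0.
  by apply/matrixP => i j; rewrite !mxE; case: (b i); rewrite ?t0 ?f0 mul0rn.
have := Hcomm cT; rewrite bd0 subr0 => le.
apply: nrm_eq0; have := nrm_ge0 T.
have e1 : eta * 1 <= eta * n%:R by rewrite ler_wpM2l // ltW.
have e2 : eta <= 1 / 200 by move: eta_small; lra.
have : eta * nrm T <= 1 / 200 * nrm T by rewrite ler_wpM2r // nrm_ge0.
lra.
Qed.

(** The commutant is determined by two entries, so an element of it satisfies a quadratic equation
    and [e] is a spectral projection. It equals its adjoint because the difference commutes and
    vanishes at both entries. *)
Lemma commutes_idempotent (Phi : M) : commutes Phi ->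
  Phi (rep true) (rep true) != Phi (rep false) (rep false) ->
  exists e : M, [/\ e *m e = e, adjJ eps e = e, commutes e &
    nrm (e - blockproj true) <= 200 * (eta * n%:R)].
Proof.
move=> cPhi nPhi.
have n1 : 1 <= n%:R :> R.
  by rewrite ler1n; case: (n) (rep true) => // -[].
have e0 := eta0.
have e1 : eta * 1 <= eta * n%:R by rewrite ler_wpM2l // ltW.
have e2 : 200 * (eta * n%:R) <= 1 by rewrite mulrCA.
have comm_lin a (T T' : M) : commutes T -> commutes T' -> commutes (a *: T + T').
  by move=> h h' s Ss; rewrite mulmxDl mulmxDr -scalemxAl -scalemxAr h // h'.
have comm_scal a : commutes a%:M by move=> s Ss; rewrite scalar_mxC.
have commM (T T' : M) : commutes T -> commutes T' -> commutes (T *m T').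
  by move=> h h' s Ss; rewrite -mulmxA h' // mulmxA h // mulmxA.
have bpt : blockproj true (rep true) (rep true) = 1 by rewrite mxE Hrep !eqxx.
have bpf : blockproj true (rep false) (rep false) = 0 by rewrite mxE Hrep.
set t := rep true in nPhi bpt *; set f := rep false in nPhi bpf *.
have nd : Phi t t - Phi f f != 0 by rewrite subr_eq0.
(* Entries 1 and 0 at the representatives: [Psi] is close to [blockproj true]. *)
pose Psi : M := (Phi t t - Phi f f)^-1 *: (Phi + (- Phi f f)%:M).
have cPsi : commutes Psi.
  have := comm_lin (Phi t t - Phi f f)^-1 (Phi + (- Phi f f)%:M) 0.
  rewrite addr0; apply; last by move=> s _; rewrite mul0mx mulmx0.
  by rewrite -[Phi]scale1r; apply: (comm_lin).
have Pt : Psi t t = 1 by rewrite /Psi !mxE eqxx mulr1n mulVf.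
have Pf : Psi f f = 0 by rewrite /Psi !mxE eqxx mulr1n subrr mulr0.
have bdPsi : blockdiag b rep Psi = blockproj true.
  apply/matrixP => i j; rewrite [LHS]mxE [RHS]mxE.
  by case: (b i) => /=; rewrite -/t -/f ?Pt ?Pf ?mul0rn.
clearbody Psi.
have := Hcomm cPsi; rewrite bdPsi => le1.
have le2 : nrm Psi <= 2.
  have := nrmD (Psi - blockproj true) (blockproj true); rewrite subrK => h.
  have h1 := nrm_blockproj true.
  have : eta * nrm Psi <= 1 / 200 * nrm Psi by rewrite ler_wpM2r ?nrm_ge0 //; lra.
  lra.
have le3 : nrm (Psi - blockproj true) <= 2 * eta.
  by apply: le_trans le1 _; rewrite mulrC ler_wpM2r // ltW.
have le4 : nrm (Psi *m Psi - blockproj true) <= 6 * (eta * n%:R).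
  rewrite (_ : _ - _ = (Psi - blockproj true) *m Psi + blockproj true *m (Psi - blockproj true)); last first.
    by rewrite mulmxBl mulmxBr blockprojM addrA subrK.
  apply: le_trans (nrmD _ _) _.
  apply: le_trans (lerD (nrmM_le le3 le2) (nrmM_le (nrm_blockproj true) le3)) _; lra.
pose q := (Psi *m Psi) f f; pose a := (Psi *m Psi) t t - q.
have qs : `|q| <= 6 * (eta * n%:R).
  have := le_trans (nrm_entry _ f f) le4.
  by rewrite [X in `|X|]mxE [X in _ + X]mxE bpf subr0.
have aqs : `|a + q - 1| <= 6 * (eta * n%:R).
  have := le_trans (nrm_entry _ t t) le4.
  by rewrite [X in `|X|]mxE [X in _ + X]mxE bpt /a subrK.
have quad : Psi *m Psi = a *: Psi + q%:M.
  apply/eqP; rewrite -subr_eq0; apply/eqP; apply: commutes_eq0.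
  - rewrite -scaleN1r addrC; apply: (comm_lin); last exact: commM.
    exact: comm_lin.
  - rewrite -/t [LHS]mxE [X in _ + X]mxE [X in _ - X]mxE [X in _ - (X + _)]mxE Pt.
    by rewrite [X in _ - (_ + X)]mxE eqxx mulr1n /a; ring.
  - rewrite -/f [LHS]mxE [X in _ + X]mxE [X in _ - X]mxE [X in _ - (X + _)]mxE Pf.
    by rewrite [X in _ - (_ + X)]mxE eqxx mulr1n /q; ring.
move: qs aqs; rewrite !ler_norml => /andP[q1 q2] /andP[a1 a2].
have a_lo : 94 / 100 <= a by lra.
have a_hi : a <= 106 / 100 by lra.
have a2_lo : 88 / 100 <= a * a.
  have := ler_pM (_ : 0 <= 94 / 100) (_ : 0 <= 94 / 100) a_lo a_lo; lra.
pose disc := a * a + 4 * q.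
have disc0 : 0 <= disc by rewrite /disc; lra.
pose r := Num.sqrt disc.
have r0 : 0 <= r by exact: sqrtr_ge0.
have rr : r * r = disc by rewrite -expr2 sqr_sqrtr.
have r_lo : 1 / 2 <= r.
  rewrite leNgt; apply/negP => lt.
  have : r * r <= 1 / 2 * (1 / 2) by rewrite ler_pM // ltW.
  rewrite rr /disc; lra.
have disc1 : `|disc - 1| <= 50 * (eta * n%:R).
  have -> : disc - 1 = (a - 1) * (a + 1) + 4 * q by rewrite /disc; ring.
  apply: le_trans (ler_normD _ _) _; rewrite normrM [`|4 * q|]normrM [`|4|]ger0_norm // [`|a + 1|]ger0_norm; last by lra.
  have h1 : `|a - 1| <= 12 * (eta * n%:R) by rewrite ler_norml; apply/andP; split; lra.
  have h2 : `|q| <= 6 * (eta * n%:R) by rewrite ler_norml; apply/andP; split; lra.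
  have h3 : `|a - 1| * (a + 1) <= 12 * (eta * n%:R) * (206 / 100) by apply: ler_pM => //; lra.
  lra.
have r1 : `|r - 1| <= 50 * (eta * n%:R).
  apply: le_trans disc1; rewrite -rr.
  have -> : r * r - 1 = (r - 1) * (r + 1) by ring.
  rewrite normrM [`|r + 1|]ger0_norm; last by lra.
  by rewrite ler_peMr //; lra.
(* [lm] is the smaller root of x^2 = a x + q, near 0; the other root exceeds it by [r], near 1. *)
pose lm := (a - r) / 2.
pose e : M := r^-1 *: (Psi + (- lm)%:M).
have rn0 : r != 0 by apply/eqP => h; move: r_lo; rewrite h; lra.
have ce : commutes e.
  have := comm_lin r^-1 (Psi + (- lm)%:M) 0.
  rewrite addr0; apply; last by move=> s _; rewrite mul0mx mulmx0.
  by rewrite -[Psi]scale1r; apply: (comm_lin).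
have ee : e *m e = e.
  rewrite /e -scalemxAl -scalemxAr mulmxDl !mulmxDr quad.
  rewrite !mul_mx_scalar !mul_scalar_mx.
  have qE : q = lm * lm - lm * a by move: rr; rewrite /disc /lm => h; lra.
  have rE : r = a - 2 * lm by rewrite /lm; field.
  apply/matrixP => i j; rewrite !mxE.
  rewrite -[(- lm) *+ (i == j)]mulr_natr -[q *+ (i == j)]mulr_natr.
  set x := Psi i j; set y := (i == j)%:R.
  rewrite (_ : _ + _ = r * (x - lm * y)); last first.
    by rewrite qE rE; ring.
  by field.
have ae : adjJ eps e = e.
  apply/eqP; rewrite eq_sym -subr_eq0; apply/eqP; apply: commutes_eq0.
  - have cae : commutes (adjJ eps e).
      move=> s Ss; have := congr1 (adjJ eps) (ce _ (SV Ss)).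
      by rewrite (adjJM Heps e) (adjJM Heps _ e) adjJK.
    by rewrite -scaleN1r addrC; apply: (comm_lin).
  - by rewrite [LHS]mxE [X in _ + X]mxE adjJE // Heps mul1r subrr.
  - by rewrite [LHS]mxE [X in _ + X]mxE adjJE // Heps mul1r subrr.
exists e; split=> //.
have -> : e - blockproj true = r^-1 *: ((Psi - blockproj true) + (- lm)%:M + (1 - r) *: blockproj true).
  have e1' : blockproj true = r^-1 *: (r *: blockproj true) by rewrite scalerA mulVf // scale1r.
  rewrite [in LHS]e1' /e -scalerBr; congr (_ *: _).
  by apply/matrixP => i j; rewrite !mxE; ring.
apply: le_trans (nrmZ _ _) _; rewrite ger0_norm ?invr_ge0 // ler_pdivrMl; last by lra.
have hl : `|- lm| <= 31 * (eta * n%:R).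
  rewrite normrN /lm normrM [`|2^-1|]ger0_norm ?invr_ge0 //.
  have -> : a - r = (a - 1) - (r - 1) by ring.
  have := ler_normB (a - 1) (r - 1).
  have h1 : `|a - 1| <= 12 * (eta * n%:R) by rewrite ler_norml; apply/andP; split; lra.
  lra.
have h3 : nrm ((1 - r) *: blockproj true) <= 50 * (eta * n%:R).
  apply: le_trans (nrmZ _ _) _; rewrite distrC -[leRHS]mulr1.
  by apply: ler_pM; rewrite ?nrm_ge0 ?nrm_blockproj.
apply: le_trans (nrmD _ _) _; apply: le_trans (lerD (nrmD _ _) h3) _.
have := nrm_scalar_le n (- lm).
have : 1 / 2 * (200 * (eta * n%:R)) <= r * (200 * (eta * n%:R)).
  by rewrite ler_wpM2r // mulr_ge0 // mulr_ge0 // ltW.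
lra.
Qed.

End Idempotent.

(** * Tangent vectors and an invariant splitting *)

Section Splitting.
Variables (R : realType) (n : nat) (b : 'I_n -> bool).
Notation M := 'M[R]_n.
Notation eps := (bsign R b).
Notation E := (Emx eps).
Let Heps : forall i, eps i * eps i = 1 := @bsignK R n b.
Variables (S : M -> Prop) (eta : R).
Hypothesis SO : forall s, S s -> OJ eps s.
Hypothesis eta0 : 0 < eta.
Hypothesis eta_small : eta * (200 * n%:R ^+ 3) <= 1.
Hypothesis n0 : (0 < n)%N.
Hypothesis Hunits : forall a c d e, a != c -> d != e -> b a = b d -> b c = b e ->
  exists2 f, Ad_like S f & forall X, soJ eps X -> nrm (f X - X d e *: E a c) <= eta * nrm X.
Variables (e : M) (theta : R).
Hypothesis ee : e *m e = e.
Hypothesis ae : adjJ eps e = e.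
Hypothesis ce : commutes S e.
Hypothesis theta_small : theta * (16 * n%:R ^+ 3) <= 1.
Hypothesis e_near : nrm (e - blockproj R b true) <= theta.

Definition ep (c : bool) : M := if c then e else 1%:M - e.

Lemma ep_idem c : ep c *m ep c = ep c.
Proof.
case: c => //=; rewrite mulmxBl mul1mx mulmxBr mulmx1 ee.
by rewrite opprB addrA subrK.
Qed.

Lemma ep_adj c : adjJ eps (ep c) = ep c.
Proof. by case: c => //=; rewrite adjJB adjJ1 // ae. Qed.

Lemma ep_comm c : commutes S (ep c).
Proof. by case: c => //= s Ss; rewrite mulmxBl mulmxBr mul1mx mulmx1 ce. Qed.

Lemma ep_compl c : ep (~~ c) = 1%:M - ep c.
Proof. by case: c => //=; rewrite opprB addrC subrK. Qed.

Lemma ep_near c : nrm (ep c - blockproj R b c) <= theta.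
Proof.
case: c => //=.
have -> : blockproj R b false = 1%:M - blockproj R b true.
  apply/matrixP => i j; rewrite !mxE; case: (b i) => /=; case: (i == j); rewrite ?subrr ?subr0 //.
by rewrite opprB addrC addrA subrK -nrmN opprB.
Qed.

Lemma theta_bounds : [/\ 0 <= theta, 16 * (theta * n%:R) <= 1 & 16 * (theta * n%:R ^+ 3) <= 1].
Proof.
have t0 : 0 <= theta by apply: le_trans (nrm_ge0 _) e_near.
have n1 : n%:R <= n%:R ^+ 3 :> R by rewrite -{1}(expr1 n%:R) ler_weXn2l // ler1n.
have : theta * n%:R <= theta * n%:R ^+ 3 by rewrite ler_wpM2l.
by move: theta_small; rewrite mulrCA => h1 h2; split=> //; lra.
Qed.

Lemma ep_row_small c (X : M) i j : ep c *m X = X -> b i != c -> `|X i j| <= theta * n%:R * nrm X.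
Proof.
move=> eX bi.
have -> : X i j = ((ep c - blockproj R b c) *m X) i j.
  rewrite mulmxBl eX [RHS]mxE [X in _ + X]mxE [X in _ - X]mxE big1 ?subr0 // => k _.
  by rewrite mxE (negPf bi) mul0r.
apply: le_trans (nrm_entry _ _ _) _.
by have := nrmM_le (ep_near c) (lexx (nrm X)); rewrite [n%:R * _]mulrC.
Qed.

Lemma ep_col_small c (X : M) i j : X *m ep c = X -> b j != c -> `|X i j| <= theta * n%:R * nrm X.
Proof.
move=> eX bi.
have -> : X i j = (X *m (ep c - blockproj R b c)) i j.
  rewrite mulmxBr eX [RHS]mxE [X in _ + X]mxE [X in _ - X]mxE big1 ?subr0 // => k _.
  rewrite mxE; have [->|_] := eqVneq k j; last by rewrite andbF mulr0.
  by rewrite (negPf bi) mulr0.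
apply: le_trans (nrm_entry _ _ _) _.
have := nrmM_le (lexx (nrm X)) (ep_near c).
by rewrite (_ : n%:R * nrm X * theta = theta * n%:R * nrm X) //; ring.
Qed.

Lemma tang_ep c X : tang S X -> ep c *m X = X *m ep c.
Proof.
move=> hX; have := @tang_linear_eq R n S (ep c) 1%:M 1%:M (ep c) X.
rewrite mulmx1 mul1mx; apply => // s Ss.
by rewrite mulmx1 mul1mx mulmxBl mulmxBr ep_comm // mulmx1 mul1mx.
Qed.

Lemma soJ_ep c X : soJ eps X -> ep c *m X = X *m ep c -> soJ eps (ep c *m X).
Proof.
move=> /soJP h hc; apply/soJP => //; rewrite (adjJM Heps) ep_adj h // mulNmx.
by rewrite hc.
Qed.

(* If [ep c *m X != 0], applying an approximate unit operator inside block [c]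
   keeps [ep c *m X] large and makes the other component small; the ratio of
   the two is bounded because type [(c, c)] is not full, so iterating gives
   [ep c *m X = 0]. *)
Lemma missing_type c : ~ full b S eta c c -> forall X, tang S X -> ep c *m X = 0.
Proof.
move=> nf; have [t0 t1 t2] := theta_bounds.
have [e1 e2 e3] := eta_bounds eta0 eta_small n0; have ep0 := eta0.
pose kappa := eta + theta * n%:R.
have k0 : 0 <= kappa by apply: addr_ge0; [exact: ltW|exact: mulr_ge0].
have k4 : kappa <= 1 / 4 by rewrite /kappa; lra.
have main X : tang S X -> ep c *m X != 0 -> exists X', [/\ tang S X',
    nrm (ep c *m X) <= 3 * kappa * nrm (ep (~~ c) *m X),
    2^-1 * nrm (ep c *m X) <= nrm (ep c *m X') &
    nrm (ep (~~ c) *m X') <= kappa * nrm (ep (~~ c) *m X)].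
  move=> hX Y0; have sX := tang_soJ SO hX.
  pose Y := ep c *m X; pose W := ep (~~ c) *m X.
  have sY : soJ eps Y by apply: soJ_ep => //; exact: tang_ep.
  have sW : soJ eps W by apply: soJ_ep => //; exact: tang_ep.
  have eY : ep c *m Y = Y by rewrite /Y mulmxA ep_idem.
  have Ye : Y *m ep c = Y by rewrite /Y tang_ep // -mulmxA ep_idem.
  have eW : ep (~~ c) *m W = W by rewrite /W mulmxA ep_idem.
  have y0 := nrm_gt0 Y0; have w0 := nrm_ge0 W.
  have [i [j Yij]] := nrm_attained Y0; rewrite -/Y in Yij y0.
  have small : theta * n%:R * nrm Y < nrm Y.
    rewrite -[ltRHS]mul1r ltr_pM2r //; lra.
  have bi : b i = c.
    by apply/eqP; apply: contraT => /(ep_row_small j eY); rewrite -Yij leNgt small.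
  have bj : b j = c.
    by apply/eqP; apply: contraT => /(ep_col_small i Ye); rewrite -Yij leNgt small.
  have ij : i != j.
    by apply/eqP => ij; move: y0; rewrite Yij ij (soJ_diag Heps _ sY) normr0 ltxx.
  have [f [fh fc] fE] := Hunits ij ij erefl erefl.
  have fY : ep c *m f X = f Y by rewrite -fc //; exact: ep_comm.
  have fW : ep (~~ c) *m f X = f W by rewrite -fc //; exact: ep_comm.
  have Eij : E i j i j = 1 by rewrite EmxE !eqxx (negPf ij) /= mulr0 subr0.
  have nE := @nrm_Emx R n b i j ij.
  have gY := fE _ sY; have gW := fE _ sW.
  have Wij : `|W i j| <= theta * n%:R * nrm W.
    by apply: ep_row_small eW _; rewrite bi; case: (c).
  have fYij : (1 - eta) * nrm Y <= `|f Y i j|.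
    have := le_trans (nrm_entry _ i j) gY.
    rewrite [X in `|X|]mxE [X in _ + X]mxE [X in _ - X]mxE Eij mulr1 => h.
    have := ler_normB (f Y i j) (f Y i j - Y i j); rewrite subKr -Yij; lra.
  have nfY : nrm (f Y) <= (1 + eta) * nrm Y.
    rewrite -(subrK (Y i j *: E i j) (f Y)); apply: le_trans (nrmD _ _) _.
    apply: le_trans (lerD gY (nrmZ _ _)) _; rewrite -Yij.
    have : nrm Y * nrm (E i j) <= nrm Y * 1 by rewrite ler_wpM2l // ltW.
    lra.
  have nfW : nrm (f W) <= kappa * nrm W.
    rewrite -(subrK (W i j *: E i j) (f W)); apply: le_trans (nrmD _ _) _.
    apply: le_trans (lerD gW (nrmZ _ _)) _; rewrite /kappa mulrDl lerD2l.
    by rewrite -[leRHS]mulr1; apply: ler_pM => //; exact: nrm_ge0.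
  have nfYl : (1 - eta) * nrm Y <= nrm (f Y) by apply: le_trans fYij (nrm_entry _ _ _).
  have e5 : eta * nrm Y <= 1 / 200 * nrm Y by apply: ler_wpM2r; [exact: ltW|lra].
  exists (f X); split; first exact: fh.
  - have decomp : f X = f Y + f W.
      by rewrite -fY -fW ep_compl mulmxBl mul1mx addrC subrK.
    have fWij : `|f W i j| <= nrm (f W) by exact: nrm_entry.
    have coord : 4 * `|f X i j| <= nrm (f Y) + nrm (f W).
      have [X0|X0] := eqVneq (f X) 0.
        by rewrite X0 mxE normr0 mulr0 addr_ge0 // nrm_ge0.
      (* Otherwise the tangent vector f X would make (c, c) full. So at (i, j) the large entry of f
         Y is mostly cancelled by f W, which bounds Y by W. *)
      have : ~ (nrm (f X) <= 4 * `|f X i j|).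
        move=> le; apply: nf.
        by have := full_of SO eta0 Hunits (fh _ hX) X0 ij le; rewrite bi bj.
      move=> /negP; rewrite -ltNge => lt; apply: le_trans (ltW lt) _.
      by rewrite decomp; exact: nrmD.
    have : `|f Y i j| <= `|f X i j| + `|f W i j|.
      have -> : f Y i j = f X i j - f W i j by rewrite decomp [X in X - _]mxE addrK.
      exact: ler_normB.
    rewrite -/Y -/W; have := mulr_ge0 k0 w0; lra.
  - rewrite fY -/Y; lra.
  - by rewrite fW -/W.
(* Passing to X' at most halves the first component and shrinks the second by [kappa <= 1 / 4]; each
   round improves the bound by 1/2. *)
have iter k X : tang S X -> nrm (ep c *m X) <= 3 * kappa * nrm (ep (~~ c) *m X) * 2^-1 ^+ k.
  elim: k X => [|k IH] X hX.
    rewrite expr0 mulr1; have [->|Y0] := eqVneq (ep c *m X) 0.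
      by rewrite nrm0 !mulr_ge0 ?nrm_ge0.
    by have [X' []] := main X hX Y0.
  have p0 : 0 <= 2^-1 ^+ k :> R by rewrite exprn_ge0 // invr_ge0.
  have w0 := nrm_ge0 (ep (~~ c) *m X).
  have [->|Y0] := eqVneq (ep c *m X) 0.
    by rewrite nrm0 !mulr_ge0 ?exprn_ge0 ?invr_ge0.
  have [X' [hX' _ l1 l2]] := main X hX Y0.
  have l3 := IH X' hX'.
  have l4 : 3 * kappa * nrm (ep (~~ c) *m X') * 2^-1 ^+ k <= 3 * kappa * (kappa * nrm (ep (~~ c) *m X)) * 2^-1 ^+ k.
    by rewrite ler_wpM2r // ler_wpM2l // mulr_ge0.
  have l5 : 3 * kappa * (kappa * nrm (ep (~~ c) *m X)) * 2^-1 ^+ k <= 1 / 4 * (3 * kappa * nrm (ep (~~ c) *m X) * 2^-1 ^+ k).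
    rewrite (_ : 3 * kappa * (kappa * nrm (ep (~~ c) *m X)) * 2^-1 ^+ k =
      kappa * (3 * kappa * nrm (ep (~~ c) *m X) * 2^-1 ^+ k)); last by ring.
    by rewrite ler_wpM2r // !mulr_ge0.
  rewrite exprS [2^-1 * _]mulrC mulrA.
  move: l1 l3 l4 l5; set u := nrm (ep c *m X); set v := 3 * kappa * _ * _.
  set w := 3 * kappa * _ * _; set z := 3 * kappa * _ * _; lra.
move=> X hX; apply: nrm_eq0.
by apply: (@geometric_le0 _ _ (3 * kappa * nrm (ep (~~ c) *m X))) => k; exact: iter.
Qed.

(** Contraction inside the block: the approximating X' has no component in the other corner, so X -
    X' satisfies the same conditions as X. Entries of X outside the block are at most theta n times
    its norm. *)
Lemma split_tang_block c : full b S eta c c -> (forall X, tang S X -> ep (~~ c) *m X = 0) ->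
  forall X, soJ eps X -> ep c *m X = X -> X *m ep c = X -> tang S X.
Proof.
move=> fc H; have [t0 t1 t2] := theta_bounds.
have [e1 e2 e3] := eta_bounds eta0 eta_small n0; have ep0 := eta0.
suff K : forall X, [/\ soJ eps X, ep c *m X = X & X *m ep c = X] -> tang S X by move=> X h1 h2 h3; apply: K.
apply: tang_contraction => X [sX eX Xe].
have HP a d : (b a == c) && (b d == c) -> full b S eta (b a) (b d) by move=> /andP[/eqP-> /eqP->].
have [||X' hX' le] := @tang_approx R n b S eta eta0 _ (theta * n%:R) X HP sX.
- exact: mulr_ge0.
- move=> a d; rewrite negb_and => /orP[h|h]; first exact: ep_row_small eX h.
  exact: ep_col_small Xe h.
have eX' : ep c *m X' = X'.
  by have := H _ hX'; rewrite ep_compl mulmxBl mul1mx => /eqP; rewrite subr_eq0 => /eqP.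
exists X'; split=> //.
  split; first by apply: soJB => //; exact: tang_soJ SO _ hX'.
    by rewrite mulmxBr eX eX'.
  by rewrite mulmxBl Xe -tang_ep // eX'.
apply: le_trans le _; rewrite ler_wpM2r ?nrm_ge0 // -mulrA -[leRHS]mulr1 ler_wpM2l ?invr_ge0 //.
rewrite mulrDr; have -> : n%:R ^+ 2 * (4 * eta) = 4 * (eta * n%:R ^+ 2) by ring.
have -> : n%:R ^+ 2 * (theta * n%:R) = theta * n%:R ^+ 3 by ring.
lra.
Qed.

(** A matrix commuting with [e] has mixed entries at most 2 theta n times its norm, so the two
    diagonal types suffice for the contraction. *)
Lemma split_tang_both : full b S eta true true -> full b S eta false false ->
  forall X, soJ eps X -> e *m X = X *m e -> tang S X.
Proof.
move=> ft ff; have [t0 t1 t2] := theta_bounds.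
have [e1 e2 e3] := eta_bounds eta0 eta_small n0; have ep0 := eta0.
suff K : forall X, soJ eps X /\ e *m X = X *m e -> tang S X by move=> X h1 h2; apply: K.
apply: tang_contraction => X [sX eX].
have HP a d : b a == b d -> full b S eta (b a) (b d) by move=> /eqP->; case: (b d).
have epX c : ep c *m X = X *m ep c by case: c => //=; rewrite mulmxBl mulmxBr mul1mx mulmx1 eX.
have [||X' hX' le] := @tang_approx R n b S eta eta0 _ (2 * (theta * n%:R)) X HP sX.
- by rewrite !mulr_ge0.
- move=> a d bad.
  have split c : X = ep c *m X + ep (~~ c) *m X by rewrite ep_compl mulmxBl mul1mx addrC subrK.
  rewrite [in X in X <= _](split (b d)) mxE; apply: le_trans (ler_normD _ _) _.
  have h1 : `|(ep (b d) *m X) a d| <= theta * n%:R * nrm X.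
    have -> : (ep (b d) *m X) a d = ((ep (b d) - blockproj R b (b d)) *m X) a d.
      rewrite mulmxBl [RHS]mxE [X in _ + X]mxE [X in _ - X]mxE big1 ?subr0 // => k _.
      by rewrite mxE (negPf bad) mul0r.
    apply: le_trans (nrm_entry _ _ _) _.
    by have := nrmM_le (ep_near (b d)) (lexx (nrm X)); rewrite [n%:R * _]mulrC.
  have h2 : `|(ep (~~ b d) *m X) a d| <= theta * n%:R * nrm X.
    have -> : (ep (~~ b d) *m X) a d = (X *m (ep (~~ b d) - blockproj R b (~~ b d))) a d.
      rewrite epX mulmxBr [RHS]mxE [X in _ + X]mxE [X in _ - X]mxE big1 ?subr0 // => k _.
      rewrite mxE; have [->|_] := eqVneq k d; last by rewrite andbF mulr0.
      by case: (b d); rewrite mulr0.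
    apply: le_trans (nrm_entry _ _ _) _.
    have := nrmM_le (lexx (nrm X)) (ep_near (~~ b d)).
    by rewrite (_ : n%:R * nrm X * theta = theta * n%:R * nrm X) //; ring.
  apply: le_trans (lerD h1 h2) _; rewrite -mulrDl ler_wpM2r ?nrm_ge0 //; lra.
exists X'; split=> //.
  split; first by apply: soJB => //; exact: tang_soJ SO _ hX'.
  by rewrite mulmxBr mulmxBl eX; have := tang_ep true hX'; rewrite /= => ->.
apply: le_trans le _; rewrite ler_wpM2r ?nrm_ge0 // -mulrA -[leRHS]mulr1 ler_wpM2l ?invr_ge0 //.
rewrite mulrDr; have -> : n%:R ^+ 2 * (4 * eta) = 4 * (eta * n%:R ^+ 2) by ring.
have -> : n%:R ^+ 2 * (2 * (theta * n%:R)) = 2 * (theta * n%:R ^+ 3) by ring.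
lra.
Qed.

End Splitting.

(** * Cholesky factorisation near the identity *)

Section Cholesky.
Variable R : realType.

Definition posdef m (B : 'M[R]_m) := forall v : 'cV[R]_m, v != 0 -> 0 < (v^T *m B *m v) 0 0.

Lemma cholesky m (B : 'M[R]_m) : B^T = B -> posdef B ->
  exists2 C : 'M[R]_m, C^T *m C = B & C \in unitmx.
Proof.
elim: m B => [|m IH] B sB pB.
  by exists 0; [apply/matrixP => -[] //|rewrite unitmxE det_mx00 unitr1].
have tr11 (A : 'M[R]_1) : A^T = A by rewrite [A]mx11_scalar tr_scalar_mx.
pose B1 : 'M[R]_(1 + m) := B.
pose a := B1 0 0; pose v : 'cV[R]_m := dlsubmx B1; pose B' := drsubmx B1.
have ulE : ulsubmx B1 = a%:M by rewrite [LHS]mx11_scalar !mxE; congr (_%:M); congr (B1 _ _); apply/val_inj.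
have sB1 : B1^T = B1 := sB.
have urE : ursubmx B1 = v^T by rewrite /v trmx_dlsub sB1.
have sB' : B'^T = B' by rewrite /B' trmx_drsub sB1.
have BE : B1 = block_mx a%:M v^T v B' by rewrite -ulE -urE submxK.
have form (x : R) (w : 'cV[R]_m) : ((col_mx x%:M w)^T *m B1 *m col_mx x%:M w) 0 0 =
    x * a * x + 2 * x * (v^T *m w) 0 0 + (w^T *m B' *m w) 0 0.
  rewrite BE tr_col_mx tr_scalar_mx -mulmxA mul_block_col mul_row_col mulmxDr.
  rewrite !mul_scalar_mx !mul_mx_scalar mulmxDr -scalemxAr -mulmxA.
  have -> : w^T *m v = v^T *m w.
    by rewrite -[LHS]tr11 trmx_mul trmxK.
  by rewrite !mxE eqxx mulr1n; ring.
have a0 : 0 < a.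
  have := pB (col_mx 1%:M 0 : 'cV[R]_(1 + m)); rewrite [X in 0 < X]form.
  rewrite trmx0 !mul0mx mulmx0 mxE mulr0 !addr0 mul1r mulr1; apply.
  apply/eqP => /(congr1 (@usubmx R 1 m 1)); rewrite col_mxKu => /matrixP /(_ 0 0).
  by rewrite !mxE eqxx => /eqP; rewrite oner_eq0.
pose Q := B' - a^-1 *: (v *m v^T).
have sQ : Q^T = Q by rewrite /Q linearB /= linearZ /= trmx_mul trmxK sB'.
have pQ : posdef Q.
  (* The form is minimised in its first coordinate; the minimum is the value at [w] of the form of
     the Schur complement [Q]. *)
  move=> w w0; pose x := - a^-1 * (v^T *m w) 0 0.
  have := pB (col_mx x%:M w : 'cV[R]_(1 + m)); rewrite [X in 0 < X]form.
  have -> : (w^T *m Q *m w) 0 0 = x * a * x + 2 * x * (v^T *m w) 0 0 + (w^T *m B' *m w) 0 0.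
    rewrite /Q mulmxBr mulmxBl -scalemxAr -scalemxAl !mulmxA -(mulmxA _ v^T).
    have -> : w^T *m v = v^T *m w.
      by rewrite -[LHS]tr11 trmx_mul trmxK.
    rewrite {1}[v^T *m w]mx11_scalar mul_scalar_mx /x !mxE.
    set u := \sum_j _; set z := \sum_j _; field.
    by rewrite lt0r_neq0.
  apply; apply: contra w0 => /eqP/(congr1 (@dsubmx R 1 m 1)); rewrite col_mxKd => ->.
  by apply/eqP/matrixP => i j; rewrite !mxE.
have [C' EC' UC'] := IH Q sQ pQ.
pose r := Num.sqrt a; have r0 : 0 < r by rewrite sqrtr_gt0.
have rr : r * r = a by rewrite -expr2 sqr_sqrtr // ltW.
have rn0 := lt0r_neq0 r0.
pose C : 'M[R]_(1 + m) := block_mx r%:M (r^-1 *: v^T) 0 C'.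
exists C; last first.
  by rewrite unitmxE [\det _](det_ublock (r%:M : 'M[R]_1)) det_scalar expr1 unitrM unitfE rn0 -unitmxE.
change (C^T *m C = B1); rewrite BE /C tr_block_mx mulmx_block trmx0 tr_scalar_mx.
rewrite !mul0mx !mulmx0 !addr0 [(r^-1 *: _)^T]linearZ /= trmxK EC'.
congr block_mx.
- by rewrite -scalar_mxM rr.
- by rewrite mul_scalar_mx scalerA mulfV // scale1r.
- by rewrite mul_mx_scalar scalerA mulfV // scale1r.
- rewrite -scalemxAl -scalemxAr scalerA -invfM rr /Q addrC subrK //.
Qed.

(** By 2 |x y| <= x^2 + y^2, the form differs from the sum of squares by at most m times the norm of
    [B - 1%:M] times that sum. *)
Lemma near_one_posdef m (B : 'M[R]_m) : m%:R * nrm (B - 1%:M) < 1 -> posdef B.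
Proof.
move=> H v v0; set d := nrm _ in H.
have E : (v^T *m B *m v) 0 0 = \sum_i v i 0 ^+ 2 + \sum_i \sum_j v i 0 * (B - 1%:M) i j * v j 0.
  rewrite -{1}(subrK 1%:M B) mulmxDr mulmx1 mulmxDl [LHS]mxE addrC; congr (_ + _).
    by rewrite mxE; apply: eq_bigr => i _; rewrite mxE expr2.
  rewrite mxE exchange_big; apply: eq_bigr => j _ /=; rewrite mxE mulr_suml.
  by apply: eq_bigr => i _; rewrite mxE.
pose N := \sum_i v i 0 ^+ 2.
have N0 : 0 < N.
  rewrite lt_def sumr_ge0 ?andbT => [|i _]; last exact: sqr_ge0.
  apply: contra v0 => /eqP h; apply/eqP/matrixP => i j; rewrite ord1 mxE; apply/eqP.
  rewrite -sqrf_eq0; move/eqP: h; rewrite psumr_eq0 => [/allP h|k _]; last exact: sqr_ge0.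
  by apply: h; rewrite mem_index_enum.
have le : `|\sum_i \sum_j v i 0 * (B - 1%:M) i j * v j 0| <= m%:R * d * N.
  apply: (@le_trans _ _ (\sum_(i < m) \sum_(j < m) d * (2^-1 * (v i 0 ^+ 2 + v j 0 ^+ 2)))).
    apply: le_trans (ler_norm_sum _ _ _) _; apply: ler_sum => i _.
    apply: le_trans (ler_norm_sum _ _ _) _; apply: ler_sum => j _.
    rewrite mulrAC normrM mulrC; apply: ler_pM => //; first exact: nrm_entry.
    rewrite ler_norml; apply/andP; split.
      by have := sqr_ge0 (v i 0 + v j 0); rewrite sqrrD -mulr_natl; lra.
    by have := sqr_ge0 (v i 0 - v j 0); rewrite sqrrB -mulr_natl; lra.
  rewrite le_eqVlt; apply/orP; left; apply/eqP.
  have Ei i : \sum_(j < m) d * (2^-1 * (v i 0 ^+ 2 + v j 0 ^+ 2)) = d * 2^-1 * (m%:R * v i 0 ^+ 2 + N).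
    rewrite -mulr_sumr -mulr_sumr mulrA; congr (_ * _); rewrite big_split /= sumr_const card_ord.
    by rewrite mulr_natl.
  rewrite (eq_bigr _ (fun i _ => Ei i)) -mulr_sumr big_split /= sumr_const card_ord -mulr_sumr -/N.
  by rewrite -[N *+ m]mulr_natl; field.
rewrite E -/N; move: le; rewrite ler_norml => /andP[le _].
have : m%:R * d * N < 1 * N by rewrite ltr_pM2r.
lra.
Qed.

End Cholesky.

Definition second_block p q (i : 'I_(p + q)) : bool := (p <= i)%N.

(** * A basis adapted to the idempotent *)

Section AdaptedBasis.
Variables (R : realType) (p q : nat).
Notation n := (p + q)%N.
Notation b := (@second_block p q).
Notation M := 'M[R]_n.
Notation eps := (bsign R b).
Notation J := (Jmx eps).
Notation P0 := (blockproj R b).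
Let Heps : forall i, eps i * eps i = 1 := @bsignK R n b.

Lemma second_block_l (i : 'I_p) : b (lshift q i) = false.
Proof. by rewrite /second_block /= leqNgt ltn_ord. Qed.

Lemma second_block_r (i : 'I_q) : b (rshift p i) = true.
Proof. by rewrite /second_block /= leq_addr. Qed.

Lemma block_diag (A : M) : (forall i j, b i != b j -> A i j = 0) ->
  A = block_mx (ulsubmx A) 0 0 (drsubmx A).
Proof.
move=> H; rewrite -{1}(submxK A); congr block_mx; apply/matrixP => i j; rewrite !mxE.
  by apply: H; rewrite second_block_l second_block_r.
by apply: H; rewrite second_block_l second_block_r.
Qed.

Lemma blockproj_true : P0 true = block_mx 0 0 0 1%:M.
Proof.
rewrite [LHS]block_diag => [|i j bij]; last first.
  by rewrite mxE; have [ij|_] := eqVneq i j; [rewrite ij eqxx in bij|rewrite andbF].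
congr block_mx; apply/matrixP => i j; rewrite !mxE ?second_block_l ?second_block_r //=.
by rewrite (inj_eq (@rshift_inj p q)).
Qed.

Lemma blockproj_compl c : P0 (~~ c) = 1%:M - P0 c.
Proof.
by apply/matrixP => i j; rewrite !mxE; case: (b i); case: c; case: (i == j); rewrite ?subrr ?subr0.
Qed.

Lemma blockproj_mul c (A : M) i j : (P0 c *m A) i j = (b i == c)%:R * A i j.
Proof.
rewrite mxE (bigD1 i) //= big1 ?addr0 => [|k ki]; first by rewrite mxE eqxx andbT.
by rewrite mxE [i == k]eq_sym (negPf ki) andbF mul0r.
Qed.

Lemma mul_blockproj c (A : M) i j : (A *m P0 c) i j = (b j == c)%:R * A i j.
Proof.
rewrite mxE (bigD1 j) //= big1 ?addr0 => [|k ki].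
  by rewrite mxE eqxx andbT mulrC.
by rewrite mxE (negPf ki) andbF mulr0.
Qed.

Lemma adjJ_blockproj c : adjJ eps (P0 c) = P0 c.
Proof.
apply/matrixP => i j; rewrite adjJE // !mxE [j == i]eq_sym.
by have [->|_] := eqVneq i j; rewrite ?andbF ?mulr0 // Heps mul1r.
Qed.

Lemma Jmx_block : J = block_mx 1%:M 0 0 (- 1%:M).
Proof.
rewrite [LHS]block_diag => [|i j bij]; last first.
  by rewrite JmxE; have [ij|_] := eqVneq i j; [rewrite ij eqxx in bij|rewrite mulr0n].
congr block_mx; apply/matrixP => i j; rewrite [LHS]mxE [LHS]mxE JmxE /bsign !mxE.
  by rewrite second_block_l expr0 (inj_eq (@lshift_inj p q)).
by rewrite second_block_r expr1 (inj_eq (@rshift_inj p q)); case: (i == j); rewrite ?mulr1n ?mulr0n ?oppr0.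
Qed.

Lemma det_OJ (A : M) : OJ eps A -> \det A ^+ 2 = 1.
Proof.
move=> /(congr1 determinant); rewrite !det_mulmx det_tr => h.
have J0 : \det J != 0.
  by rewrite -unitfE -unitmxE; have [] := mulmx1_unit (JJ Heps).
by apply: (mulfI J0); rewrite mulr1 expr2 mulrA [\det J * _]mulrC; exact: h.
Qed.

Variables (e : M) (theta : R).
Hypothesis ee : e *m e = e.
Hypothesis ae : adjJ eps e = e.
Hypothesis theta_small : theta * (16 * n%:R ^+ 3) <= 1.
Hypothesis e_near : nrm (e - P0 true) <= theta.

(** [g1] intertwines the standard splitting with that of [e] but is only nearly J-orthogonal. Its
    defect [Q], adjoint of g1 times g1, is symmetric, block diagonal and close to 1; Cholesky in
    each block gives C with J Q = C^T J C, and g1 C^-1 is J-orthogonal. *)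
Lemma adapted_basis : (0 < p)%N -> exists g : M, [/\ OJ eps g, \det g = 1 & e *m g = g *m P0 true].
Proof.
move=> p0; have n0 : (0 < n)%N by rewrite addn_gt0 p0.
have n1 : 1 <= n%:R :> R by rewrite ler1n.
have [t0 t1 t2] := theta_bounds n0 theta_small e_near.
pose e1 := ep e true; pose e2 := ep e false; pose p1 := P0 true; pose p2 := P0 false.
have p2E : p2 = 1%:M - p1 by exact: (blockproj_compl true).
have p11 : p1 *m p1 = p1 by exact: blockprojM.
have p22 : p2 *m p2 = p2 by exact: blockprojM.
have p12 : p1 *m p2 = 0 by rewrite p2E mulmxBr mulmx1 p11 subrr.
have p21 : p2 *m p1 = 0 by rewrite p2E mulmxBl mul1mx p11 subrr.
pose g1 : M := e1 *m p1 + e2 *m p2.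
have e12 : e1 *m e2 = 0 by rewrite /e1 /e2 /= mulmxBr mulmx1 ee subrr.
have e21 : e2 *m e1 = 0 by rewrite /e1 /e2 /= mulmxBl mul1mx ee subrr.
have e11 : e1 *m e1 = e1 by exact: ep_idem.
have e22 : e2 *m e2 = e2 by exact: ep_idem.
have eg1 : e *m g1 = g1 *m p1.
  rewrite -[e]/e1 /g1 mulmxDr mulmxDl !mulmxA e11 e12 mul0mx addr0.
  by rewrite -(mulmxA e1) -(mulmxA e2) p11 p21 mulmx0 addr0.
pose Q : M := p1 *m e1 *m p1 + p2 *m e2 *m p2.
have adjg : adjJ eps g1 = p1 *m e1 + p2 *m e2.
  by rewrite /g1 adjJD !(adjJM Heps) !adjJ_blockproj !ep_adj.
have gQ : adjJ eps g1 *m g1 = Q.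
  have abs (a1 a2 x1 x2 : M) : a1 *m a1 = a1 -> a2 *m a2 = a2 -> a1 *m a2 = 0 -> a2 *m a1 = 0 ->
      (x1 *m a1 + x2 *m a2) *m (a1 *m x1 + a2 *m x2) = x1 *m a1 *m x1 + x2 *m a2 *m x2.
    move=> h1 h2 h3 h4; rewrite mulmxDl !mulmxDr !mulmxA.
    rewrite -(mulmxA x1 a1 a1) -(mulmxA x1 a1 a2) -(mulmxA x2 a2 a1) -(mulmxA x2 a2 a2).
    by rewrite h1 h2 h3 h4 !mulmx0 !mul0mx addr0 add0r.
  by rewrite adjg; exact: abs.
have Qb i j : b i != b j -> Q i j = 0.
  move=> bij; rewrite /Q mxE !mul_blockproj !blockproj_mul.
  by move: bij; case: (b i); case: (b j) => //= _; rewrite ?mul0r ?mulr0 ?mul0r addr0.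
have nearQ : nrm (Q - 1%:M) <= 2 * (theta * n%:R ^+ 2).
  have -> : Q - 1%:M = p1 *m (e1 - p1) *m p1 + p2 *m (e2 - p2) *m p2.
    have abs (a1 a2 x1 x2 : M) : x1 *m x1 = x1 -> x2 *m x2 = x2 ->
        x1 *m (a1 - x1) *m x1 + x2 *m (a2 - x2) *m x2 = x1 *m a1 *m x1 + x2 *m a2 *m x2 - (x1 + x2).
      by move=> h1 h2; rewrite !mulmxBr !mulmxBl !h1 !h2 addrACA -opprD.
    by rewrite abs // -/Q p2E subrKC.
  have h c : nrm (P0 c *m (ep e c - P0 c) *m P0 c) <= theta * n%:R ^+ 2.
    have h1 := nrmM_le (nrmM_le (nrm_blockproj R b c) (ep_near e_near c)) (nrm_blockproj R b c).
    by apply: le_trans h1 _; rewrite le_eqVlt; apply/orP; left; apply/eqP; ring.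
  by apply: le_trans (nrmD _ _) _; apply: le_trans (lerD (h true) (h false)) _; lra.
have QT : Q^T = Q.
  have aQ : adjJ eps Q = Q by rewrite -gQ (adjJM Heps) adjJK.
  apply/matrixP => i j; rewrite mxE.
  have := congr1 (fun A : M => A i j) aQ; rewrite adjJE //.
  have [bij <-|bij _] := eqVneq (b i) (b j); last by rewrite !Qb // eq_sym.
  by rewrite /bsign bij -signr_addb addbb expr0 mul1r.
have smallQ m (A : 'M[R]_m) : (m <= n)%N -> nrm (A - 1%:M) <= 2 * (theta * n%:R ^+ 2) ->
    m%:R * nrm (A - 1%:M) < 1.
  move=> mn hA; have mn' : m%:R <= n%:R :> R by rewrite ler_nat.
  apply: le_lt_trans (ler_pM _ (nrm_ge0 _) mn' hA) _ => //.
  rewrite (_ : n%:R * _ = 2 * (theta * n%:R ^+ 3)); last by ring.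
  lra.
have [C1 EC1 UC1] : exists2 C : 'M[R]_p, C^T *m C = ulsubmx Q & C \in unitmx.
  apply: cholesky; first by rewrite trmx_ulsub QT.
  apply: near_one_posdef; apply: smallQ; first exact: leq_addr.
  apply: le_trans nearQ; apply: nrm_le => [|i j]; first exact: nrm_ge0.
  apply: le_trans (nrm_entry _ (lshift q i) (lshift q j)).
  by rewrite !mxE (inj_eq (@lshift_inj p q)).
have [C2 EC2 UC2] : exists2 C : 'M[R]_q, C^T *m C = drsubmx Q & C \in unitmx.
  apply: cholesky; first by rewrite trmx_drsub QT.
  apply: near_one_posdef; apply: smallQ; first exact: leq_addl.
  apply: le_trans nearQ; apply: nrm_le => [|i j]; first exact: nrm_ge0.
  apply: le_trans (nrm_entry _ (rshift p i) (rshift p j)).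
  by rewrite !mxE (inj_eq (@rshift_inj p q)).
pose C : M := block_mx C1 0 0 C2.
have UC : C \in unitmx by rewrite unitmxE det_ublock unitrM -!unitmxE UC1.
have Cp : C *m p1 = p1 *m C.
  by rewrite /C /p1 blockproj_true !mulmx_block !mul0mx !mulmx0 !mulmx1 !mul1mx !addr0.
have JQ : J *m Q = C^T *m J *m C.
  rewrite (block_diag Qb) Jmx_block /C tr_block_mx !mulmx_block !trmx0.
  rewrite !mul0mx !mulmx0 !mulmx1 !mul1mx !addr0 !add0r !mul0mx.
  by rewrite -EC1 -EC2 mulmxN mulmx1 mulNmx mul1mx mulNmx.
pose g : M := g1 *m invmx C.
have gJ : OJ eps g.
  have E : g1^T *m J *m g1 = J *m Q by rewrite -gQ /adjJ !mulmxA (JJ Heps) mul1mx.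
  rewrite /OJ /g trmx_mul -!mulmxA (mulmxA J g1) (mulmxA g1^T) (mulmxA g1^T) E JQ.
  rewrite -(mulmxA _ C) mulmxV // mulmx1 mulmxA -trmx_mul mulmxV // trmx1 mul1mx //.
have eg : e *m g = g *m p1.
  rewrite /g mulmxA eg1 -!mulmxA; congr (_ *m _).
  by rewrite -[LHS](mulKmx UC) (mulmxA C) Cp mulmxK.
have dg := det_OJ gJ.
move/eqP: dg; rewrite sqrf_eq1 => /orP[/eqP dg|/eqP dg]; first by exists g.
(* A reflection in the first coordinate corrects the determinant and commutes with [P0 true]. *)
pose i0 := lshift q (Ordinal p0); pose D := sgn_mx R [set i0].
have DJ : OJ eps D.
  apply/matrixP => i j; rewrite /OJ (_ : D^T = D); last first.
    by apply/matrixP => k l; rewrite mxE !sgn_mxE eq_sym; case: eqP => [->|].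
  rewrite -mulmxA mul_sgn_mx mulJmx sgn_mxE JmxE.
  case: (i == j); rewrite ?mulr0n ?mulr0 // !mulr1n mulrCA -signr_addb addbb.
  by rewrite mulr1.
exists (g *m D); split.
- exact: OJM.
- by rewrite det_mulmx dg det_sgn_mx cards1 expr1; ring.
- rewrite mulmxA eg -(mulmxA g p1) -(mulmxA g D); congr (_ *m _).
  apply/matrixP => i j; rewrite [LHS]blockproj_mul [RHS]mul_sgn_mx sgn_mxE mxE.
  by case: (i == j); rewrite ?andbT ?andbF ?mulr0n ?mulr0 // mulr1n mulrC.
Qed.

End AdaptedBasis.

(** * The dichotomy *)

Section Dichotomy.
Variables (R : realType) (p q : nat).
Notation n := (p + q)%N.
Notation b := (@second_block p q).
Notation M := 'M[R]_n.
Notation eps := (bsign R b).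
Notation E := (Emx eps).
Notation P0 := (blockproj R b).
Let Heps : forall i, eps i * eps i = 1 := @bsignK R n b.
Variables (S T0 : M -> Prop) (eta r : R).
Hypothesis S1 : S 1%:M.
Hypothesis SM : forall s t, S s -> S t -> S (s *m t).
Hypothesis SV : forall s, S s -> S (adjJ eps s).
Hypothesis SO : forall s, S s -> OJ eps s.
Hypothesis Sdet : forall s, S s -> \det s = 1.
Hypothesis eta0 : 0 < eta.
Hypothesis eta_small : eta * (3200 * n%:R ^+ 4) <= 1.
Hypothesis r_small : r * (32 * n%:R ^+ 4) <= 1.
Hypothesis Hunits : forall a c d e, a != c -> d != e -> b a = b d -> b c = b e ->
  exists2 f, Ad_like S f & forall X, soJ eps X -> nrm (f X - X d e *: E a c) <= eta * nrm X.
Hypothesis Hblk : forall c (s : seq 'I_n), (size s <= 4)%N -> exists2 y, b y = c & y \notin s.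
Hypothesis Hpq : #|[pred j | b j == true]| != #|[pred j | b j == false]|.
Variable rep : bool -> 'I_n.
Hypothesis Hrep : forall c, b (rep c) = c.
Hypothesis TS : forall x, T0 x -> S x.
Hypothesis T_near : forall x, T0 x -> nrm (x - 1%:M) <= r.
Hypothesis T_comm : forall T, (forall x, T0 x -> T *m x = x *m T) ->
  nrm (T - blockdiag b rep T) <= eta * nrm T.
Hypothesis Hdet : forall e : M, e *m e = e -> adjJ eps e = e -> commutes S e ->
  nrm (e - P0 true) <= 200 * (eta * n%:R) -> forall s, S s -> \det (1%:M - e + e *m s) = 1.

Let n0 : (0 < n)%N.
Proof.
have [y _ _] := Hblk true (isT : (size ([::] : seq 'I_n) <= 4)%N).
exact: leq_ltn_trans (leq0n y) (ltn_ord y).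
Qed.

Let n1 : 1 <= n%:R :> R. Proof. by rewrite ler1n. Qed.

Let eta_small3 : eta * (200 * n%:R ^+ 3) <= 1.
Proof.
apply: le_trans eta_small; rewrite ler_wpM2l ?(ltW eta0) //.
by apply: ler_pM; rewrite ?exprn_ge0 ?ler_nat ?ler_weXn2l.
Qed.

Let theta_small : 200 * (eta * n%:R) * (16 * n%:R ^+ 3) <= 1.
Proof. by apply: le_trans eta_small; rewrite le_eqVlt; apply/orP; left; apply/eqP; ring. Qed.

(** For an idempotent [f] commuting with [s]: [s] on the image of [f], the identity on its
    kernel. *)
Definition corner (f s : M) : M := 1%:M - f + f *m s.
Definition corner_group (f : M) : M -> Prop := fun a => exists2 s, S s & a = corner f s.

Section Corner.
Variable f : M.
Hypothesis ff : f *m f = f.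
Hypothesis af : adjJ eps f = f.
Hypothesis cf : commutes S f.

Lemma corner_mul s t : S s -> corner f s *m corner f t = corner f (s *m t).
Proof.
move=> Ss; rewrite /corner; move: (cf Ss) (mulmxA f s t) => cs ast.
have h1 : (1%:M - f) *m (1%:M - f) = 1%:M - f by rewrite mulmxBl mul1mx mulmxBr mulmx1 ff subrr subr0.
have h2 : (1%:M - f) *m f = 0 by rewrite mulmxBl mul1mx ff subrr.
have h3 : f *m (1%:M - f) = 0 by rewrite mulmxBr mulmx1 ff subrr.
move: (1%:M - f) h1 h2 h3 => g h1 h2 h3.
rewrite mulmxDl !mulmxDr h1 mulmxA h2 mul0mx addr0; congr (_ + _).
rewrite cs -(mulmxA s f) h3 mulmx0 add0r.
by rewrite -(mulmxA s f) (mulmxA f f) ff mulmxA -cs -mulmxA.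
Qed.

Lemma corner1 : corner f 1%:M = 1%:M.
Proof. by rewrite /corner mulmx1 subrK. Qed.

Lemma corner_adj s : S s -> adjJ eps (corner f s) = corner f (adjJ eps s).
Proof.
by move=> Ss; rewrite /corner adjJD adjJB adjJ1 // (adjJM Heps f) af -cf //; exact: SV.
Qed.

Lemma corner_OJ s : S s -> OJ eps (corner f s).
Proof.
move=> Ss; apply/OJP => //; rewrite corner_adj // corner_mul; last exact: SV.
by have /(OJP Heps) -> := SO Ss; exact: corner1.
Qed.

Lemma cornerB1 s : corner f s - 1%:M = f *m (s - 1%:M).
Proof. by rewrite /corner mulmxBr mulmx1 addrAC [1%:M - f]addrC addrK addrC. Qed.

Lemma offdiag (T : M) i j : i != j -> (T - blockdiag b rep T) i j = T i j.
Proof.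
by move=> ij; rewrite [LHS]mxE [X in _ + X]mxE [X in _ - X]mxE (negPf ij) mulr0n subr0.
Qed.

(** Zassenhaus for the group of corners. If all corners of [T0] were trivial, f delta_ac f would
    commute with [T0] despite an (a, c) entry of at least 1/4. A corner commuting with those of [T0]
    commutes with [T0] itself, so its off-diagonal entries are small. *)
Lemma corner_tang a c : a != c -> nrm f <= 2 -> 1 / 2 <= `|f a a| -> 1 / 2 <= `|f c c| ->
  exists2 X, tang (corner_group f) X & X != 0 /\ f *m X = X.
Proof.
move=> ac f2 fa fc.
have e200 : 200 * eta <= 1.
  have [] := eta_bounds eta0 eta_small3 n0; lra.
have nis : forall e, 0 < e -> exists s, [/\ corner_group f s, s != 1%:M & nrm (s - 1%:M) < e].
  pose Q a := exists2 x, T0 x & a = corner f x.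
  apply: (@zassenhaus R n eps Heps (corner_group f) Q (n%:R * 2 * r)) => //.
  - by apply: le_trans r_small; rewrite le_eqVlt; apply/orP; left; apply/eqP; ring.
  - by move=> _ [s Ss ->]; exact: corner_OJ.
  - by move=> _ _ [s Ss ->] [t St ->]; exists (s *m t); [exact: SM|exact: corner_mul].
  - by move=> _ [s Ss ->]; exists (adjJ eps s); [exact: SV|exact: corner_adj].
  - move=> _ [x Tx ->]; split; first by exists x => //; exact: TS.
    by rewrite cornerB1; exact: nrmM_le f2 (T_near Tx).
  - apply: contrapT => H.
    have {}H x : T0 x -> f *m x = f.
      move=> Tx; apply/eqP; apply: contraT => nx; case: H; exists (corner f x); first by exists x.
      by rewrite -subr_eq0 cornerB1 mulmxBr mulmx1 subr_eq0.
    pose T : M := f *m delta_mx a c *m f.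
    have TE i j : T i j = f i a * f c j.
      rewrite /T mxE (bigD1 c) //= big1 ?addr0 => [|l lj].
        rewrite mxE (bigD1 a) //= big1 ?addr0 => [|l li]; first by rewrite mxE !eqxx mulr1.
        by rewrite mxE (negPf li) mulr0.
      by rewrite mxE big1 ?mul0r // => m _; rewrite mxE (negPf lj) andbF mulr0.
    have := T_comm (T := T); case/(_ _)/Wrap => [x Tx|le].
      have xf : x *m f = f by rewrite -cf ?H //; exact: TS.
      by rewrite /T -(mulmxA _ f x) (H x) // !mulmxA xf.
    have := le_trans (nrm_entry _ a c) le; rewrite offdiag //.
    rewrite TE normrM => le2.
    have nT : nrm T <= 4.
      apply: nrm_le => // i j; rewrite TE normrM (_ : 4 = 2 * 2); last by ring.
      by apply: ler_pM => //; apply: le_trans (nrm_entry _ _ _) f2.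
    have h1 : 1 / 2 * (1 / 2) <= `|f a a| * `|f c c| by apply: ler_pM; rewrite ?divr_ge0.
    have h2 : eta * nrm T <= eta * 4 by rewrite ler_wpM2l // ltW.
    lra.
  - move=> _ [s Ss ->] Hc i j ij; set T := corner f s - 1%:M.
    have TfE : T = f *m (s - 1%:M) by exact: cornerB1.
    have fT : f *m T = T by rewrite TfE mulmxA ff.
    have Tf : T *m f = T.
      by rewrite TfE -mulmxA mulmxBl mul1mx -cf // mulmxBr ff mulmxA ff mulmxBr mulmx1.
    have Tc x : T0 x -> T *m x = x *m T.
      move=> Tx; have cfx : f *m x = x *m f by apply: cf; exact: TS.
      have abs (A B : M) : (A + 1%:M) *m (B + 1%:M) = (B + 1%:M) *m (A + 1%:M) -> A *m B = B *m A.
        rewrite !mulmxDl !mulmxDr !mulmx1 !mul1mx => h.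
        by apply: (addIr (A + (B + 1%:M))); rewrite addrA h -addrA; congr (_ + _); rewrite addrCA.
      have {abs}h : T *m (f *m (x - 1%:M)) = f *m (x - 1%:M) *m T.
        apply: abs; rewrite -cornerB1 /T !subrK.
        exact: (Hc (corner f x) (ex_intro2 _ _ x Tx erefl)).
      move: (T) Tf fT h => {TfE} {}T Tf fT.
      rewrite mulmxA Tf mulmxBr mulmx1 mulmxBr mulmx1 cfx mulmxBl fT -mulmxA fT.
      by move=> h; apply: (addIr (- T)).
    have := le_trans (nrm_entry _ i j) (T_comm Tc); rewrite offdiag // => h.
    apply: le_trans h _; rewrite ler_wpM2r ?nrm_ge0 //; lra.
have g1 : corner_group f 1%:M by exists 1%:M => //; rewrite corner1.
have [X hX X0] := tang_nonisolated nis g1.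
exists X => //; split=> //.
have := @tang_linear_eq R n (corner_group f) f 1%:M 1%:M 1%:M X.
rewrite !mulmx1 mul1mx; apply => // _ [s Ss ->].
by rewrite cornerB1 !mulmx1 mul1mx mulmxA ff.
Qed.

End Corner.

Let two_indices c : exists a d, [/\ b a = c, b d = c & a != d].
Proof.
have [a ba _] := @Hblk c [::] isT; have [d bd] := @Hblk c [:: a] isT.
by rewrite inE => da; exists a, d; rewrite eq_sym.
Qed.

Lemma tang_nonzero : exists2 X, tang S X & X != 0.
Proof.
have [a [c [_ _ ac]]] := two_indices true.
have := @corner_tang 1%:M (mulmx1 _) (adjJ1 Heps) _ a c ac.
case/(_ _ _ _ _)/Wrap => [s _||||[X hX [X0 _]]].
- by rewrite mul1mx mulmx1.
- by apply: le_trans (nrm_scalar_le _ _) _; rewrite normr1; lra.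
- by rewrite mxE eqxx normr1; lra.
- by rewrite mxE eqxx normr1; lra.
exists X => //; apply: tang_mono hX => _ [s Ss ->]; apply: zc_sub.
by rewrite /corner subrr add0r mul1mx.
Qed.

Lemma full_mixed_zc : full b S eta true false ->
  forall k, OJ eps k -> \det k = 1 -> zc S k.
Proof.
move=> f1 k kO kd; have f2 := full_sym f1.
have ftt := full_bracket SM SO eta0 eta_small3 n0 Hunits Hblk (p := true) f1.
have fff := full_bracket SM SO eta0 eta_small3 n0 Hunits Hblk (p := false) f2.
have ft := full_tang SO eta0 eta_small3 n0 ftt fff f1.
rewrite -[k]mul1mx; apply: (orthogonal_zc_mulr Heps (B := predT) SM) => //.
- by move=> a c _ _; apply: ft; exact: soJ_Emx.
- exact: zc_sub.
Qed.

Section Split.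
Variables e g h : M.
Hypothesis ee : e *m e = e.
Hypothesis ae : adjJ eps e = e.
Hypothesis ce : commutes S e.
Hypothesis e_near : nrm (e - P0 true) <= 200 * (eta * n%:R).
Hypothesis gO : OJ eps g.
Hypothesis eg : e *m g = g *m P0 true.
Hypothesis hE : h = adjJ eps g.
Let hg : h *m g = 1%:M. Proof. by rewrite hE; apply/(OJP Heps). Qed.
Let gh : g *m h = 1%:M. Proof. exact: mulmx1C hg. Qed.
Let hO : OJ eps h. Proof. by rewrite hE; exact: OJ_adj. Qed.

Definition conj_image : M -> Prop := fun a => exists2 s, S s & a = h *m s *m g.

Let conj_h s : h *m (g *m s *m h) *m g = s.
Proof. by rewrite !mulmxA hg mul1mx -mulmxA hg mulmx1. Qed.

Let conj_g s : g *m (h *m s *m g) *m h = s.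
Proof. by rewrite !mulmxA gh mul1mx -mulmxA gh mulmx1. Qed.

Lemma ep_basis c : ep e c *m g = g *m P0 c.
Proof.
case: c => //=; rewrite -[false]/(~~ true) (blockproj_compl R) mulmxBl mul1mx eg.
by rewrite mulmxBr mulmx1.
Qed.

Lemma basis_ep c : h *m ep e c = P0 c *m h.
Proof.
by rewrite -[LHS]mulmx1 -gh mulmxA -(mulmxA h) ep_basis mulmxA hg mul1mx.
Qed.

Definition block_full c := forall X, soJ eps X -> ep e c *m X = X -> X *m ep e c = X -> tang S X.

Lemma conj_block_tang c : block_full c ->
  forall a d, b a == c -> b d == c -> tang conj_image (E a d).
Proof.
move=> H a d /eqP ba /eqP bd; rewrite -[E a d]conj_h.
apply: (tang_transport (S := S)) => //; first by move=> s Ss; exists s.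
have PE : P0 c *m E a d = E a d.
  apply/matrixP => i j; rewrite blockproj_mul; have [|bi] := eqVneq (b i) c; first by rewrite mul1r.
  rewrite mul0r EmxE; have [ia|_] := eqVneq i a; first by rewrite ia ba eqxx in bi.
  have [id|_] := eqVneq i d; first by rewrite id bd eqxx in bi.
  by rewrite /= mulr0 subr0.
have EP : E a d *m P0 c = E a d.
  apply/matrixP => i j; rewrite mul_blockproj; have [|bi] := eqVneq (b j) c; first by rewrite mul1r.
  rewrite mul0r EmxE; have [ia|_] := eqVneq j a; first by rewrite ia ba eqxx in bi.
  have [id|_] := eqVneq j d; first by rewrite id bd eqxx in bi.
  by rewrite !andbF /= mulr0 subr0.
have sE : soJ eps (E a d) by exact: soJ_Emx.
move: (E a d) sE PE EP => X /(soJP Heps) sX PX XP.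
apply: H.
- apply/(soJP Heps); rewrite (adjJM Heps) (adjJM Heps g) sX hE (adjJK Heps) mulNmx mulmxN.
  by rewrite mulmxA.
- by rewrite !mulmxA ep_basis -(mulmxA g) PX.
- by rewrite -(mulmxA (g *m X) h) basis_ep mulmxA -(mulmxA g) XP.
Qed.

Lemma conj_image_mul s t : conj_image s -> conj_image t -> conj_image (s *m t).
Proof.
move=> [x Sx ->] [y Sy ->]; exists (x *m y); first exact: SM.
by rewrite !mulmxA -(mulmxA (h *m x)) gh mulmx1.
Qed.

Lemma conj_block_mulr c : block_full c -> forall s k, zc conj_image s -> OJ eps k ->
  \det k = 1 -> supp_on (fun i => b i == c) (k - 1%:M) -> zc conj_image (s *m k).
Proof.
by move=> H; apply: (orthogonal_zc_mulr Heps conj_image_mul); exact: conj_block_tang.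
Qed.

(** Conjugation by [g] reduces to a standard block, where the tangent vectors E a d generate. *)
Lemma block_mulr c : block_full c -> forall s k, zc S s -> OJ eps k -> \det k = 1 ->
  ep e (~~ c) *m (k - 1%:M) = 0 -> (k - 1%:M) *m ep e (~~ c) = 0 -> zc S (s *m k).
Proof.
move=> H s k zs kO kd e1 e2.
have E1 : h *m k *m g - 1%:M = h *m (k - 1%:M) *m g.
  by rewrite mulmxBr mulmx1 mulmxBl hg.
have z : zc conj_image ((h *m s *m g) *m (h *m k *m g)).
  apply: (conj_block_mulr H).
  - by apply: zc_transport zs => x Sx; exists x.
  - by apply: OJM => //; exact: OJM.
  - by rewrite !det_mulmx kd mulr1 -det_mulmx hg det1.
  - move=> i j; rewrite E1 negb_and.
    have P1 : P0 (~~ c) *m (h *m (k - 1%:M) *m g) = 0.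
      by rewrite 2!mulmxA -basis_ep -(mulmxA h) e1 mulmx0 mul0mx.
    have P2 : (h *m (k - 1%:M) *m g) *m P0 (~~ c) = 0.
      by rewrite -mulmxA -ep_basis mulmxA -(mulmxA h) e2 mulmx0 mul0mx.
    move: (h *m (k - 1%:M) *m g) P1 P2 => X P1 P2 /orP[bi|bj].
      have := congr1 (fun A : M => A i j) P1; rewrite [RHS]mxE blockproj_mul.
      by rewrite (_ : b i == ~~ c) ?mul1r //; move: bi; case: (b i); case: (c).
    have := congr1 (fun A : M => A i j) P2; rewrite [RHS]mxE mul_blockproj.
    by rewrite (_ : b j == ~~ c) ?mul1r //; move: bj; case: (b j); case: (c).
have := zc_transport (S' := S) (g := g) (h := h) _ z.
case/(_ _)/Wrap => [_ [x Sx ->]|]; first by rewrite conj_g.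
by rewrite !mulmxA gh mul1mx -(mulmxA s g h) gh mulmx1 -(mulmxA _ g h) gh mulmx1.
Qed.

Let th := theta_bounds n0 theta_small e_near.

Let ep_entry c a : b a = c -> 1 / 2 <= `|ep e c a a|.
Proof.
move=> ba; have [t0 t1 _] := th.
have /(le_trans (nrm_entry _ a a)) := ep_near e_near c.
have t2 : 200 * (eta * n%:R) * 1 <= 200 * (eta * n%:R) * n%:R by rewrite ler_wpM2l.
have -> : (ep e c - P0 c) a a = ep e c a a - 1 by rewrite [LHS]mxE [X in _ + X]mxE mxE ba !eqxx.
move: (ep e c a a) => x h1; have := ler_normB x (x - 1); rewrite subKr normr1; lra.
Qed.

Let nrm_ep c : nrm (ep e c) <= 2.
Proof.
have [t0 t1 _] := th.
have t2 : 200 * (eta * n%:R) * 1 <= 200 * (eta * n%:R) * n%:R by rewrite ler_wpM2l.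
rewrite -(subrK (P0 c) (ep e c)); apply: le_trans (nrmD _ _) _.
have := ep_near e_near c; have := nrm_blockproj R b c; lra.
Qed.

(** The two corners of [s] multiply to [s], so the determinant of one fixes that of the other. *)
Lemma det_corner c s : S s -> \det (corner (ep e c) s) = 1.
Proof.
case: c => Ss; first exact: Hdet.
have : \det (corner e s *m corner (1%:M - e) s) = 1.
  rewrite (_ : _ *m _ = s) ?Sdet // /corner subKr.
  have h1 : (1%:M - e) *m e = 0 by rewrite mulmxBl mul1mx ee subrr.
  have h2 : e *m (1%:M - e) = 0 by rewrite mulmxBr mulmx1 ee subrr.
  have h3 : (1%:M - e) *m (1%:M - e) = 1%:M - e by rewrite [LHS]mulmxBl h2 subr0 mul1mx.
  have h4 : 1%:M - e + e = 1%:M by rewrite subrK.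
  have cs : e *m s = s *m e by exact: ce.
  move: (1%:M - e) h1 h2 h3 h4 => f h1 h2 h3 h4.
  rewrite mulmxDl !mulmxDr h1 add0r !(mulmxA f) h3.
  rewrite cs -!(mulmxA s e) ee (mulmxA e f) h2 mul0mx mulmx0 addr0 -cs -mulmxDl.
  by rewrite h4 mul1mx.
by rewrite det_mulmx Hdet // mul1r.
Qed.

(** A corner of [s] in c is [s] times an orthogonal element of the other block, hence lies in the
    closure. So the nonzero tangent vector X = ep c X of the corner group is tangent to [S], while
    [missing_type] would give ep c X = 0. *)
Lemma block_present c : block_full (~~ c) -> full b S eta c c.
Proof.
move=> Hc; apply: contrapT => nf.
have [a [d [ba bd ad]]] := two_indices c.
have [X hX [X0 fX]] := corner_tang (ep_idem ee c) (ep_adj ae c) (ep_comm ce c) ad (nrm_ep c) (ep_entry ba) (ep_entry bd).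
move: X0; rewrite -fX (missing_type SO eta0 eta_small3 n0 Hunits ee ae ce theta_small e_near nf) ?eqxx //.
apply: tang_mono hX => _ [s Ss ->].
pose t := adjJ eps s; have St : S t by exact: SV.
have ts : t *m s = 1%:M by have /(OJP Heps) := SO Ss.
have st : s *m t = 1%:M by exact: mulmx1C.
have fc := ep_comm ce c Ss; have ff := ep_idem ee c; have ft := ep_comm ce c St.
have dt := det_corner c Ss; have co : OJ eps (corner (ep e c) s).
  exact: (corner_OJ (ep_idem ee c) (ep_adj ae c) (ep_comm ce c) Ss).
rewrite -[corner _ _]mul1mx -st -mulmxA.
have kE : t *m corner (ep e c) s - 1%:M = (1%:M - ep e c) *m (t - 1%:M).
  rewrite /corner mulmxDr mulmxBr mulmx1 (mulmxA t) -ft -(mulmxA _ t) ts mulmx1.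
  rewrite mulmxBl mul1mx mulmxBr mulmx1; move: (ep e c *m t) (ep e c) (t) => A B C.
  by apply/matrixP => i j; rewrite !mxE; ring.
have e0 : ep e (~~ ~~ c) *m (1%:M - ep e c) = 0 by rewrite negbK mulmxBr mulmx1 ff subrr.
have e1 : (1%:M - ep e c) *m ep e (~~ ~~ c) = 0 by rewrite negbK mulmxBl mul1mx ff subrr.
apply: (block_mulr Hc); first exact: zc_sub.
- by apply: OJM => //; exact: SO.
- by rewrite det_mulmx Sdet // mul1r.
- by rewrite kE mulmxA e0 mul0mx.
- rewrite kE -mulmxA (_ : (t - 1%:M) *m _ = ep e (~~ ~~ c) *m (t - 1%:M)); last first.
    by rewrite negbK mulmxBl mulmxBr mul1mx mulmx1 ft.
  by rewrite mulmxA e1 mul0mx.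
Qed.

Lemma full_block c : ~ full b S eta (~~ c) (~~ c) -> full b S eta c c -> block_full c.
Proof.
move=> nf fc; apply: (split_tang_block SO eta0 eta_small3 n0 ce theta_small e_near fc).
exact: (missing_type SO eta0 eta_small3 n0 Hunits ee ae ce theta_small e_near nf).
Qed.

(** If the second diagonal type were missing, the first block would be full and [block_present]
    would supply that type; with both types, [split_tang_both] applies. *)
Lemma all_blocks : (exists c, full b S eta c c) -> forall c, block_full c.
Proof.
have both : full b S eta true true -> full b S eta false false -> forall c, block_full c.
  move=> ft ff c X sX eX Xe.
  apply: (split_tang_both SO eta0 eta_small3 n0 ce theta_small e_near ft ff sX).
  case: c eX Xe => /= eX Xe; first by rewrite eX Xe.
  have -> : e *m X = 0.
    by move/eqP: eX; rewrite mulmxBl mul1mx -subr_eq0 addrAC subrr add0r oppr_eq0 => /eqP.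
  by move/eqP: Xe; rewrite mulmxBr mulmx1 -subr_eq0 addrAC subrr add0r oppr_eq0 => /eqP.
move=> [c fc]; have fn : full b S eta (~~ c) (~~ c).
  by apply: contrapT => nf; apply: (nf); apply: block_present; rewrite negbK; exact: full_block nf fc.
by case: c fc fn => fc fn; exact: both.
Qed.

End Split.

Hypothesis p0 : (0 < p)%N.

(** The second alternative bounds the conjugated closure from above by polynomial conditions and
    from below by stability under right multiplication by either block, a form in which the two
    blocks compose. *)
Lemma dichotomy :
  (forall k, OJ eps k -> \det k = 1 -> zc S k) \/
  exists g : M, let S' := conj_image g (adjJ eps g) in
    [/\ OJ eps g, \det g = 1,
     (forall s, S' s -> commutes S' (P0 true) /\ \det (corner (P0 true) s) = 1) &
     forall c s k, zc S' s -> OJ eps k -> \det k = 1 ->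
       supp_on (fun i => b i == c) (k - 1%:M) -> zc S' (s *m k)].
Proof.
have [f|nf] := pselect (full b S eta true false); first by left; exact: full_mixed_zc.
right; have [X hX X0] := tang_nonzero.
have [Phi cPhi nPhi] := casimir_exists SM SV SO eta0 eta_small3 n0 Hunits Hblk hX X0 nf Hpq (Hrep true) (Hrep false).
have Hcomm T : commutes S T -> nrm (T - blockdiag b rep T) <= eta * nrm T.
  by move=> cT; apply: T_comm => x /TS; exact: cT.
have es : eta * (200 * n%:R) <= 1.
  apply: le_trans eta_small3; rewrite ler_wpM2l ?(ltW eta0) // ler_wpM2l //.
  by rewrite -{1}(expr1 n%:R) ler_weXn2l.
have [e [ee ae ce e_near]] := commutes_idempotent Hrep SV eta0 es Hcomm cPhi nPhi.
have [g [gO gdet eg]] := adapted_basis ee ae theta_small e_near p0.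
have hg : adjJ eps g *m g = 1%:M by apply/(OJP Heps).
have gh := mulmx1C hg.
exists g => S'; split=> //; last first.
  move=> c; apply: (conj_block_mulr gO eg erefl); move: c.
  apply: (all_blocks ee ae ce e_near gO eg erefl).
  have [c1 [c2 [fc [d [d' [_ bd bd' _]]]]]] := full_exists SO eta0 Hunits hX X0.
  move: c1 c2 fc {bd bd'} => -[] [] fc.
  - by exists true.
  - by case: nf.
  - by case: nf; exact: full_sym.
  - by exists false.
have PE : P0 true = adjJ eps g *m e *m g by rewrite -mulmxA eg mulmxA hg mul1mx.
have csg a1 a2 (x y : M) : a1 *m a2 = 1%:M -> (a2 *m x *m a1) *m (a2 *m y *m a1) = a2 *m (x *m y) *m a1.
  by move=> h; rewrite !mulmxA -(mulmxA (a2 *m x)) h mulmx1.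
move=> _ [s Ss ->]; split.
  by move=> _ [t St ->]; rewrite PE !csg // ce.
rewrite PE /corner csg //.
have -> : 1%:M - adjJ eps g *m e *m g + adjJ eps g *m (e *m s) *m g = adjJ eps g *m (1%:M - e + e *m s) *m g.
  by rewrite mulmxDr mulmxDl mulmxBr mulmxBl mulmx1 hg.
by move: (adjJ eps g) hg => h hg; rewrite !det_mulmx (Hdet ee ae ce e_near Ss) mulr1 -det_mulmx hg det1.
Qed.

End Dichotomy.

(** * A uniform neighbourhood *)

Section Near.
Variables (R : realType) (p q : nat) (Gamma : groupType).
Notation n := (p + q)%N.
Notation b := (@second_block p q).
Notation M := 'M[R]_n.
Notation eps := (bsign R b).
Notation E := (Emx eps).
Notation P0 := (blockproj R b).
Let Heps : forall i, eps i * eps i = 1 := @bsignK R n b.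
Variable rho0 : Gamma -> M.
Hypothesis rho0M : forall x y, rho0 (x * y)%g = rho0 x *m rho0 y.
Hypothesis rho01 : rho0 1%g = 1%:M.
Hypothesis rho0_orth : forall x, (rho0 x)^T *m rho0 x = 1%:M.
Hypothesis rho0_det : forall x, \det (1%:M - P0 true + P0 true *m rho0 x) = 1.
Hypothesis Hblk : forall c (s : seq 'I_n), (size s <= 4)%N -> exists2 y, b y = c & y \notin s.
Hypothesis Hpq : #|[pred j | b j == true]| != #|[pred j | b j == false]|.
Variable rep : bool -> 'I_n.
Hypothesis Hrep : forall c, b (rep c) = c.
Hypothesis Hrot : forall x y t, x != y -> b x = b y -> zc (image_of rho0) (rot b x y t).
Variable gs : seq Gamma.
Hypothesis Hgs : forall H : {pred Gamma}, group_closed H -> {subset gs <= H} -> forall x, x \in H.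
Hypothesis p0 : (0 < p)%N.

Let n0 : (0 < n)%N. Proof. by rewrite addn_gt0 p0. Qed.
Let n1 : 1 <= n%:R :> R. Proof. by rewrite ler1n. Qed.

(** The determinant is Lipschitz near the corner of rho0 x, where it is 1; a deviation below 1 is
    enough to exclude -1. *)
Lemma det_corner_near x : exists2 z, 0 < z & forall e A : M,
  nrm (e - P0 true) <= z -> nrm (A - rho0 x) <= z -> `|\det (corner e A) - 1| < 1.
Proof.
have n1' := n1; have [dF [ddF hF]] : poly_fun (fun A : M => \det A).
  have H : poly_fun (fun A : M => \det (\matrix_(i, j) A i j)).
    by apply: (poly_det (F := fun i j (A : M) => A i j)) => i j; exact: poly_coord.
  by apply: (poly_ext H) => A; congr (\det _); apply/matrixP => i j; rewrite mxE.
have [C C0 HC] := pf_lipschitz hF (corner (P0 true) (rho0 x)).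
have D0 : 0 < 4 * n%:R * (C + 1) by apply: mulr_gt0; lra.
(* The corner moves by at most 4 n z; this is at most 1, and C times it is less than 1. *)
exists (4 * n%:R * (C + 1))^-1; first by rewrite invr_gt0.
set z := _^-1 => e A he hA.
have z0 : 0 < z by rewrite invr_gt0.
have zE : z * (4 * n%:R * (C + 1)) = 1 by rewrite mulVf // gt_eqF.
have nz : 4 * n%:R * z <= 1.
  have h : 0 <= 4 * n%:R * z * C by rewrite !mulr_ge0 // ltW.
  by move: zE; rewrite (_ : z * _ = 4 * n%:R * z * C + 4 * n%:R * z); [lra|ring].
have z1 : z <= 1 by have := ler_wpM2r (ltW z0) n1; lra.
have s0 : nrm (rho0 x) <= 1 by exact: orthogonal_entry.
have nA : nrm A <= 2.
  rewrite -(subrK (rho0 x) A); apply: le_trans (nrmD _ _) _; lra.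
have nd : nrm (corner e A - corner (P0 true) (rho0 x)) <= 4 * n%:R * z.
  have -> : corner e A - corner (P0 true) (rho0 x) =
      P0 true *m (A - rho0 x) + (e - P0 true) *m A - (e - P0 true).
    rewrite /corner mulmxBl mulmxBr; move: (e *m A) (P0 true *m A) (P0 true *m rho0 x) => X Y Z.
    by apply/matrixP => i j; move: e (P0 true) {he} => e f; rewrite !mxE; ring.
  have h1 := nrmM_le (nrm_blockproj R b true) hA.
  have h2 := nrmM_le he nA.
  apply: le_trans (nrmB _ _) _; apply: le_trans (lerD (nrmD _ _) (lexx _)) _.
  have h3 : z <= n%:R * z by rewrite ler_peMl // ltW.
  by lra.
have := HC _ (le_trans nd nz); rewrite /corner rho0_det => h.
apply: le_lt_trans h _; apply: le_lt_trans (ler_wpM2l C0 nd) _.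
have h1 : 0 < 4 * n%:R * z by rewrite !mulr_gt0 // (lt_le_trans _ n1).
by move: zE; rewrite (_ : z * _ = C * (4 * n%:R * z) + 4 * n%:R * z); [lra|ring].
Qed.

Lemma det_corner_near_seq (s : seq Gamma) : exists2 z, 0 < z & forall x (e A : M), x \in s ->
  nrm (e - P0 true) <= z -> nrm (A - rho0 x) <= z -> `|\det (corner e A) - 1| < 1.
Proof.
elim: s => [|x s [z z0 IH]]; first by exists 1.
have [z' z0' Hx] := det_corner_near x.
exists (Num.min z z'); first by rewrite lt_min z0.
move=> y e A; rewrite inE !le_min => /orP[/eqP->|ys] /andP[h1 h2] /andP[h3 h4].
  exact: Hx.
exact: (IH y).
Qed.

Lemma local_dichotomy : exists (s : seq Gamma) (dl : R), 0 < dl /\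
  forall rho : Gamma -> M,
  (forall x y, rho (x * y)%g = rho x *m rho y) -> rho 1%g = 1%:M ->
  (forall x, OJ eps (rho x)) -> (forall x, \det (rho x) = 1) ->
  (forall x, x \in s -> nrm (rho x - rho0 x) <= dl) ->
  let S := image_of rho in
  (forall k, OJ eps k -> \det k = 1 -> zc S k) \/
  exists g : M, let S' := conj_image S g (adjJ eps g) in
    [/\ OJ eps g, \det g = 1,
     (forall s, S' s -> commutes S' (P0 true) /\ \det (corner (P0 true) s) = 1) &
     forall c s k, zc S' s -> OJ eps k -> \det k = 1 ->
       supp_on (fun i => b i == c) (k - 1%:M) -> zc S' (s *m k)].
Proof.
have n1' := n1; have [z z0 Hz] := det_corner_near_seq gs.
have X0 : 0 < n%:R ^+ 4 :> R by rewrite exprn_gt0 // (lt_le_trans _ n1).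
have [r r0 rE] : exists2 r : R, 0 < r & r * (32 * n%:R ^+ 4) = 1.
  have N0 : 0 < 32 * n%:R ^+ 4 :> R by rewrite mulr_gt0.
  by exists (32 * n%:R ^+ 4)^-1; [rewrite invr_gt0|rewrite mulVf // gt_eqF].
(* The first bound matches 32 n^4 with 3200 n^4; the second keeps the idempotent, at distance at
   most 200 [eta] n from the block projection, in the range [z] of the determinant estimate. *)
pose eta := Num.min (r / 100) (z / (200 * n%:R)).
have nn0 : 0 < 200 * n%:R :> R by lra.
have eta0 : 0 < eta by rewrite lt_min !divr_gt0.
have eta_small : eta * (3200 * n%:R ^+ 4) <= 1.
  have h : eta <= r / 100 by rewrite ge_min lexx.
  have aux (e u X : R) : 0 <= X -> e <= u / 100 -> u * (32 * X) = 1 -> e * (3200 * X) <= 1.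
    by move=> hX he E; have := ler_wpM2r hX he; lra.
  exact: (aux _ _ _ (ltW X0) h rE).
have eta_z : 200 * (eta * n%:R) <= z.
  have h : eta <= z / (200 * n%:R) by rewrite ge_min lexx orbT.
  by move: h; rewrite ler_pdivlMr //; lra.
(* Half of the radius is left for the distance from rho x to rho0 x. *)
have r20 : 0 < r / 2 by rewrite divr_gt0.
have [s1 [d1 [d10 T1 T2]]] := commutant_near rho0M rho01 rho0_orth Hblk Hrep Hrot r20 eta0.
have [s2 [d2 [d20 U]]] := units_near rho0M rho01 rho0_orth Hblk Hrot eta0.
exists (gs ++ s1 ++ s2), (Num.min z (Num.min (r / 2) (Num.min d1 d2))).
split; first by rewrite !lt_min z0 d10 d20 divr_gt0.
move=> rho rhoM rho1 rhoO rhod near S.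
have near_gs x : x \in gs -> nrm (rho x - rho0 x) <= z.
  move=> xs; have := near x; rewrite !mem_cat xs /= !le_min => /(_ isT) /andP[-> //].
have near1 x : x \in s1 -> nrm (rho x - rho0 x) <= r / 2 /\ nrm (rho x - rho0 x) <= d1.
  by move=> xs; have := near x; rewrite !mem_cat xs orbT /= !le_min => /(_ isT) /and4P[].
have near2 x : x \in s2 -> nrm (rho x - rho0 x) <= d2.
  by move=> xs; have := near x; rewrite !mem_cat xs !orbT /= !le_min => /(_ isT) /and4P[].
have rhoV x : adjJ eps (rho x) = rho (x^-1)%g.
  have h1 : adjJ eps (rho x) *m rho x = 1%:M by apply/(OJP Heps).
  by rewrite -[LHS]mulmx1 -rho1 -(mulgV x) rhoM mulmxA h1 mul1mx.
have SV s : S s -> S (adjJ eps s) by move=> [x ->]; exists (x^-1)%g.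
have SO s : S s -> OJ eps s by move=> [x ->].
have SM s t : S s -> S t -> S (s *m t) by move=> [x ->] [y ->]; exists (x * y)%g.
apply: (@dichotomy R p q S (fun x => exists2 y, y \in s1 & x = rho y) eta r) Hblk Hpq rep Hrep _ _ _ _ p0 => //.
- by exists 1%g.
- by move=> _ [x ->].
- by rewrite rE.
- move=> a c d e ac de ad ce.
  have [cs Hcs] := U rho near2 a c d e ac de ad ce.
  exists (Ad_comb b rho cs) => //; split.
    move=> X hX; apply: tang_sum => x; apply: tangZ; apply: (tang_Ad SM SV) => //.
    by exists x.2.
  move=> g X cg; rewrite /Ad_comb mulmx_sumr; apply: eq_bigr => x _.
  by rewrite -scalemxAr !mulmxA cg //; exists x.2.
- by move=> _ [x _ ->]; exists x.
- move=> _ [x xs ->]; have [h _] := near1 x xs; have := T1 x xs => h'.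
  rewrite -(subrK (rho0 x) (rho x)) -addrA; apply: le_trans (nrmD _ _) _; lra.
- move=> T cT; apply: (T2 rho).
    by move=> x /near1[].
  by move=> x xs; apply: cT; exists x.
- move=> e ee ae ce ne _ [x ->].
  have cM y t : corner e (rho y) *m corner e (rho t) = corner e (rho (y * t)%g).
    by rewrite rhoM; exact: (corner_mul ee ce _ (ex_intro _ y erefl)).
  (* The corner determinant is a character with values in signs; the subgroup where it is 1 contains
     the generators by [Hz]. *)
  have dc y : \det (corner e (rho y)) ^+ 2 = 1.
    by apply: det_OJ; exact: (corner_OJ SV SO ee ae ce (ex_intro _ y erefl)).
  have := Hgs (H := [pred y | \det (corner e (rho y)) == 1]) _ _ x; rewrite inE => H; apply/eqP/H.
    split; first by rewrite inE rho1 corner1 det1.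
    move=> y t; rewrite !inE => /eqP dy /eqP dt.
    have := congr1 determinant (cM (y * t^-1)%g t); rewrite det_mulmx dt mulr1 mulgKV dy => ->.
    by [].
  move=> y ys; rewrite inE.
  have := Hz y e (rho y) ys (le_trans ne eta_z) (near_gs y ys).
  move/eqP: (dc y); rewrite sqrf_eq1 => /orP[//|/eqP->].
  by rewrite -opprD normrN ger0_norm; lra.
Qed.

End Near.

Local Open Scope classical_set_scope.
Local Open Scope ring_scope.

(** * Topology and Zariski closures *)

Section Topology.
Variables (R : realType) (Gamma : groupType) (p q : nat).
Notation n := (p + q)%N.

Lemma nbhs_repvar (rho0 : repvar R Gamma p q) (s : seq Gamma) (dl : R) : 0 < dl ->
  nbhs rho0 [set rho | forall x, x \in s -> nrm (set_val rho x - set_val rho0 x) <= dl].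
Proof.
move=> dl0; elim: s => [|x s IH].
  by apply: filterS filterT => rho _ x.
have cx : continuous (fun rho : repvar R Gamma p q => set_val rho x).
  move=> rho; apply: (@continuous_comp _ _ _ set_val (fun f : {ptws Gamma -> 'M[R]_n} => f x)).
    exact: initial_continuous.
  exact: proj_continuous.
have Nx : nbhs rho0 [set rho | nrm (set_val rho x - set_val rho0 x) <= dl].
  have H : nbhs rho0 [set rho : repvar R Gamma p q | ball (set_val rho0 x) dl (set_val rho x)].
    exact: (cx rho0 _ (nbhsx_ballx (set_val rho0 x) _ dl0)).
  apply: filterS H => rho /= [_ H]; apply: nrm_le => [|i j]; first exact: ltW.
  rewrite !mxE distrC; apply: ltW.
  exact: (H i j).
apply: filterS (filterI Nx IH) => rho [h1 h2] y; rewrite inE => /orP[/eqP->|] //.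
exact: h2.
Qed.

End Topology.

(** * Zariski closures through polynomial functions *)

Section ZariskiClosure.
Variables (R : realType) (n : nat).
Notation M := 'M[R]_n.
Notation eval f := (fun A : M => mpoly.meval (fun k => mxvec A 0 k) f).

Lemma poly_meval (f : mpoly.mpoly (n * n) R) : poly_fun (eval f).
Proof.
have H (k : 'I_(n * n)) : poly_fun (fun A : M => mxvec A 0 k).
  case/mxvec_indexP: k => i j; apply: (poly_ext (poly_coord R i j)) => A.
  by rewrite mxvecE.
have -> : eval f = (fun A : M => \sum_(m <- mpoly.msupp f)
    mpoly.mcoeff m f * \prod_i mxvec A 0 i ^+ mpoly.fun_of_multinom m i).
  by apply/funext => A; rewrite mpoly.mevalE.
apply: poly_sum => m; apply: poly_mul; first exact: poly_const.
by apply: poly_prod => i; exact: poly_exp.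
Qed.

Lemma meval_poly (F : M -> R) : poly_fun F -> exists f, F = eval f.
Proof.
move=> [dF [ddF]]; elim=> {F dF ddF} [c|i j|F dF ddF G dG ddG _ [f ->] _ [g ->]|F dF ddF G dG ddG _ [f ->] _ [g ->]].
- by exists (mpoly.mpolyC _ c); apply/funext => A; rewrite mpoly.mevalC.
- by exists (mpoly.mpolyX _ (mpoly.mnm1 (mxvec_index i j))); apply/funext => A; rewrite mpoly.mevalXU mxvecE.
- by eexists; apply/funext => A; rewrite -mpoly.mevalD.
- by eexists; apply/funext => A; rewrite -mpoly.mevalM.
Qed.

Lemma zariski_closureE (S : set M) : zariski_closure S = [set A | zc S A].
Proof.
apply/seteqP; split=> A.
  apply; split; last by move=> s Ss; exact: zc_sub.
  exists [set f | vanish S (eval f)]; apply/seteqP; split=> B.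
    by move=> h f hf; exact: (h (eval f) (poly_meval f)).

  by move=> h F /meval_poly[f ->] hf; exact: h.
move=> h Z [[I ->]] sub f If; apply: (h (eval f) (poly_meval f)).
by move=> s /sub; exact.
Qed.

End ZariskiClosure.

(** * The two groups as zero sets *)

Section Groups.
Variables (R : realType) (p q : nat).
Notation n := (p + q)%N.
Notation b := (@second_block p q).
Notation M := 'M[R]_n.
Notation eps := (bsign R b).
Notation P0 := (blockproj R b).
Notation K := (SOp_x_SOq R p q).
Let Heps : forall i, eps i * eps i = 1 := @bsignK R n b.

Lemma SOpqP (A : M) : SOpq R p q A <-> OJ eps A /\ \det A = 1.
Proof. by rewrite /OJ Jmx_block. Qed.

Lemma corner_block (A : 'M[R]_p) (B : 'M[R]_q) :
  corner (P0 true) (block_mx A 0 0 B) = block_mx 1%:M 0 0 B.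
Proof.
rewrite /corner blockproj_true (scalar_mx_block p q 1) mulmx_block !mul0mx !mul1mx !add0r.
by rewrite opp_block_mx add_block_mx !oppr0 add_block_mx !addr0 subrr add0r.
Qed.

(** The corner of diag (A, B) is diag (1, B), which isolates the second determinant; all four
    conditions are polynomial and pass to closures. *)
Lemma SOp_x_SOqP (A : M) : K A <->
  [/\ P0 true *m A = A *m P0 true, OJ eps A, \det A = 1 & \det (corner (P0 true) A) = 1].
Proof.
have OE (X : 'M[R]_p) (Y : 'M[R]_q) : (block_mx X 0 0 Y)^T *m Jmx eps *m block_mx X 0 0 Y =
    block_mx (X^T *m X) 0 0 (- (Y^T *m Y)).
  rewrite Jmx_block tr_block_mx !trmx0 !mulmx_block !mulmx0 !mul0mx !addr0 !add0r.
  by rewrite !mulmx1 !mul0mx mulmxN mulmx1 mulNmx.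
split.
  move=> [X [XO Xd] [Y [YO Yd] <-]]; split.
  - by rewrite blockproj_true !mulmx_block !mulmx0 !mul0mx !mul1mx !mulmx1 !addr0.
  - by rewrite /OJ OE XO YO Jmx_block.
  - by rewrite det_ublock Xd Yd mulr1.
  - by rewrite corner_block det_ublock det1 Yd mulr1.
move=> [PA AO Ad].
have AE := @block_diag R p q A; case/(_ _)/Wrap: AE => [i j bij|AE].
  have := congr1 (fun X : M => X i j) PA; rewrite blockproj_mul mul_blockproj.
  by case: (b i) bij; case: (b j) => //= _; rewrite ?mul1r ?mul0r.
move: AO Ad; rewrite AE; move: (ulsubmx A) (drsubmx A) => X Y.
rewrite /OJ OE corner_block !det_ublock Jmx_block det1 mul1r => /eq_block_mx[XO _ _ /oppr_inj YO] d Yd.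
exists X; first by split=> //; rewrite Yd mulr1 in d.
by exists Y.
Qed.

Lemma zc_OJ (S : M -> Prop) A : (forall s, S s -> OJ eps s) -> zc S A -> OJ eps A.
Proof.
move=> H hA; apply/matrixP => i j; apply/eqP; rewrite -subr_eq0; apply/eqP.
apply: (hA (fun A : M => (A^T *m Jmx eps *m A) i j - Jmx eps i j)); last first.
  by move=> s /H ->; rewrite subrr.
apply: poly_add; last exact: poly_const.
apply: (@poly_ext _ _ (fun A : M => \sum_k (1%:M *m A *m 1%:M) k j * ((Jmx eps)^T *m A *m 1%:M) k i)).
  by apply: poly_sum => k; apply: poly_mul; exact: poly_entry.
move=> B; rewrite mxE; apply: eq_bigr => k _; rewrite mul1mx !mulmx1 mulrC; congr (_ * _).
by rewrite -[B^T *m _]trmxK trmx_mul trmxK [RHS]mxE.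
Qed.

(** The affine argument covers det s (U = 0, W = 1) and the corner determinant (U = 1 - P0, W =
    P0). *)
Lemma zc_det (S : M -> Prop) A (U W : M) : (forall s, S s -> \det (U + W *m s) = 1) ->
  zc S A -> \det (U + W *m A) = 1.
Proof.
move=> H hA; apply/eqP; rewrite -subr_eq0; apply/eqP.
apply: (hA (fun A : M => \det (U + W *m A) - 1)); last first.
  by move=> s /H ->; rewrite subrr.
apply: poly_add; last exact: poly_const.
apply: (@poly_ext _ _ (fun A : M => \det (\matrix_(i, j) (U i j + (W *m A *m 1%:M) i j)))).
  apply: (poly_det (F := fun i j (A : M) => U i j + (W *m A *m 1%:M) i j)) => i j.
  by apply: poly_add; [exact: poly_const|exact: poly_entry].
by move=> B; congr (\det _); apply/matrixP => i j; rewrite mulmx1 !mxE.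
Qed.

Lemma zc_SOpq (S : M -> Prop) A : (forall s, S s -> SOpq R p q s) -> zc S A -> SOpq R p q A.
Proof.
move=> H hA; apply/SOpqP; split.
  by apply: zc_OJ hA => s /H /SOpqP[].
rewrite -[A]add0r -[A]mul1mx; apply: zc_det hA => s /H /SOpqP[_].
by rewrite add0r mul1mx.
Qed.

Lemma zc_SOp_x_SOq (S : M -> Prop) A : (forall s, S s -> K s) -> zc S A -> K A.
Proof.
move=> H hA; apply/SOp_x_SOqP; split.
- apply/matrixP => i j; apply/eqP; rewrite -subr_eq0; apply/eqP.
  apply: (hA (fun A : M => (P0 true *m A) i j - (A *m P0 true) i j)).
    apply: (@poly_ext _ _ (fun A : M => (P0 true *m A *m 1%:M) i j + (- 1%:M *m A *m P0 true) i j)).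
      by apply: poly_add; exact: poly_entry.
    by move=> B; rewrite mulmx1 mulNmx mul1mx mulNmx [X in _ + X]mxE.
  by move=> s /H /SOp_x_SOqP[-> _ _ _]; rewrite subrr.
- by apply: zc_OJ hA => s /H /SOp_x_SOqP[].
- rewrite -[A]add0r -[A]mul1mx; apply: zc_det hA => s /H /SOp_x_SOqP[_ _ ds _].
  by rewrite add0r mul1mx.
- by apply: zc_det hA => s /H /SOp_x_SOqP[].
Qed.

(** Squaring removes the signs of both determinants. Applied to the rotation by half the angle, it
    places rotations in the block group. *)
Lemma square_SOp_x_SOq (B : M) : OJ eps B -> P0 true *m B = B *m P0 true -> K (B *m B).
Proof.
move=> BO BP; pose S (A : M) := OJ eps A /\ P0 true *m A = A *m P0 true.
have pp : P0 true *m P0 true = P0 true by exact: blockprojM.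
have cp : commutes S (P0 true) by move=> s [].
have SV s : S s -> S (adjJ eps s).
  move=> [sO sP]; split; first exact: OJ_adj.
  by rewrite -{1}(@adjJ_blockproj R p q true) -(adjJM Heps) -sP (adjJM Heps) adjJ_blockproj.
have SB : S B by [].
apply/SOp_x_SOqP; split.
- by rewrite mulmxA BP -mulmxA BP mulmxA.
- exact: OJM.
- by rewrite det_mulmx -expr2; exact: det_OJ.
- rewrite -(corner_mul pp cp B SB) det_mulmx -expr2; apply: det_OJ.
  by apply: (corner_OJ SV _ pp (@adjJ_blockproj R p q true) cp SB) => s [].
Qed.

Lemma rot_SOp_x_SOq x y (t : R) : x != y -> b x = b y -> K (rot b x y t).
Proof.
move=> xy bxy; have -> : t = t / 2 + t / 2 by field.
rewrite -rotD //; apply: square_SOp_x_SOq; first exact: OJ_rot.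
apply/matrixP => i j; rewrite blockproj_mul mul_blockproj.
have [->|bij] := eqVneq (b i) (b j); first by rewrite mulrC.
rewrite /rot /planar; move: (sin _) (cos _) => u v.
have ij : i == j = false by apply: contra_neqF bij => /eqP->.
have off k l : b k = b l -> (i == k) && (j == l) = false.
  by move=> bkl; apply: contra_neqF bij => /andP[/eqP-> /eqP->].
rewrite !mxE ij !off //.
by rewrite !mulr0n; ring.
Qed.

Lemma SOpq_neq_SOp_x_SOq : (0 < p)%N -> (0 < q)%N -> exists2 A, SOpq R p q A & ~ K A.
Proof.
move=> p0 q0; pose x := lshift q (Ordinal p0); pose y := rshift p (Ordinal q0).
have bx : b x = false by exact: second_block_l.
have by' : b y = true by exact: second_block_r.
have xy : x != y by apply/eqP => /(congr1 b); rewrite bx by'.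
have e : eps x * eps y = -1 by rewrite /bsign bx by' expr0 mul1r expr1.
(* A boost with cosh = 5/4, sinh = 3/4; its square has determinant 1 and a nonzero mixed entry. *)
pose H : M := planar eps x y (3 / 4) (1 / 4).
have HO : OJ eps H by apply: OJ_planar => //; rewrite e; field.
exists (H *m H).
  by apply/SOpqP; split; [exact: OJM|rewrite det_mulmx -expr2; exact: det_OJ].
move=> /SOp_x_SOqP[/(congr1 (fun X : M => X x y)) + _ _ _].
rewrite blockproj_mul mul_blockproj bx by' eqxx -[false == true]/false mul0r mul1r /H planarM // e.
rewrite /planar !mxE !eqxx (negPf xy) [y == x]eq_sym (negPf xy) /=; lra.
Qed.

End Groups.

Lemma second_block_avoid p q : (4 < p)%N -> (4 < q)%N ->
  forall c (s : seq 'I_(p + q)), (size s <= 4)%N -> exists2 y, second_block y = c & y \notin s.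
Proof.
move=> p4 q4 c s s4.
have avoid m (f : 'I_m -> 'I_(p + q)) : injective f -> (4 < m)%N -> exists i, f i \notin s.
  move=> fi m4; have [/existsP[i fis]|] := boolP [exists i, f i \notin s]; first by exists i.
  rewrite negb_exists => /forallP H.
  have : (size (map f (enum 'I_m)) <= size s)%N.
    apply: uniq_leq_size; first by rewrite map_inj_uniq ?enum_uniq.
    by move=> _ /mapP[i _ ->]; have := H i; rewrite negbK.
  by rewrite size_map size_enum_ord leqNgt (leq_ltn_trans s4 m4).
case: c.
  have [i si] := avoid q (@rshift p q) (@rshift_inj p q) q4.
  by exists (rshift p i); rewrite ?second_block_r.
have [i si] := avoid p (@lshift p q) (@lshift_inj p q) p4.
by exists (lshift q i); rewrite ?second_block_l.
Qed.

Lemma card_second_block p q c : #|[pred j : 'I_(p + q) | second_block j == c]| = if c then q else p.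
Proof.
rewrite -sum1_card big_mkcond big_split_ord /=.
rewrite (eq_bigr (fun=> ~~ c : nat)) => [|i _]; last by rewrite inE second_block_l; case: (c).
rewrite [X in (_ + X)%N](eq_bigr (fun=> c : nat)) => [|i _]; last by rewrite inE second_block_r; case: (c).
by rewrite !sum_nat_const !card_ord; case: c; rewrite ?muln0 ?muln1 ?addn0.
Qed.

Section Conclusion.
Variables (R : realType) (p q : nat).
Notation n := (p + q)%N.
Notation b := (@second_block p q).
Notation M := 'M[R]_n.
Notation eps := (bsign R b).
Notation P0 := (blockproj R b).
Notation K := (SOp_x_SOq R p q).
Let Heps : forall i, eps i * eps i = 1 := @bsignK R n b.

(** diag (A, B) = diag (A, 1) diag (1, B), and each factor is absorbed by one block. *)
Lemma SOp_x_SOq_sub_zc (S : M -> Prop) : S 1%:M ->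
  (forall c s k, zc S s -> OJ eps k -> \det k = 1 ->
     supp_on (fun i => b i == c) (k - 1%:M) -> zc S (s *m k)) ->
  forall k, K k -> zc S k.
Proof.
move=> S1 H _ [A [AO Ad] [B [BO Bd] <-]].
have OO (X : 'M[R]_p) (Y : 'M[R]_q) : X^T *m X = 1%:M -> Y^T *m Y = 1%:M -> \det X = 1 -> \det Y = 1 ->
    OJ eps (block_mx X 0 0 Y) /\ \det (block_mx X 0 0 Y) = 1.
  move=> h1 h2 h3 h4.
  have : K (block_mx X 0 0 Y) by exists X => //; exists Y.
  by move=> /SOp_x_SOqP[].
have E : block_mx A 0 0 B = 1%:M *m block_mx A 0 0 1%:M *m block_mx 1%:M 0 0 B.
  by rewrite mul1mx mulmx_block !mulmx0 !mul0mx !mulmx1 !mul1mx !addr0 !add0r.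
rewrite E.
have O1 m : (1%:M : 'M[R]_m)^T *m 1%:M = 1%:M by rewrite trmx1 mulmx1.
have [kO kd] := OO A 1%:M AO (O1 q) Ad (det1 _ _).
have [lO ld] := OO 1%:M B (O1 p) BO (det1 _ _) Bd.
have supp i j (X : 'M[R]_p) (Y : 'M[R]_q) : (block_mx X 0 0 Y - 1%:M) i j != 0 ->
    [/\ b i = false, b j = false & X != 1%:M] \/ [/\ b i = true, b j = true & Y != 1%:M].
  rewrite (scalar_mx_block p q 1) opp_block_mx add_block_mx !oppr0 !addr0.
  case: (split_ordP i) => k ->; case: (split_ordP j) => l ->;
    rewrite ?block_mxEul ?block_mxEur ?block_mxEdl ?block_mxEdr ?second_block_l ?second_block_r.
  - by move=> h; left; split=> //; apply: contra_neq h => ->; rewrite subrr mxE.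
  - by rewrite mxE eqxx.
  - by rewrite mxE eqxx.
  - by move=> h; right; split=> //; apply: contra_neq h => ->; rewrite subrr mxE.
apply: (H true) => // [|i j nB].
  apply: (H false) => // [|i j nB]; first exact: zc_sub.
  by apply/eqP/negP => /negP /supp[[bi bj _]|[_ _ /eqP]] //; rewrite bi bj in nB.
by apply/eqP/negP => /negP /supp[[_ _ /eqP]|[bi bj _]] //; rewrite bi bj in nB.
Qed.

Lemma dichotomy_closure (S : set M) : S 1%:M -> S `<=` SOpq R p q ->
  ((forall k, OJ eps k -> \det k = 1 -> zc S k) \/
   exists g : M, let S' := conj_image S g (adjJ eps g) in
    [/\ OJ eps g, \det g = 1,
     (forall s, S' s -> commutes S' (P0 true) /\ \det (corner (P0 true) s) = 1) &
     forall c s k, zc S' s -> OJ eps k -> \det k = 1 ->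
       supp_on (fun i => b i == c) (k - 1%:M) -> zc S' (s *m k)]) ->
  zariski_closure S = SOpq R p q \/ conjugate_in (SOpq R p q) (zariski_closure S) K.
Proof.
move=> S1 SG; rewrite zariski_closureE => -[H|[g /= [gO gd H1 H2]]].
  left; apply/seteqP; split=> A; first exact: zc_SOpq SG.
  by move=> /SOpqP[AO Ad]; exact: H.
right; exists g; first exact/SOpqP.
have hg : adjJ eps g *m g = 1%:M by apply/(OJP Heps).
have hO : OJ eps (adjJ eps g) by exact: OJ_adj.
move: (adjJ eps g) hg hO H1 H2 => h hg hO H1 H2; set S' := conj_image S g h in H1 H2.
have gh := mulmx1C hg.
have gU : g \in unitmx by have [] := mulmx1_unit gh.
have hE : h = invmx g by rewrite -[h]mulmx1 -(mulmxV gU) mulmxA hg mul1mx.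
have S'K s : S' s -> K s.
  move=> S's; have [c d] := H1 s S's; apply/SOp_x_SOqP; split=> //.
  - exact: c.
  - by case: S's => x /SG/SOpqP[xO _] ->; apply: OJM => //; exact: OJM.
  - by case: S's => x /SG/SOpqP[_ xd] ->; rewrite !det_mulmx xd mulr1 -det_mulmx hg det1.
have S'1 : S' 1%:M by exists 1%:M => //; rewrite mulmx1 hg.
rewrite -hE; apply/seteqP; split=> A.
  move=> zA; exists (h *m A *m g).
    by apply: (zc_SOp_x_SOq S'K); apply: zc_transport zA => x Sx; exists x.
  by rewrite !mulmxA gh mul1mx -mulmxA gh mulmx1.
move=> [k Kk <-]; have := SOp_x_SOq_sub_zc S'1 H2 Kk.
apply: zc_transport => _ [x Sx ->].
by rewrite !mulmxA gh mul1mx -mulmxA gh mulmx1.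
Qed.

(** Conjugation by an element of SO(p,q) preserves SO(p,q), so equality would put every element of
    SO(p,q) in the block group. *)
Lemma SOpq_not_conjugate (S : set M) : (0 < p)%N -> (0 < q)%N -> zariski_closure S = SOpq R p q ->
  ~ conjugate_in (SOpq R p q) (zariski_closure S) K.
Proof.
move=> p0 q0 -> [g gG E]; have [A AG] := SOpq_neq_SOp_x_SOq R p0 q0; apply.
have [gO gd] := (SOpqP _).1 gG; have [AO Ad] := (SOpqP _).1 AG.
have gU : g \in unitmx by rewrite unitmxE gd unitr1.
have hg : adjJ eps g *m g = 1%:M by apply/(OJP Heps).
have hE : adjJ eps g = invmx g by rewrite -[LHS]mulmx1 -(mulmxV gU) mulmxA hg mul1mx.
have : SOpq R p q (g *m A *m invmx g).
  apply/SOpqP; split; first by rewrite -hE; apply: OJM => //; [exact: OJM|exact: OJ_adj].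
  by rewrite !det_mulmx det_inv gd Ad invr1 !mulr1.
rewrite E => -[k Kk /(congr1 (fun X => invmx g *m X *m g))].
by rewrite !mulmxA mulVmx // !mul1mx -!mulmxA mulVmx // !mulmx1 => <-.
Qed.

End Conclusion.

Theorem theorem1p2 :
  exists N : nat,
  forall (R : realType) (p q : nat) (Gamma : groupType)
    (rho0 : repvar R Gamma p q),
    (N <= p)%N -> (N <= q)%N -> (p < q)%N -> q <> (p + 1)%N ->
    finitely_generated Gamma ->
    rep_image rho0 `<=` SOp_x_SOq R p q ->
    zariski_closure (rep_image rho0) = SOp_x_SOq R p q ->
  exists U : set (repvar R Gamma p q),
    open_nbhs rho0 U /\
    forall rho, U rho ->
      let a := zariski_closure (rep_image rho) = SOpq R p q in
      let b := conjugate_in (SOpq R p q) (zariski_closure (rep_image rho))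
                            (SOp_x_SOq R p q) in
      (a /\ ~ b) \/ (~ a /\ b).
Proof.
exists 5%N => R p q Gamma rho0 p5 q5 pq _ [gs Hgs] img dense.
have p0 : (0 < p)%N by exact: leq_trans p5.
have q0 : (0 < q)%N by exact: leq_trans q5.
have Hblk := second_block_avoid p5 q5.
have rep1 (rho : repvar R Gamma p q) : set_val rho 1%g = 1%:M.
  have [rG rM] := set_valP rho; have [_ d1] := rG 1%g.
  have U1 : set_val rho 1%g \in unitmx by rewrite unitmxE d1 unitr1.
  by rewrite -[LHS](mulKmx U1) -rM mulg1 mulVmx.
have [y1 y1b _] := Hblk true [::] isT; have [y2 y2b _] := Hblk false [::] isT.
pose rep (c : bool) := if c then y1 else y2.
have Hrep c : second_block (rep c) = c by case: c.
have imE (rho : repvar R Gamma p q) : rep_image rho = image_of (set_val rho).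
  by apply/seteqP; split=> A [x]; [move=> _ <-; exists x|move=> ->; exists x].
have rho0K x : SOp_x_SOq R p q (set_val rho0 x) by apply: img; exists x.
have rho0_orth x : (set_val rho0 x)^T *m set_val rho0 x = 1%:M.
  have [A [AO _] [B [BO _] <-]] := rho0K x.
  rewrite tr_block_mx !trmx0 mulmx_block !mulmx0 !mul0mx !addr0 !add0r AO BO.
  by rewrite -scalar_mx_block.
have rho0_det x := let: And4 _ _ _ h := (SOp_x_SOqP _).1 (rho0K x) in h.
have Hpq : #|[pred j : 'I_(p + q) | second_block j == true]| != #|[pred j : 'I_(p + q) | second_block j == false]|.
  by rewrite !card_second_block gtn_eqF.
have Hrot (x y : 'I_(p + q)) t : x != y -> second_block x = second_block y ->
    zc (image_of (set_val rho0)) (rot (@second_block p q) x y t : 'M[R]_(p + q)).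
  move=> xy bxy; have := rot_SOp_x_SOq t xy bxy; rewrite -dense zariski_closureE imE.
  exact.
have [s [dl [dl0 H]]] := local_dichotomy (set_valP rho0).2 (rep1 rho0) rho0_orth rho0_det
  Hblk Hpq Hrep Hrot Hgs p0.
pose U := [set rho : repvar R Gamma p q | forall x, x \in s -> nrm (set_val rho x - set_val rho0 x) <= dl].
(* The inequalities defining [U] are not strict, so its interior is taken. *)
exists (interior U); split.
  by split; [exact: open_interior|exact: nbhs_repvar].
move=> rho /interior_subset Urho a b.
have [rG rM] := set_valP rho.
have D := H (set_val rho) rM (rep1 rho) (fun x => ((SOpqP _).1 (rG x)).1)
  (fun x => ((SOpqP _).1 (rG x)).2) Urho.
have ab : a \/ b.
  apply: dichotomy_closure; rewrite ?imE //.
  - by exists 1%g; rewrite rep1.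
  - by move=> _ [x ->]; exact: rG.
have nab : a -> ~ b by exact: SOpq_not_conjugate.
by case: ab => h; [left; split=> //; exact: nab|right; split=> // /nab].
Qed.
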